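(* For all $f,g\in\mathcal D(\Gamma_0)$ the maps $Q_s$ defined in the context satisfy: \begin{enumerate} \item $Q_0=\mathrm{id}$; \item $\lim_{s\to0}\|Q_s(f^* )-Q_s(f)^{*_s}\|_s=0$; \item $\lim_{s\to0}\|Q_s(f)*_sQ_s(g)-Q_s(f*g)\|_s=0$; \item $\lim_{s\to0}\big\|\tfrac1s[Q_s(f),Q_s(g)]-Q_s(\{f,g\})\big\|_s=0$, where $[Q_s(f),Q_s(g)]=Q_s(f)*_sQ_s(g)-Q_s(g)*_sQ_s(f)$; \item the function $s\mapsto\|Q_s(f)\|_s$ (defined for those $s$ with $f\in D(Q_s)$) is continuous for $s\neq0$ and lower semicontinuous at $s=0$. \end{enumerate}
   Context: $\mathbb R_*=\mathbb R\setminus\{0\}$; $\mathcal D(M)$ = smooth compactly supported complex functions on $M$. For $s\in\mathbb R$ let $\Gamma_s:=\{(b,a)\in\mathbb R\times\mathbb R_*:(1+sb)(a-sb)\neq0\}$, a groupoid over $\mathbb R_*$ with target $a-sb$, source $\frac{a}{1+sb}$, inverse $(b,a)\mapsto\big(\frac{-b}{1+sb},\frac{a-sb}{1+sb}\big)$ and product $(b_1,a_1)(b_2,a_2)=(b_1+(1+sb_1)b_2,(1+sb_1)a_2)$ when $a_1=(1+sb_1)(a_2-sb_2)$. In particular $\Gamma_0=\mathbb R\times\mathbb R_*$. $\mathcal D(\Gamma_s)$ (functions with compact support contained in $\Gamma_s$) is a $*$-algebra with $$(f*_sg)(b,a)=\int\frac{dc}{|1+sc|}\,f(c,a+s(c-b))\,g\Big(\frac{b-c}{1+sc},\frac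 a{1+sc}\Big),\qquad f^{*_s}(b,a)=\overline{f\Big(\frac{-b}{1+sb},\frac{a-sb}{1+sb}\Big)}.$$ For $s=0$ write $*$ and $f^*$: $(f*g)(b,a)=\int dc\,f(c,a)g(b-c,a)$, $f^*(b,a)=\overline{f(-b,a)}$. For $f\in\mathcal D(\Gamma_s)$, $\|f\|_s$ is the norm of the bounded operator $g\mapsto f*_sg$ on $L^2(\mathbb R\times\mathbb R_*,\,db\,da/a^2)$ (the norm of $C^*_r(\Gamma_s)$; the complement of $\Gamma_s$ has measure zero). For $f,g\in\mathcal D(\Gamma_0)$, $\{f,g\}:=(a-1)[(\partial_af)*(bg)-(\partial_ag)*(bf)]$, where $bf$ and $(a-1)f$ denote pointwise multiplication by the coordinate functions. $D(Q_s):=\{f\in\mathcal D(\Gamma_0):f\in\mathcal D(\Gamma_\delta)\text{ for all }|\delta|\le|s|\}$, and $Q_s:D(Q_s)\to\mathcal D(\Gamma_s)$, $Q_s(f):=f$. Each $f\in\mathcal D(\Gamma_0)$ lies in $D(Q_s)$ for all sufficiently small $|s|$, so the limits make sense. *)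

(* Defs.v *)
From HB Require Import structures.
From mathcomp Require Import all_boot all_order all_algebra.
From mathcomp Require Import complex.
From mathcomp Require Import all_classical all_reals all_analysis.

Set Implicit Arguments.
Unset Strict Implicit.
Unset Printing Implicit Defensive.

Import Order.TTheory GRing.Theory Num.Theory.
Import numFieldNormedType.Exports.

Local Open Scope classical_set_scope.
Local Open Scope ring_scope.
Local Open Scope complex_scope.

Section Defs.
Context {R : realType}.

(* Points of R x R are written (b, a).  A function on R x R_* with compact
   support is represented by its extension by zero to R x R, so all the spaces
   of test functions below consist of functions on the whole of R x R. *)

Definition db : R * R := (1, 0).
Definition da : R * R := (0, 1).

Fixpoint Ck (k : nat) (u : R * R -> R) : Prop :=
  continuous u /\
  if k is k'.+1 then
    [/\ forall p, derivable u p db /\ derivable u p da,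
        Ck k' ('D_db u) & Ck k' ('D_da u)]
  else True.

Definition smooth (f : R * R -> R[i]) : Prop :=
  forall k, Ck k (fun p => complex.Re (f p)) /\ Ck k (fun p => complex.Im (f p)).

Definition supp (f : R * R -> R[i]) : set (R * R) := closure [set p | f p != 0].

Definition RxRstar : set (R * R) := [set p | p.2 != 0].

Definition Gamma (s : R) : set (R * R) :=
  RxRstar `&` [set p | (1 + s * p.1) * (p.2 - s * p.1) != 0].

Definition testfun (s : R) : set (R * R -> R[i]) :=
  [set f | [/\ smooth f, compact (supp f) & supp f `<=` Gamma s]].

Definition Cintegral (F : R -> R[i]) : R[i] :=
  (\int[lebesgue_measure]_c complex.Re (F c)) +i*
  (\int[lebesgue_measure]_c complex.Im (F c)).

(* Where a denominator vanishes, x / 0 = 0 is harmless for f in testfun s: in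
   convol the factor f (c, _) is then 0, and star evaluates f at (0, 0), where
   it is 0 as well. *)
Definition convol (s : R) (f g : R * R -> R[i]) (p : R * R) : R[i] :=
  let: (b, a) := p in
  Cintegral (fun c => (`|1 + s * c|^-1)%:C * f (c, a + s * (c - b)) *
                      g ((b - c) / (1 + s * c), a / (1 + s * c))).

Definition star (s : R) (f : R * R -> R[i]) (p : R * R) : R[i] :=
  let: (b, a) := p in
  (f (- b / (1 + s * b), (a - s * b) / (1 + s * b)))^*.

Definition convol_comm (s : R) (f g : R * R -> R[i]) : R * R -> R[i] :=
  convol s f g \- convol s g f.

Definition partial_a (f : R * R -> R[i]) (p : R * R) : R[i] :=
  ('D_da (fun q => complex.Re (f q)) p) +i* ('D_da (fun q => complex.Im (f q)) p).

Definition mulb (f : R * R -> R[i]) (p : R * R) : R[i] := p.1%:C * f p.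

Definition bracket (f g : R * R -> R[i]) (p : R * R) : R[i] :=
  (p.2 - 1)%:C *
  (convol 0 (partial_a f) (mulb g) p - convol 0 (partial_a g) (mulb f) p).

Definition L2norm (g : R * R -> R[i]) : \bar R :=
  ((\int[(lebesgue_measure \x lebesgue_measure)%E]_(p in RxRstar)
     (ComplexField.Normc.normc (g p) ^+ 2 / p.2 ^+ 2)%:E) `^ 2^-1)%E.

Definition L2 : set (R * R -> R[i]) :=
  [set g | [/\ measurable_fun RxRstar (fun p => complex.Re (g p)),
               measurable_fun RxRstar (fun p => complex.Im (g p)) &
               (L2norm g < +oo)%E]].

(* The operator norm of g |-> convol s f g on L^2(R x R_*, db da / a^2), as an
   extended real: it is finite exactly when the operator is bounded. *)
Definition opnorm (s : R) (f : R * R -> R[i]) : \bar R :=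
  ereal_sup [set L2norm (convol s f g) | g in L2 `&` [set g | (L2norm g <= 1)%E]].

Definition domQ (s : R) : set (R * R -> R[i]) :=
  [set f | testfun 0 f /\ forall d : R, `|d| <= `|s| -> testfun d f].

(* The partial map Q_s : D(Q_s) -> D(Gamma_s), f |-> f, totalized by the junk
   value 0 outside of D(Q_s). *)
Definition Q (s : R) (f : R * R -> R[i]) : R * R -> R[i] :=
  if `[< domQ s f >] then f else (fun=> 0).

End Defs.

(* Main.v *)
(* Every operator norm is controlled by one estimate: if h is bounded by A and
   supported in |b| <= M, and 1 + s c >= e for |c| <= M, then ||h||_s <= 3 M A / e,
   by Cauchy-Schwarz in c and the fact that each substitution
   (b, a) -> ((b - c)/(1 + s c), a/(1 + s c)) preserves the measure db da/a^2.

   For the first three limits it then suffices to estimate sup norms.  The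
   integrand of f *_s g is expanded to first order in s with remainder O(s^2),
   uniformly in (b, a, c); the first-order term, antisymmetrized in f and g,
   differs from the bracket by the integral of the total derivative of
   c (b - c) f(c, a) g(b - c, a) in c.

   For s0 <> 0 the dilation b -> (s / s0) b conjugates *_s with *_s0, so that
   ||f||_s = (s0 / s) ||f((s0 / s) b, a)||_s0, which depends continuously on s
   by the norm estimate.

   At 0 the map s -> f *_s g is continuous in L^2 for fixed g, so ||f||_s is a
   supremum of functions continuous at 0.  The strong continuity rests on that
   of the translations above: Scheffe's argument gives it for indicators of open
   sets, the pi-lambda theorem for indicators of Borel sets, and L^2
   approximation in general. *)
Require Import Defs.
From HB Require Import structures.
From mathcomp Require Import all_boot all_order all_algebra.
From mathcomp Require Import complex ring lra.
From mathcomp Require Import all_classical all_reals all_analysis.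
From mathcomp Require Import measurable_realfun.
Set Implicit Arguments. Unset Strict Implicit. Unset Printing Implicit Defensive.
Import Order.TTheory GRing.Theory Num.Theory.
Import numFieldNormedType.Exports.
Local Open Scope classical_set_scope.
Local Open Scope ring_scope.
Local Open Scope complex_scope.

(** * Smooth functions on the plane *)

(** [Cintegral] assigns a value to every integrand, and for [g] in [L2] the integral defining
    [convol s f g] may diverge at some points. Norm bounds are therefore drawn from a monotonicity
    of the integral that is valid without measurability. Additivity in [f], in contrast, holds only
    almost everywhere; it is obtained by viewing the integrand as one square-integrable function of
    [(c, (b, a))], supported in |c| <= M, and applying Tonelli. The same space of triples carries
    the strong continuity: the translates are compared after integration over [c] as well, so that
    one identity of masses and one dominated convergence treat all [c] at once. The parameter 0 is
    exceptional because the dilation by lam takes the parameter s to lam s: it links nonzero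
    parameters of equal sign and fixes 0. Away from 0 only [f] moves and the product stays, which
    gives estimates uniform in the test vector. At 0 the convergence is for each test vector
    separately, whence semicontinuity only. *)

Section SmoothFunctions.
Context {R : realType}.
Implicit Types (u v : R * R -> R) (k : nat) (M e : R).

Lemma continuous_pairf (T : topologicalType) (f g : T -> R) :
  continuous f -> continuous g -> continuous (fun p => (f p, g p)).
Proof. by move=> cf cg p; exact: (cvg_pair (cf p) (cg p)). Qed.

(** A displacement along [db] leaves the second coordinate alone, so the difference quotient in the
    plane is that of a slice; one-variable calculus then applies to partial derivatives. *)
Let quotient_db u b a :
  (fun h : R => h^-1 *: ((u \o shift (b, a)) (h *: db) - u (b, a))) =
  (fun h => h^-1 *: (((fun x => u (x, a)) \o shift b) (h *: 1) - u (b, a))).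
Proof.
apply/funext => h /=; congr (_ *: (u _ - _)).
transitivity (h * 1 + b, h * 0 + a) => //.
by rewrite mulr0 add0r.
Qed.

Let quotient_da u b a :
  (fun h : R => h^-1 *: ((u \o shift (b, a)) (h *: da) - u (b, a))) =
  (fun h => h^-1 *: (((fun x => u (b, x)) \o shift a) (h *: 1) - u (b, a))).
Proof.
apply/funext => h /=; congr (_ *: (u _ - _)).
transitivity (h * 0 + b, h * 1 + a) => //.
by rewrite mulr0 add0r.
Qed.

Lemma derivable_dbE u b a :
  derivable u (b, a) db = derivable (fun x => u (x, a)) b 1.
Proof. by rewrite /derivable quotient_db. Qed.

Lemma derivable_daE u b a :
  derivable u (b, a) da = derivable (fun x => u (b, x)) a 1.
Proof. by rewrite /derivable quotient_da. Qed.

Lemma derive_dbE u b a : 'D_db u (b, a) = 'D_1 (fun x => u (x, a)) b.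
Proof. by rewrite /derive quotient_db. Qed.

Lemma derive_daE u b a : 'D_da u (b, a) = 'D_1 (fun x => u (b, x)) a.
Proof. by rewrite /derive quotient_da. Qed.

Lemma CkSE k u : Ck k.+1 u <-> continuous u /\
  [/\ forall p, derivable u p db /\ derivable u p da, Ck k ('D_db u) & Ck k ('D_da u)].
Proof. by []. Qed.

Lemma CkS k u : Ck k.+1 u -> Ck k u.
Proof.
elim: k u => [|k IH] u /CkSE [cu [du ub ua]]; first by [].
by apply/CkSE; split=> //; split; [exact: du|apply: (IH _ ub)|apply: (IH _ ua)].
Qed.

Lemma Ck_continuous k u : Ck k u -> continuous u.
Proof. by case: k => [|k] []. Qed.

Lemma Ck_cst k (r : R) : Ck k (fun=> r : R).
Proof.
elim: k r => [|k IH] r; split=> //=; try by move=> x; exact: cvg_cst.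
have H (v : (R * R)%type) : 'D_v (fun _ : R * R => r) = (fun=> 0 : R).
  by apply/funext => x; rewrite derive_cst.
by split => [p||]; rewrite ?H //; split; exact: derivable_cst.
Qed.

Lemma Ck_fst k : Ck k (fst : R * R -> R).
Proof.
have cf : continuous (fst : R * R -> R) by move=> p; exact: cvg_fst.
case: k => [|k]; split=> //.
split => [[b a]||].
- rewrite derivable_dbE derivable_daE /=; split; [exact: derivable_id|exact: derivable_cst].
- rewrite (_ : 'D_db _ = fun=> (1 : R)); first exact: Ck_cst.
  by apply/funext => -[b a]; rewrite derive_dbE /= derive_id.
- rewrite (_ : 'D_da _ = fun=> (0 : R)); first exact: Ck_cst.
  by apply/funext => -[b a]; rewrite derive_daE /= derive_cst.
Qed.

Lemma Ck_snd k : Ck k (snd : R * R -> R).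
Proof.
have cf : continuous (snd : R * R -> R) by move=> p; exact: cvg_snd.
case: k => [|k]; split=> //.
split => [[b a]||].
- rewrite derivable_dbE derivable_daE /=; split; [exact: derivable_cst|exact: derivable_id].
- rewrite (_ : 'D_db _ = fun=> (0 : R)); first exact: Ck_cst.
  by apply/funext => -[b a]; rewrite derive_dbE /= derive_cst.
- rewrite (_ : 'D_da _ = fun=> (1 : R)); first exact: Ck_cst.
  by apply/funext => -[b a]; rewrite derive_daE /= derive_id.
Qed.

Lemma CkD k u v : Ck k u -> Ck k v -> Ck k (u \+ v).
Proof.
elim: k u v => [|k IH] u v.
  by move=> [cu _] [cv _]; split=> // x; apply: cvgD; [exact: cu|exact: cv].
move=> /CkSE[cu [du ub ua]] /CkSE[cv [dv vb va]]; apply/CkSE.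
split; first by move=> x; apply: cvgD; [exact: cu|exact: cv].
have H w : (forall p, derivable u p w) -> (forall p, derivable v p w) ->
    'D_w (u \+ v) = 'D_w u \+ 'D_w v.
  by move=> hu hv; apply/funext => p; rewrite deriveD.
split.
- by move=> p; split; apply: derivableD; [apply (du p).1|apply (dv p).1|apply (du p).2|apply (dv p).2].
- by rewrite H; [exact: IH|move=> p; apply (du p).1|move=> p; apply (dv p).1].
- by rewrite H; [exact: IH|move=> p; apply (du p).2|move=> p; apply (dv p).2].
Qed.

Lemma CkM k u v : Ck k u -> Ck k v -> Ck k (u \* v).
Proof.
elim: k u v => [|k IH] u v.
  by move=> [cu _] [cv _]; split=> // x; apply: cvgM; [exact: cu|exact: cv].
move=> Hu Hv; have /CkSE[cu [du ub ua]] := Hu; have /CkSE[cv [dv vb va]] := Hv.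
apply/CkSE.
split; first by move=> x; apply: cvgM; [exact: cu|exact: cv].
have H w : (forall p, derivable u p w) -> (forall p, derivable v p w) ->
    'D_w (u \* v) = (u \* 'D_w v) \+ (v \* 'D_w u).
  by move=> hu hv; apply/funext => p; rewrite deriveM.
split.
- by move=> p; split; apply: derivableM; [apply (du p).1|apply (dv p).1|apply (du p).2|apply (dv p).2].
- rewrite H; [|by move=> p; apply (du p).1|by move=> p; apply (dv p).1].
  by apply: CkD; apply: IH => //; exact: CkS.
- rewrite H; [|by move=> p; apply (du p).2|by move=> p; apply (dv p).2].
  by apply: CkD; apply: IH => //; exact: CkS.
Qed.

Lemma CkN k u : Ck k u -> Ck k (fun p => - u p).
Proof.
move=> Hu; rewrite (_ : (fun _ => _) = (fun=> -1) \* u).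
  by apply: CkM => //; exact: Ck_cst.
by apply/funext => p /=; rewrite mulN1r.
Qed.

Lemma CkB k u v : Ck k u -> Ck k v -> Ck k (u \- v).
Proof. by move=> Hu Hv; apply: (CkD Hu); exact: CkN. Qed.

Lemma derivable_oppr (f : R -> R) x :
  derivable f (- x) 1 -> is_derive x 1 (fun y => f (- y)) (- 'D_1 f (- x)).
Proof.
move=> df.
have H : is_derive (- x) 1 f ('D_1 f (- x)) by exact: derivableP.
have Ho : is_derive x 1 (-%R : R -> R) (- 1) by exact: is_deriveNid.
have := @is_derive1_comp _ f (-%R) x _ _ H Ho.
by rewrite mulrN1.
Qed.

(** Serves the involution at [s = 0], which evaluates at [(- b, a)]. Each derivative in [b] only
    adds a sign, so the induction runs over all [u]. *)
Lemma Ck_reflect k u : Ck k u -> Ck k (fun p => u (- p.1, p.2)).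
Proof.
have cr : continuous (fun p : R * R => (- p.1, p.2)).
  by apply: continuous_pairf; [move=> p; apply: cvgN; exact: cvg_fst|move=> p; exact: cvg_snd].
elim: k u => [|k IH] u.
  move=> [cu _]; split=> // p.
  apply: (@continuous_comp _ _ _ (fun p : R * R => (- p.1, p.2)) u); last exact: cu.
  exact: cr.
move=> /CkSE[cu [du ub ua]]; apply/CkSE; split.
  move=> p; apply: (@continuous_comp _ _ _ (fun p : R * R => (- p.1, p.2)) u); last exact: cu.
  exact: cr.
have D (b a : R) : is_derive b 1 (fun x : R => u (- x, a)) (- 'D_db u (- b, a)).
  rewrite derive_dbE; apply: (@derivable_oppr (fun x => u (x, a))).
  by rewrite -derivable_dbE; apply (du _).1.
split.
- case=> b a; rewrite derivable_dbE derivable_daE /=; split.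
    by have [] := D b a.
  by rewrite -(derivable_daE u); apply (du _).2.
- have -> : 'D_db (fun p : R * R => u (- p.1, p.2)) = (fun p : R * R => - ('D_db u) (- p.1, p.2)); last exact: CkN (IH _ ub).
  by apply/funext => -[b a]; rewrite derive_dbE /=; have [_ ->] := D b a.
- have -> : 'D_da (fun p : R * R => u (- p.1, p.2)) = (fun p : R * R => ('D_da u) (- p.1, p.2)); last exact: (IH _ ua).
  by apply/funext => -[b a]; rewrite !derive_daE.
Qed.

End SmoothFunctions.

(** * Functions supported in a box away from the b-axis *)

Section Boxed.
Context {R : realType}.
Implicit Types (u v : R * R -> R) (k : nat) (M e : R).

(** A condition on nonvanishing points instead of on [supp]: it passes to real and imaginary parts,
    products and derivatives without handling closures. Since the three bounds are closed
    conditions, the support satisfies them too. *)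
Definition boxed (V : nmodType) M e (f : R * R -> V) :=
  forall p, f p != 0 -> [/\ `|p.1| <= M, `|p.2| <= M & e <= `|p.2|].

Lemma boxed_le (V : nmodType) M e M' e' (f : R * R -> V) :
  M <= M' -> e' <= e -> boxed M e f -> boxed M' e' f.
Proof.
move=> MM ee H p /H [h1 h2 h3]; split; [exact: le_trans h1 MM|exact: le_trans h2 MM|exact: le_trans h3].
Qed.

Lemma boxedW (V : nmodType) M e (f : R * R -> V) p :
  boxed M e f -> M < `|p.1| \/ M < `|p.2| \/ `|p.2| < e -> f p = 0.
Proof.
move=> H h; apply/eqP; apply: contraPT h => /H [h1 h2 h3].
by case=> [|[]]; rewrite ltNge ?h1 ?h2 ?h3.
Qed.

(** The complement of the box is open, so [u] vanishes near each of its points, and so does the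
    derivative there. *)
Lemma boxed_derive M e u (w : (R * R)%type) : boxed M e u -> boxed M e ('D_w u).
Proof.
move=> H p; apply: contraNP => /not_and3P h.
have c1 : `|q.1| @[q --> p] --> `|p.1| by apply: cvg_norm; exact: cvg_fst.
have c2 : `|q.2| @[q --> p] --> `|p.2| by apply: cvg_norm; exact: cvg_snd.
have u0 : \forall q \near p, u q = 0.
  case: h => /negP; rewrite -ltNge => h.
  - by apply: filterS (cvgr_gt _ c1 _ h) => q hq; apply: (boxedW H); left.
  - by apply: filterS (cvgr_gt _ c2 _ h) => q hq; apply: (boxedW H); right; left.
  - by apply: filterS (cvgr_lt _ c2 _ h) => q hq; apply: (boxedW H); right; right.
rewrite (@near_eq_derive _ _ _ u (fun=> 0) p w) ?derive_cst //.
Qed.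

Lemma boxed_bounded M e u : boxed M e u -> continuous u ->
  exists A : R, 0 <= A /\ forall p, `|u p| <= A.
Proof.
move=> bu cu.
have cpt : compact (`[-M, M] `*` `[-M, M]) by apply: compact_setX; exact: segment_compact.
have /compact_bounded[A [_ HA]] : compact (u @` (`[-M, M] `*` `[-M, M])).
  by apply: continuous_compact => //; exact: continuous_subspaceT.
exists (`|A| + 1); split => [|p]; first by rewrite addr_ge0.
have [->|/bu[h1 h2 _]] := eqVneq (u p) 0; first by rewrite normr0 addr_ge0.
apply: (HA (`|A| + 1)); first by rewrite ltr_pwDr// ler_norm.
by exists p => //; split; rewrite /= in_itv /= -ler_norml.
Qed.

Lemma MVT_lipschitz (f : R -> R) L : (forall x, derivable f x 1) ->
  (forall x, `|'D_1 f x| <= L) -> forall x y, `|f x - f y| <= L * `|x - y|.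
Proof.
move=> df fL.
suff H x y : x <= y -> `|f x - f y| <= L * `|x - y|.
  move=> x y; have [/H//|/ltW/H] := leP x y.
  by rewrite distrC (distrC y).
move=> xy.
have [|c _ E] := @MVT_segment _ f ('D_1 f) x y xy (fun x _ => derivableP (df x)).
  by apply: derivable_within_continuous => z _; exact: df.
by rewrite distrC E normrM (distrC x) ler_wpM2r.
Qed.

(** The two points are joined by a horizontal and a vertical segment, with the mean value theorem on
    each. *)
Lemma lipschitz_from_derivatives u L : Ck 1 u ->
  (forall p, `|'D_db u p| <= L) -> (forall p, `|'D_da u p| <= L) ->
  forall p q, `|u p - u q| <= L * (`|p.1 - q.1| + `|p.2 - q.2|).
Proof.
move=> /CkSE[cu [du _ _]] h1 h2 [b a] [b' a'] /=.
have -> : u (b, a) - u (b', a') = (u (b, a) - u (b', a)) + (u (b', a) - u (b', a')) by ring.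
rewrite mulrDr (le_trans (ler_normD _ _))// lerD//.
- apply: (@MVT_lipschitz (fun x => u (x, a))) => x.
    by rewrite -derivable_dbE; apply (du _).1.
  by rewrite -derive_dbE.
- apply: (@MVT_lipschitz (fun x => u (b', x))) => x.
    by rewrite -derivable_daE; apply (du _).2.
  by rewrite -derive_daE.
Qed.

Lemma boxed_lipschitz M e u : boxed M e u -> Ck 1 u ->
  exists L : R, 0 <= L /\ forall p q, `|u p - u q| <= L * (`|p.1 - q.1| + `|p.2 - q.2|).
Proof.
move=> bu cu; have /CkSE[_ [_ [cb _] [ca _]]] := cu.
have [A [A0 hA]] := boxed_bounded (boxed_derive (w := db) bu) cb.
have [B [B0 hB]] := boxed_bounded (boxed_derive (w := da) bu) ca.
exists (A + B); split; first by rewrite addr_ge0.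
apply: lipschitz_from_derivatives => // p.
  by rewrite (le_trans (hA p))// lerDl.
by rewrite (le_trans (hB p))// lerDr.
Qed.

Lemma lipschitz_continuous2 u L :
  (forall p q, `|u p - u q| <= L * (`|p.1 - q.1| + `|p.2 - q.2|)) -> continuous u.
Proof.
move=> H p.
suff : L * (`|q.1 - p.1| + `|q.2 - p.2|) @[q --> p] --> L * (0 + 0).
  rewrite addr0 mulr0 => h; apply/cvgrPdist_le => e e0.
  move/cvgrPdist_le : h => /(_ _ e0); apply: filterS => q.
  rewrite sub0r normrN => /(le_trans (ler_norm _)); apply: le_trans.
  by rewrite distrC H.
have c1 : `|q.1 - p.1| @[q --> p] --> 0.
  by rewrite -(normr0 R) -(subrr p.1); apply: cvg_norm; apply: cvgB; [exact: cvg_fst|exact: cvg_cst].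
have c2 : `|q.2 - p.2| @[q --> p] --> 0.
  by rewrite -(normr0 R) -(subrr p.2); apply: cvg_norm; apply: cvgB; [exact: cvg_snd|exact: cvg_cst].
by apply: cvgM; [exact: cvg_cst|exact: cvgD].
Qed.

Lemma integrable_of_compact (F : R -> R) M : continuous F ->
  (forall c, M < `|c| -> F c = 0) -> lebesgue_measure.-integrable setT (EFin \o F).
Proof.
move=> cF F0.
have : lebesgue_measure.-integrable `[-M, M] (EFin \o F).
  by apply: continuous_compact_integrable; [exact: segment_compact|exact: continuous_subspaceT].
move=> h.
have mI : measurable (`[-M, M]%classic : set (measurableTypeR R)) by exact: measurable_itv.
have := (@integrable_mkcond _ _ R (@lebesgue_measure R) _ (EFin \o F) mI).1 h.
congr (_.-integrable _ _); apply/funext => c; rewrite /patch.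
case: ifPn => //; rewrite notin_setE /= in_itv /= -ler_norml => /negP.
by rewrite -ltNge => /F0 ->.
Qed.

Lemma Rintegral_itv_sym (F : R -> R) M : (forall c, M < `|c| -> F c = 0) ->
  \int[lebesgue_measure]_c F c = \int[lebesgue_measure]_(c in `[-M, M]) F c.
Proof.
move=> F0; rewrite [RHS]Rintegral_mkcond; apply: eq_Rintegral => c _.
rewrite /patch.
case: ifPn => //; rewrite notin_setE /= in_itv /= -ler_norml => /negP.
by rewrite -ltNge => /F0 ->.
Qed.

Lemma Rintegral_itv_sym_cst M (C : R) : 0 <= M ->
  \int[lebesgue_measure]_(c in `[-M, M]) C = 2 * M * C.
Proof.
move=> M0; rewrite Rintegral_cst //= lebesgue_measure_itv /=.
case: ifPn; rewrite lte_fin.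
  by move=> _ /=; rewrite opprK mulrC; congr (_ * _); rewrite mulr_natl mulr2n.
rewrite -leNgt => h; have -> : M = 0.
  by apply/eqP; rewrite eq_le M0 andbT; lra.
by rewrite /= !mulr0 mul0r.
Qed.

Lemma Rintegral_compact_bound (F : R -> R) M C : 0 <= M -> continuous F ->
  (forall c, M < `|c| -> F c = 0) -> (forall c, `|F c| <= C) ->
  `|\int[lebesgue_measure]_c F c| <= 2 * M * C.
Proof.
move=> M0 cF F0 FC; have iF := integrable_of_compact cF F0.
rewrite (le_trans (le_normr_Rintegral _ iF))//.
rewrite (@Rintegral_itv_sym _ M); last by move=> c /F0 ->; rewrite normr0.
rewrite -Rintegral_itv_sym_cst //; apply: le_Rintegral => //.
- apply: continuous_compact_integrable; first exact: segment_compact.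
  by apply: continuous_subspaceT => c; apply: cvg_norm; exact: cF.
- apply: continuous_compact_integrable; first exact: segment_compact.
  by apply: continuous_subspaceT => c; exact: cvg_cst.
Qed.

(** The convolution at [s = 0] for real functions; four of these make up the complex one, see
    [convol0E]. *)
Definition fconv u v (p : R * R) : R :=
  \int[lebesgue_measure]_c (u (c, p.2) * v (p.1 - c, p.2)).

Lemma continuous_conv_integrand u v (b a : R) : continuous u -> continuous v ->
  continuous (fun c : R => u (c, a) * v (b - c, a)).
Proof.
move=> cu cv c; apply: cvgM.
- apply: (@continuous_comp _ _ _ (fun c : R => (c, a)) u); last exact: cu.
  by apply: continuous_pairf => x; [exact: cvg_id|exact: cvg_cst].
- apply: (@continuous_comp _ _ _ (fun c : R => (b - c, a)) v); last exact: cv.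
  apply: continuous_pairf => x; last exact: cvg_cst.
  by apply: cvgB; [exact: cvg_cst|exact: cvg_id].
Qed.

Lemma conv_integrable M e u v b a : boxed M e u -> continuous u -> continuous v ->
  lebesgue_measure.-integrable setT (EFin \o (fun c => u (c, a) * v (b - c, a))).
Proof.
move=> bu cu cv; apply: (@integrable_of_compact _ M).
  exact: continuous_conv_integrand.
by move=> c h; rewrite (boxedW bu) ?mul0r//; left.
Qed.

(** The integrand forces |c| <= M and |b - c| <= M, hence |b| <= 2 M, while both factors see the
    same [a]. *)
Lemma boxed_conv M e u v : boxed M e u -> boxed M e v -> boxed (M + M) e (fconv u v).
Proof.
move=> bu bv [b a]; rewrite /fconv /=; apply: contraNP => /not_and3P h.
apply/eqP; rewrite -[RHS](Rintegral_set0 (@lebesgue_measure R) (fun=> 0)).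
rewrite (_ : \int[_]_(x in set0) 0 = \int[lebesgue_measure]_x 0); last first.
  by rewrite Rintegral_mkcond; apply: eq_Rintegral => c _; rewrite /patch; case: ifP.
apply: eq_Rintegral => c _.
have [|cM] := ltP M `|c|; first by move=> h'; rewrite (boxedW bu) ?mul0r//; left.
case: h => /negP; rewrite -ltNge => h.
- rewrite (boxedW bv) ?mulr0 //; left => /=.
  by have := ler_normD (b - c) c; rewrite subrK; lra.
- have M0 : 0 <= M by exact: le_trans cM.
  by rewrite (boxedW bu) ?mul0r//; right; left => /=; lra.
- by rewrite (boxedW bu) ?mul0r//; right; right.
Qed.

Lemma conv_lipschitz M e u v : 0 <= M -> boxed M e u -> boxed M e v ->
  Ck 1 u -> Ck 1 v ->
  exists L : R, 0 <= L /\ forall p q, `|fconv u v p - fconv u v q| <= L * (`|p.1 - q.1| + `|p.2 - q.2|).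
Proof.
move=> M0 bu bv su sv.
have cu := Ck_continuous su; have cv := Ck_continuous sv.
have [A [A0 hA]] := boxed_bounded bu cu.
have [B [B0 hB]] := boxed_bounded bv cv.
have [Lu [Lu0 hLu]] := boxed_lipschitz bu su.
have [Lv [Lv0 hLv]] := boxed_lipschitz bv sv.
exists (2 * M * (Lu * B + A * Lv)); split; first by rewrite !(mulr_ge0, addr_ge0).
move=> [b a] [b' a'] /=; rewrite /fconv /= -(RintegralB measurableT (conv_integrable b a bu cu cv) (conv_integrable b' a' bu cu cv)).
rewrite -(mulrA (2 * M)); apply: Rintegral_compact_bound => //.
- by move=> c; apply: cvgB; exact: continuous_conv_integrand.
- by move=> c h; rewrite !(boxedW bu) ?mul0r ?subrr//; left.
- move=> c.
  have -> : u (c, a) * v (b - c, a) - u (c, a') * v (b' - c, a') =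
    (u (c, a) - u (c, a')) * v (b - c, a) + u (c, a') * (v (b - c, a) - v (b' - c, a')) by ring.
  rewrite (le_trans (ler_normD _ _))// !normrM mulrDl lerD//.
    rewrite mulrAC ler_pM // (le_trans (hLu _ _)) //= subrr normr0 add0r.
    by rewrite ler_wpM2l // lerDr.
  rewrite -mulrA ler_pM // (le_trans (hLv _ _)) //=.
  by rewrite (_ : b - c - (b' - c) = b - b')//; ring.
Qed.

Lemma conv_continuous M e u v : 0 <= M -> boxed M e u -> boxed M e v ->
  Ck 1 u -> Ck 1 v -> continuous (fconv u v).
Proof.
move=> M0 bu bv su sv; have [L [_ HL]] := conv_lipschitz M0 bu bv su sv.
exact: lipschitz_continuous2 HL.
Qed.


(** Differentiation under the integral sign. Cutting the integral down to [-M, M] makes the constant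
    [C] an integrable majorant of the derivative on the interval of radius 1 around [a]. *)
Let derivable_conv_aux (f : R -> R -> R) (M C a : R) : 0 <= C ->
  (forall x, continuous (f x)) -> (forall c x, derivable (f ^~ c) x 1) ->
  (forall x c, M < `|c| -> f x c = 0) ->
  (forall x c, `|x - a| < 1 -> `|'D_1 (f ^~ c) x| <= C) ->
  derivable (fun x => \int[lebesgue_measure]_c f x c) a 1 /\
  'D_1 (fun x => \int[lebesgue_measure]_c f x c) a =
    \int[lebesgue_measure]_c ('D_1 (f ^~ c) a).
Proof.
move=> C0 cf df f0 fC.
have E : (fun x => \int[lebesgue_measure]_c f x c) =
    (fun x => \int[lebesgue_measure]_(c in `[-M, M]) f x c).
  by apply/funext => x; apply: Rintegral_itv_sym => c; exact: f0.
have Ia : `]a - 1, a + 1[%classic a by rewrite /= in_itv /=; apply/andP; split; lra.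
have intf x : `]a - 1, a + 1[%classic x ->
    lebesgue_measure.-integrable `[-M, M] (EFin \o f x).
  by move=> _; apply: continuous_compact_integrable; [exact: segment_compact|exact: continuous_subspaceT].
have iG : lebesgue_measure.-integrable `[-M, M] (EFin \o (fun _ : R => C)).
  apply: continuous_compact_integrable; first exact: segment_compact.
  by apply: continuous_subspaceT => c; exact: cvg_cst.
have dC x y : `]a - 1, a + 1[%classic x -> `[-M, M]%classic y ->
    `|partial1of2 f x y| <= C.
  rewrite /= in_itv /= => /andP[x1 x2] _; rewrite partial1of2E; apply: fC.
  by rewrite ltr_norml; apply/andP; split; lra.
rewrite E; have mI : measurable (`[-M, M]%classic : set (measurableTypeR R)) by exact: measurable_itv.
split.
  exact: (derivable_under_integral mI Ia intf (fun x y _ _ => df y x) (fun=> C0) iG dC).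
rewrite -derive1E.
rewrite (differentiation_under_integral mI Ia intf (fun x y _ _ => df y x) (fun=> C0) iG dC).
rewrite [RHS](@Rintegral_itv_sym _ M).
  by apply: eq_Rintegral => c _; rewrite /= partial1of2E.
move=> c h; rewrite (_ : f ^~ c = fun=> 0) ?derive_cst //.
by apply/funext => x; exact: f0.
Qed.

Lemma conv_db M e u v : 0 <= M -> boxed M e u -> boxed M e v ->
  Ck 1 u -> Ck 1 v ->
  forall p, derivable (fconv u v) p db /\ 'D_db (fconv u v) p = fconv u ('D_db v) p.
Proof.
move=> M0 bu bv su sv [b a].
have cu := Ck_continuous su; have cv := Ck_continuous sv.
have [A [A0 hA]] := boxed_bounded bu cu.
have /CkSE[_ [dv [cdv _] _]] := sv.
have [B [B0 hB]] := boxed_bounded (boxed_derive (w := db) bv) cdv.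
rewrite derivable_dbE derive_dbE /fconv /=.
have D (x c : R) : is_derive x 1 (fun x : R => u (c, a) * v (x - c, a)) (u (c, a) * 'D_db v (x - c, a)).
  have Hs : is_derive x 1 (fun x : R => v (x - c, a)) ('D_db v (x - c, a)).
    have Hi : is_derive (x - c) 1 (fun y : R => v (y, a)) ('D_db v (x - c, a)).
      by rewrite derive_dbE; apply: derivableP; rewrite -derivable_dbE; apply (dv _).1.
    have Ho : is_derive x 1 (fun y : R => y - c) 1 by apply: is_derive_shift.
    have := @is_derive1_comp _ (fun y => v (y, a)) (fun y => y - c) x _ _ Hi Ho.
    by rewrite mulr1.
  exact: is_deriveZ.
have D1 (x c : R) : 'D_1 (fun x : R => u (c, a) * v (x - c, a)) x = u (c, a) * 'D_db v (x - c, a).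
  by have [_] := D x c.
have f0 (x c : R) : M < `|c| -> u (c, a) * v (x - c, a) = 0.
  by move=> h; rewrite (boxedW bu) ?mul0r//; left.
have fC (x c : R) : `|x - b| < 1 -> `|'D_1 (fun x : R => u (c, a) * v (x - c, a)) x| <= A * B.
  by move=> _; rewrite D1 normrM ler_pM.
have [d1 d2] := @derivable_conv_aux (fun x c => u (c, a) * v (x - c, a)) M (A * B) b
  (mulr_ge0 A0 B0) (fun x => @continuous_conv_integrand u v x a cu cv)
  (fun c x => let: DeriveDef h _ := D x c in h) f0 fC.
split; first exact: d1.
rewrite d2; apply: eq_Rintegral => c _; exact: D1.
Qed.

Lemma conv_da M e u v : 0 <= M -> boxed M e u -> boxed M e v ->
  Ck 1 u -> Ck 1 v ->
  forall p, derivable (fconv u v) p da /\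
    'D_da (fconv u v) p = fconv ('D_da u) v p + fconv u ('D_da v) p.
Proof.
move=> M0 bu bv su sv [b a].
have cu := Ck_continuous su; have cv := Ck_continuous sv.
have [A [A0 hA]] := boxed_bounded bu cu.
have [A' [A'0 hA']] := boxed_bounded bv cv.
have /CkSE[_ [dv _ [cdv _]]] := sv.
have /CkSE[_ [du _ [cdu _]]] := su.
have [B [B0 hB]] := boxed_bounded (boxed_derive (w := da) bu) cdu.
have [B' [B'0 hB']] := boxed_bounded (boxed_derive (w := da) bv) cdv.
rewrite derivable_daE derive_daE /fconv /=.
have D (x c : R) : is_derive x 1 (fun x : R => u (c, x) * v (b - c, x))
    (u (c, x) * 'D_da v (b - c, x) + v (b - c, x) * 'D_da u (c, x)).
  have H1 : is_derive x 1 (fun x : R => u (c, x)) ('D_da u (c, x)).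
    by rewrite derive_daE; apply: derivableP; rewrite -derivable_daE; apply (du _).2.
  have H2 : is_derive x 1 (fun x : R => v (b - c, x)) ('D_da v (b - c, x)).
    by rewrite derive_daE; apply: derivableP; rewrite -derivable_daE; apply (dv _).2.
  exact: is_deriveM.
have D1 (x c : R) : 'D_1 (fun x : R => u (c, x) * v (b - c, x)) x =
    u (c, x) * 'D_da v (b - c, x) + v (b - c, x) * 'D_da u (c, x).
  by have [_] := D x c.
have f0 (x c : R) : M < `|c| -> u (c, x) * v (b - c, x) = 0.
  by move=> h; rewrite (boxedW bu) ?mul0r//; left.
have fC (x c : R) : `|x - a| < 1 -> `|'D_1 (fun x : R => u (c, x) * v (b - c, x)) x| <= A * B' + A' * B.
  by move=> _; rewrite D1 (le_trans (ler_normD _ _))// !normrM lerD// ler_pM.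
have [d1 d2] := @derivable_conv_aux (fun x c => u (c, x) * v (b - c, x)) M (A * B' + A' * B) a
  (addr_ge0 (mulr_ge0 A0 B'0) (mulr_ge0 A'0 B0))
  (fun x => @continuous_conv_integrand u v b x cu cv)
  (fun c x => let: DeriveDef h _ := D x c in h) f0 fC.
split; first exact: d1.
rewrite d2 -(RintegralD measurableT (conv_integrable b a (boxed_derive (w := da) bu) cdu cv)
  (conv_integrable b a bu cu cdv)).
by apply: eq_Rintegral => c _; rewrite D1 addrC mulrC.
Qed.

(** The derivatives of a convolution are convolutions of derivatives, again boxed and smooth; hence
    the induction on [k] with [u] and [v] varying. *)
Lemma Ck_conv M e u v : 0 <= M -> boxed M e u -> boxed M e v ->
  (forall k, Ck k u) -> (forall k, Ck k v) -> forall k, Ck k (fconv u v).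
Proof.
move=> M0 bu bv su sv k; elim: k u v bu bv su sv => [|k IH] u v bu bv su sv.
  by split => //; exact: (conv_continuous M0 bu bv).
apply/CkSE; split; first exact: (conv_continuous M0 bu bv).
have sd (w : R * R -> R) : (forall k, Ck k w) -> (forall k, Ck k ('D_db w)) /\ (forall k, Ck k ('D_da w)).
  by move=> H; split => j; have /CkSE[_ []] := H j.+1.
have Hb := conv_db M0 bu bv (su 1%N) (sv 1%N).
have Ha := conv_da M0 bu bv (su 1%N) (sv 1%N).
split.
- by move=> p; split; [apply (Hb p).1|apply (Ha p).1].
- have -> : 'D_db (fconv u v) = fconv u ('D_db v) by apply/funext => p; apply (Hb p).2.
  by apply: IH => //; [exact: boxed_derive|apply (sd _ sv).1].
- have -> : 'D_da (fconv u v) = fconv ('D_da u) v \+ fconv u ('D_da v) by apply/funext => p; apply (Ha p).2.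
  by apply: CkD; apply: IH => //; [exact: boxed_derive|apply (sd _ su).2|exact: boxed_derive|apply (sd _ sv).2].
Qed.

End Boxed.

(** * Changes of variables and measurability *)

Section Monotone.
Context d (T : measurableType d) (R : realType) (mu : {measure set T -> \bar R}).
Local Open Scope ereal_scope.

(** For nonnegative functions the integral is a supremum over simple functions below the integrand,
    and this is monotone for arbitrary functions. *)
Lemma ge0_le_integral_nonmeasurable (f g : T -> \bar R) : (forall x, 0 <= f x) ->
  (forall x, f x <= g x) -> \int[mu]_x f x <= \int[mu]_x g x.
Proof.
move=> f0 fg; rewrite !ge0_integralTE //; last by move=> x; exact: le_trans (fg x).
by apply: ereal_sup_le => _ [h hf <-]; exists h => // x; exact: le_trans (fg x).
Qed.

(** The integrals of the positive and negative parts both lie between 0 and that of [g], so their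
    difference has absolute value at most the latter; the two are never added. *)
Lemma abse_integral_le_nonmeasurable (f : T -> R) (g : T -> \bar R) :
  (forall x, `|f x|%:E <= g x) -> `|\int[mu]_x (f x)%:E| <= \int[mu]_x g x.
Proof.
move=> fg; rewrite integralE.
have g0 x : 0 <= g x by apply: le_trans (fg x); rewrite lee_fin.
set X := \int[mu]_x _^\+ x; set Y := \int[mu]_x _^\- x.
have X0 : 0 <= X by apply: integral_ge0.
have Y0 : 0 <= Y by apply: integral_ge0.
have XG : X <= \int[mu]_x g x.
  apply: ge0_le_integral_nonmeasurable => // x; apply: le_trans (fg x).
  by rewrite funeposE ge_max !lee_fin ler_norm normr_ge0.
have YG : Y <= \int[mu]_x g x.
  apply: ge0_le_integral_nonmeasurable => // x; apply: le_trans (fg x).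
  by rewrite funenegE ge_max -EFinN !lee_fin -normrN ler_norm normr_ge0.
move: (\int[mu]_x g x) X0 Y0 XG YG => G X0 Y0 XG YG; clearbody X Y.
case: G XG YG => [G| |] XG YG; [|by rewrite leey|by have := le_trans X0 XG].
case: X X0 XG => [X||] // X0 XG; case: Y Y0 YG => [Y||] // Y0 YG.
move: X0 Y0 XG YG; rewrite -EFinB abse_EFin !lee_fin => X0 Y0 XG YG.
by rewrite ler_norml; apply/andP; split; lra.
Qed.

End Monotone.

(** * Affine substitutions and the invariant measure *)

Section Affine.
Context {R : realType}.
Local Notation mu1 := (@lebesgue_measure R).
Local Notation mu2 := (mu1 \x mu1)%E.
Local Notation T1 := (measurableTypeR R).
Local Notation T2 := (measurableTypeR R * measurableTypeR R)%type.
Implicit Types (c k s : R).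

Lemma measurable_affine c k : measurable_fun setT (fun x : R => (x - c) / k).
Proof. by apply: measurable_funM => //; exact: measurable_funB. Qed.

(** After scaling by [k^-1], the image measure gives each half-open interval its length, and
    uniqueness of Lebesgue measure concludes. *)
Lemma lebesgue_affine_pushforward c k : 0 < k -> forall A : set (measurableTypeR R), measurable A ->
  pushforward mu1 (fun x : measurableTypeR R => (x - c) / k : measurableTypeR R) A =
  (k%:E * mu1 A)%E.
Proof.
move=> k0 A mA.
have ki0 : 0 <= k^-1 by rewrite invr_ge0 ltW.
pose phi := fun x : measurableTypeR R => (x - c) / k : measurableTypeR R.
have mphi : measurable_fun setT phi by exact: measurable_affine.
pose phiM : {mfun measurableTypeR R >-> measurableTypeR R} :=
  HB.pack phi (isMeasurableFun.Build _ _ _ _ phi mphi).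
have := @lebesgue_measure_unique R
  (mscale (NngNum ki0) (pushforward mu1 phiM)).
move=> /(_ mphi) H; rewrite (H _ A mA); last first.
  move=> _ [[a b] _ <-]; rewrite /= /mscale /= /pushforward /=.
  have -> : phi @^-1` `]a, b] = `]a * k + c, b * k + c]%classic.
    apply/seteqP; split => x; rewrite /= !in_itv /= /phi /= => /andP[h1 h2]; apply/andP; split.
    - by move: h1; rewrite ltr_pdivlMr // ltrBrDr.
    - by move: h2; rewrite ler_pdivrMr // lerBlDr.
    - by rewrite ltr_pdivlMr // ltrBrDr.
    - by rewrite ler_pdivrMr // lerBlDr.
  rewrite !lebesgue_measure_itv /= !lte_fin ltrD2r ltr_pM2r //.
  case: ifP => _; last by rewrite mule0.
  rewrite -!EFinB -EFinM; congr EFin; field; exact: lt0r_neq0.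
by rewrite /mscale /= muleA -EFinM divff ?mul1e // lt0r_neq0.
Qed.

Lemma ge0_integral_affine c k (f : R -> \bar R) : 0 < k ->
  measurable_fun setT f -> (forall x, 0 <= f x)%E ->
  (\int[mu1]_x f ((x - c) / k)%R = k%:E * \int[mu1]_x f x)%E.
Proof.
move=> k0 mf f0.
have k0' : 0 <= k by exact: ltW.
pose phi := fun x : measurableTypeR R => (x - c) / k : measurableTypeR R.
have mphi : measurable_fun setT phi by exact: measurable_affine.
pose phiM : {mfun measurableTypeR R >-> measurableTypeR R} :=
  HB.pack phi (isMeasurableFun.Build _ _ _ _ phi mphi).
transitivity (\int[pushforward mu1 phiM]_x f x)%E.
  by rewrite (ge0_integral_pushforward mphi) ?preimage_setT //.
rewrite -(ge0_integral_mscale mu1 measurableT (NngNum k0')) //.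
apply: eq_measure_integral => A mA _.
exact: lebesgue_affine_pushforward.
Qed.

(** The density of da/a^2. As [wt 0 = 0], integrals over the set a != 0 may be taken over the whole
    plane. *)
Definition wt (a : R) : R := (a ^+ 2)^-1.

Lemma wt_ge0 a : 0 <= wt a. Proof. by rewrite /wt invr_ge0 sqr_ge0. Qed.

Lemma wt0 : wt 0 = 0. Proof. by rewrite /wt expr0n invr0. Qed.

Lemma measurable_invr : measurable_fun setT (fun x : R => x^-1).
Proof.
have mD : measurable [set x : R | x != 0] by apply: open_measurable; exact: open_neq.
have -> : (fun x : R => x^-1) = (fun x : R => x^-1) \_ [set x | x != 0].
  apply/funext => x; rewrite /patch; case: ifPn => //; rewrite notin_setE /= => /negP.
  by rewrite negbK => /eqP ->; rewrite invr0.
apply: (measurable_restrictT (fun x : R => x^-1) mD).1.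
apply: (@open_continuous_measurable_fun R _ (fun x : R => x^-1)); first exact: open_neq.
by move=> x /set_mem /= x0; exact: inv_continuous.
Qed.

Lemma measurable_wt : measurable_fun setT wt.
Proof.
have -> : wt = (fun a => (a ^-1) ^+ 2) by apply/funext => a; rewrite /wt exprVn.
apply: measurable_funX; exact: measurable_invr.
Qed.

(** Each variable contributes a factor [k], and [wt y = k^-2 wt (y / k)] cancels both. *)
Lemma ge0_integral_affine2 c k (f : T2 -> \bar R) : 0 < k ->
  measurable_fun setT f -> (forall x, 0 <= f x)%E ->
  (\int[mu2]_p (f ((p.1 - c) / k, p.2 / k)%R * (wt p.2)%:E) =
   \int[mu2]_p (f p * (wt p.2)%:E))%E.
Proof.
move=> k0 mf f0.
have mw := measurable_wt.
have mw2 : measurable_fun setT (fun p : T2 => (wt p.2)%:E).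
  by apply/measurable_EFinP; apply: measurableT_comp.
have m2 : measurable_fun setT (fun p : T2 => (f p * (wt p.2)%:E)%E).
  by apply: emeasurable_funM.
have m1 : measurable_fun setT (fun p : T2 => (f ((p.1 - c) / k, p.2 / k)%R * (wt p.2)%:E)%E).
  apply: emeasurable_funM => //; apply: (measurableT_comp mf).
  apply: measurable_fun_pair; apply: measurable_funM => //; exact: measurable_funB.
have wE0 a : (0 <= (wt a)%:E)%E by rewrite lee_fin wt_ge0.
rewrite (fubini_tonelli2 _ m1); last by move=> x; rewrite mule_ge0.
rewrite (fubini_tonelli2 _ m2); last by move=> x; rewrite mule_ge0.
rewrite /fubini_G.
have mfx (y : T1) : measurable_fun setT (fun x => f (x, y)) by exact: measurableT_comp.
pose Psi (y : R) := (\int[mu1]_x (f (x, y) * (wt y)%:E))%E.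
have mPsi : measurable_fun [set: T1] Psi.
  by apply: (measurable_fun_fubini_tonelli_G (m1 := mu1) _ m2) => x; rewrite mule_ge0.
have Psi0 y : (0 <= Psi y)%E by apply: integral_ge0 => z _; rewrite mule_ge0.
transitivity (\int[mu1]_y (k^-1%:E * Psi ((y - 0) / k)%R))%E; last first.
  rewrite ge0_integralZl_EFin //; [|by apply: (measurableT_comp mPsi); exact: measurable_affine|by rewrite invr_ge0 ltW].
  rewrite (ge0_integral_affine 0 k0 mPsi) //.
  by rewrite muleA -EFinM mulVf ?mul1e // lt0r_neq0.
apply: eq_integral => y _ /=; rewrite subr0 /Psi.
rewrite ge0_integralZr //; last first.
  apply: (measurableT_comp mf); apply: measurable_fun_pair => //; exact: measurable_affine.
rewrite ge0_integralZr //.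
rewrite (ge0_integral_affine c k0 (mfx (y / k))) //.
rewrite -muleA muleCA [RHS]muleCA; congr (_ * _)%E.
rewrite -!EFinM; congr EFin; rewrite /wt.
have [->|y0] := eqVneq y 0; first by rewrite mul0r !expr0n /= !invr0 !mulr0.
have kn0 : k != 0 by rewrite gt_eqF.
by field; apply/andP.
Qed.

End Affine.

(** * Borel sets of the plane *)

Section OpenMeasurable.
Context {R : realType}.

(** Second countability: an open set is the countable union of the squares with rational centre and
    rational half side that it contains. *)
Lemma open_measurable2 (O : set (R * R)) : open O -> measurable O.
Proof.
move=> oO.
pose box (q1 q2 r : R) := `]q1 - r, q1 + r[%classic `*` `]q2 - r, q2 + r[%classic.
pose F (q1 q2 r : rat) := if `[< box (ratr q1) (ratr q2) (ratr r) `<=` O >]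
  then box (ratr q1) (ratr q2) (ratr r) else set0.
have -> : O = \bigcup_q1 \bigcup_q2 \bigcup_r F q1 q2 r.
  apply/seteqP; split => [[x y] Oxy|p [q1 _ [q2 _ [r _]]]]; last first.
    by rewrite /F; case: ifPn => // /asboolP; exact.
  have := oO; rewrite openE => /(_ _ Oxy); rewrite /interior /= => -[[A B] /= [nA nB] AB].
  move: nA nB => /nbhs_ballP[e1 /= e10 h1] /nbhs_ballP[e2 /= e20 h2].
  pose e := Num.min e1 e2.
  have e0 : 0 < e by rewrite lt_min e10.
  (* The point is within [r] of the chosen centre, so the square of half side [r] stays within
     [2 r < e] of it. *)
  have [r] := @rat_in_itvoo R 0 (e / 2) ltac:(by rewrite divr_gt0).
  rewrite in_itv /= => /andP[r0 re].
  have [q1] := @rat_in_itvoo R (x - ratr r) (x + ratr r) ltac:(lra).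
  rewrite in_itv /= => /andP[q1a q1b].
  have [q2] := @rat_in_itvoo R (y - ratr r) (y + ratr r) ltac:(lra).
  rewrite in_itv /= => /andP[q2a q2b].
  exists q1 => //; exists q2 => //; exists r => //.
  rewrite /F; case: ifPn; first by move=> _; split; rewrite /= in_itv /=; apply/andP; split; lra.
  move=> /asboolPn []; move=> [x' y'] [/=]; rewrite !in_itv /= => /andP[a1 a2] /andP[a3 a4].
  have ee1 : e <= e1 by rewrite ge_min lexx.
  have ee2 : e <= e2 by rewrite ge_min lexx orbT.
  apply: AB; split => /=; [apply: h1|apply: h2]; rewrite /ball /= ltr_norml; apply/andP; split; lra.
apply: bigcupT_measurable_rat => q1; apply: bigcupT_measurable_rat => q2.
apply: bigcupT_measurable_rat => r; rewrite /F; case: ifP => // _.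
by apply: measurableX; exact: measurable_itv.
Qed.

Lemma continuous_measurable2 (u : R * R -> R) : continuous u -> measurable_fun setT u.
Proof.
move=> /continuousP cu; apply: (measurability _ (RGenOpens.measurableE R)).
move=> _ [_ [a [b ->] <-]]; rewrite setTI; apply: open_measurable2.
exact/cu/interval_open.
Qed.

(** Presents the product sigma-algebra as generated by a family stable under intersection, as the
    pi-lambda argument of [cvgosc_indic] demands. *)
Lemma measurable_prod_open : @measurable _ (R * R)%type = <<s @open (R * R)%type >>.
Proof.
apply/seteqP; split; last first.
  by apply: smallest_sub; [exact: sigma_algebra_measurable|exact: open_measurable2].
have H (f : R * R -> R) : continuous f -> forall A : set (measurableTypeR R), measurable A -> <<s @open (R * R)%type >> (f @^-1` A).
  move=> /continuousP cf A; rewrite (RGenOpens.measurableE R).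
  move: A; apply: smallest_sub.
    split => /=.
    - by rewrite preimage_set0; apply: sigma_algebra0.
    - by move=> A h; rewrite setTD -preimage_setC -setTD; apply: sigma_algebraCD.
    - by move=> F h; rewrite preimage_bigcup; apply: sigma_algebra_bigcup.
  move=> _ [a [b ->]] /=; apply: sub_sigma_algebra; exact/cf/interval_open.
rewrite measurable_prod_measurableType; apply: smallest_sub; first exact: smallest_sigma_algebra.
move=> _ [A mA [B mB <-]].
have -> : A `*` B = ~` (~` (fst @^-1` A) `|` ~` (snd @^-1` B)).
  by rewrite setCU !setCK.
rewrite -setTD; apply: sigma_algebraCD.
have -> : ~` (fst @^-1` A) `|` ~` (snd @^-1` B) =
  \bigcup_n (bigcup2 (~` (@fst R R @^-1` A)) (~` (@snd R R @^-1` B)) n) by rewrite bigcup2E.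
apply: sigma_algebra_bigcup => -[|[|n]] /=.
- by rewrite -setTD; apply: sigma_algebraCD; apply: H => // p; exact: cvg_fst.
- by rewrite -setTD; apply: sigma_algebraCD; apply: H => // p; exact: cvg_snd.
- exact: sigma_algebra0.
Qed.
End OpenMeasurable.

(** * The L2 estimate of twisted convolutions *)

Section ComplexNorm.
Context {R : realType}.
Implicit Types z w : R[i].
Local Notation Re := (@complex.Re R).
Local Notation Im := (@complex.Im R).
Local Notation normc := (@ComplexField.Normc.normc R).

Lemma sqr_normcE z : normc z ^+ 2 = Re z ^+ 2 + Im z ^+ 2.
Proof. by case: z => x y /=; rewrite sqr_sqrtr // addr_ge0 // sqr_ge0. Qed.

Lemma normc_ge0 z : 0 <= normc z.
Proof. by case: z => x y /=; exact: sqrtr_ge0. Qed.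

Lemma normcD z w : normc (z + w) <= normc z + normc w.
Proof. exact: (@le_normcD R z w). Qed.

Lemma normcB z w : normc (z - w) <= normc z + normc w.
Proof. by rewrite -(@normcN R w); exact: (@le_normcD R z (- w)). Qed.

Lemma normcM z w : normc (z * w) = normc z * normc w.
Proof. exact: ComplexField.Normc.normcM. Qed.

Lemma normc_real (x : R) : normc x%:C = `|x|.
Proof. by rewrite /= expr0n addr0 sqrtr_sqr. Qed.

Lemma Re_le_normc z : `|Re z| <= normc z.
Proof.
rewrite -(ler_pXn2r (n := 2)) ?nnegrE ?normr_ge0 ?normc_ge0 //.
by rewrite sqr_normcE real_normK ?num_real // lerDl sqr_ge0.
Qed.

Lemma Im_le_normc z : `|Im z| <= normc z.
Proof.
rewrite -(ler_pXn2r (n := 2)) ?nnegrE ?normr_ge0 ?normc_ge0 //.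
by rewrite sqr_normcE real_normK ?num_real // lerDr sqr_ge0.
Qed.

Lemma normc_le_ReIm z : normc z <= `|Re z| + `|Im z|.
Proof.
rewrite -(ler_pXn2r (n := 2)) ?nnegrE ?addr_ge0 ?normr_ge0 ?normc_ge0 //.
rewrite sqr_normcE sqrrD !real_normK ?num_real // addrAC lerDl.
by rewrite mulrn_wge0 // mulr_ge0.
Qed.

Lemma cReD z w : Re (z + w) = Re z + Re w. Proof. by case: z; case: w. Qed.
Lemma cImD z w : Im (z + w) = Im z + Im w. Proof. by case: z; case: w. Qed.
Lemma cReN z : Re (- z) = - Re z. Proof. by case: z. Qed.
Lemma cImN z : Im (- z) = - Im z. Proof. by case: z. Qed.
Lemma cReB z w : Re (z - w) = Re z - Re w. Proof. by rewrite cReD cReN. Qed.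
Lemma cImB z w : Im (z - w) = Im z - Im w. Proof. by rewrite cImD cImN. Qed.
Lemma cReM z w : Re (z * w) = Re z * Re w - Im z * Im w. Proof. by case: z; case: w. Qed.
Lemma cImM z w : Im (z * w) = Re z * Im w + Im z * Re w.
Proof. by case: z => a b; case: w => c d. Qed.
Lemma complex_ext z w : Re z = Re w -> Im z = Im w -> z = w.
Proof. by case: z => a b; case: w => c d /= -> ->. Qed.

End ComplexNorm.

(** * The weighted square norm and the bound on the operator norm *)

Section SquareNorm.
Context {R : realType}.
Local Notation mu1 := (@lebesgue_measure R).
Local Notation mu2 := (mu1 \x mu1)%E.
Local Notation T1 := (measurableTypeR R).
Local Notation T2 := (measurableTypeR R * measurableTypeR R)%type.
Local Notation normc := (@ComplexField.Normc.normc R).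
Implicit Types (s M : R).

Lemma lebesgue2_sigma_finite : sigma_finite [set: T2] (mu1 \x mu1)%E.
Proof.
exists (fun n => `[- n%:R, n%:R]%classic `*` `[- n%:R, n%:R]%classic).
  apply/seteqP; split => // -[x y] _.
  have [n hn] : exists n : nat, `|x| + `|y| <= n%:R.
    by exists (Num.truncn (`|x| + `|y|)).+1; apply: ltW; apply: truncnS_gt.
  exists n => //; split; rewrite /= in_itv /= -ler_norml; apply: le_trans hn.
    by rewrite lerDl. by rewrite lerDr.
move=> n; split.
  by apply: measurableX; exact: measurable_itv.
rewrite product_measure1E; [|exact: measurable_itv|exact: measurable_itv].
by rewrite /= lebesgue_measure_itv /=; case: ifP => _; rewrite ?mule0 ?ltry //= -!EFinB -EFinM ltry.
Qed.
(* The product measure, with the sigma-finiteness needed by Fubini-Tonelli on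
   R x (R x R). *)
Definition lebesgue2 : {sigma_finite_measure set T2 -> \bar R} :=
  HB.pack (mu1 \x mu1)%E (Measure_isSigmaFinite.Build _ _ _ (mu1 \x mu1)%E lebesgue2_sigma_finite).

(** The square of [L2norm]; most estimates are made here, before the root is taken. *)
Definition sqn (g : T2 -> R[i]) : \bar R :=
  (\int[mu2]_p (normc (g p) ^+ 2 * wt p.2)%:E)%E.

Lemma sqn_ge0 g : (0 <= sqn g)%E.
Proof. by apply: integral_ge0 => p _; rewrite lee_fin mulr_ge0 ?sqr_ge0 ?wt_ge0. Qed.

Lemma L2normE (g : R * R -> R[i]) : L2norm g = (sqn g `^ 2^-1)%E.
Proof.
rewrite /L2norm integral_mkcond; congr poweR; apply: eq_integral => -[b a] _.
rewrite /patch; case: ifPn => //; rewrite notin_setE /RxRstar /= => /negP; rewrite negbK => /eqP ->.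
by rewrite wt0 mulr0.
Qed.

Lemma L2norm_ge0 (g : R * R -> R[i]) : (0 <= L2norm g)%E.
Proof. exact: poweR_ge0. Qed.

Lemma L2norm_le (K : R) (X Y : R * R -> R[i]) : 0 <= K ->
  (sqn X <= (K ^+ 2)%:E * sqn Y)%E -> (L2norm X <= K%:E * L2norm Y)%E.
Proof.
move=> K0 h; rewrite !L2normE.
have -> : K%:E = ((K ^+ 2)%:E `^ 2^-1)%E.
  by rewrite poweR_EFin powR12_sqrt ?sqr_ge0 // sqrtr_sqr ger0_norm.
rewrite -poweRM ?lee_fin ?sqr_ge0 ?sqn_ge0 //.
apply: gt0_ler_poweR; rewrite ?invr_ge0 // ?in_itv /= ?leey ?andbT ?sqn_ge0 //.
by rewrite mule_ge0 // ?lee_fin ?sqr_ge0 ?sqn_ge0.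
Qed.

Definition symitv M : set T1 := `[-M, M]%classic.

Lemma measurable_symitv M : measurable (symitv M). Proof. exact: measurable_itv. Qed.

Lemma lebesgue_symitv M : 0 < M -> mu1 (symitv M) = (2 * M)%:E.
Proof.
move=> M0; rewrite /symitv lebesgue_measure_itv /= lte_fin ifT; last lra.
by rewrite -EFinD; congr EFin; ring.
Qed.

Lemma integral_itv_sym_cst M (t : R) : 0 < M ->
  (\int[mu1]_(c in symitv M) t%:E = (2 * M * t)%:E)%E.
Proof.
move=> M0; rewrite integral_cst /=; last exact: measurable_symitv.
by rewrite lebesgue_symitv // -EFinM mulrC.
Qed.

(** Cauchy-Schwarz on [-M, M]. Only the majorant [B] is measurable, since [F] will contain an
    arbitrary bounded function. *)
Lemma Rintegral_sqr_le (F B : R -> R) M : 0 < M -> measurable_fun setT B ->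
  (forall c, `|F c| <= B c) -> (forall c, M < `|c| -> B c = 0) ->
  (((\int[mu1]_c F c) ^+ 2)%:E <= (2 * M)%:E * \int[mu1]_c (B c ^+ 2)%:E)%E.
Proof.
move=> M0 mB FB B0; set S := (\int[mu1]_c (B c ^+ 2)%:E)%E.
have S0 : (0 <= S)%E by apply: integral_ge0 => c _; rewrite lee_fin sqr_ge0.
have Bge0 c : 0 <= B c by exact: le_trans (FB c).
have mB2 : measurable_fun setT (fun c => (B c ^+ 2)%:E).
  by apply/measurable_EFinP; exact: measurable_funX.
(* AM-GM instead of Cauchy-Schwarz: |F| <= t / 2 + B^2 / (2 t) on [-M, M]. *)
have key (t : R) : 0 < t -> (`|\int[mu1]_c (F c)%:E| <= (t * M)%:E + (2 * t)^-1%:E * S)%E.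
  move=> t0.
  have mI := measurable_symitv M.
  have -> : ((t * M)%:E + (2 * t)^-1%:E * S =
      \int[mu1]_c (((fun=> (t / 2)%:E) \_ (symitv M)) c + (2 * t)^-1%:E * (B c ^+ 2)%:E))%E.
    have p0 : forall c, (0 <= ((fun=> (t / 2)%:E) \_ (symitv M)) c)%E.
      by move=> c; rewrite /patch; case: ifP => // _; rewrite lee_fin divr_ge0 // ltW.
    rewrite ge0_integralD //.
    - rewrite -integral_mkcond integral_itv_sym_cst // ge0_integralZl_EFin //.
      + by congr (_ + _)%E; congr EFin; field.
      + by move=> c _; rewrite lee_fin sqr_ge0.
      + by rewrite invr_ge0 mulr_ge0 // ltW.
    - by apply: (measurable_restrictT _ mI).1; exact: measurable_cst.
    - by move=> c _; rewrite mule_ge0 // lee_fin ?sqr_ge0 // invr_ge0 mulr_ge0 // ltW.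
    - by apply: emeasurable_funM => //; exact: measurable_cst.
  apply: abse_integral_le_nonmeasurable => c.
  have [cM|cM] := ltP M `|c|.
    rewrite (le_trans (y := 0%E)) //; first by rewrite lee_fin -(B0 _ cM).
    rewrite adde_ge0 //; first by rewrite /patch; case: ifP => // _; rewrite lee_fin divr_ge0 // ltW.
    by rewrite -EFinM lee_fin mulr_ge0 // ?sqr_ge0 // invr_ge0 mulr_ge0 // ltW.
  rewrite /patch ifT; last by rewrite inE /symitv /= in_itv /= -ler_norml.
  rewrite -EFinM -EFinD lee_fin (le_trans (FB c)) //.
  rewrite -subr_ge0.
  have -> : t / 2 + (2 * t)^-1 * B c ^+ 2 - B c = (2 * t)^-1 * (t - B c) ^+ 2.
    by field; rewrite gt_eqF.
  by rewrite mulr_ge0 ?sqr_ge0 // invr_ge0 mulr_ge0 // ltW.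
case: S S0 key => [S| |] // S0 key; last first.
  by rewrite gt0_muley ?leey // lte_fin mulr_gt0.
rewrite -EFinM lee_fin.
have fin : (\int[mu1]_c (F c)%:E)%E \is a fin_num.
  have := key 1 ltr01; rewrite -EFinM -EFinD; case: (\int[mu1]_c _)%E => //.
rewrite /Rintegral.
move: fin key; case: (\int[mu1]_c (F c)%:E)%E => // I _ key /=.
have {}key t : 0 < t -> `|I| <= t * M + (2 * t)^-1 * S.
  by move=> /key; rewrite -EFinM -EFinD abse_EFin lee_fin.
rewrite lee_fin in S0.
rewrite -real_normK ?num_real //.
have [->|I0] := eqVneq I 0; first by rewrite normr0 expr0n /= !mulr_ge0 // ltW.
have Ip : 0 < `|I| by rewrite normr_gt0.
(* With this [t] the term [t * M] is [|I| / 2] and is absorbed on the left. *)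
have := key (`|I| / (2 * M)) ltac:(by rewrite divr_gt0 // mulr_gt0).
have -> : `|I| / (2 * M) * M + (2 * (`|I| / (2 * M)))^-1 * S = `|I| / 2 + M * S / `|I|.
  by field; rewrite !gt_eqF.
move=> h; have {}h : `|I| / 2 <= M * S / `|I| by lra.
move: h; rewrite ler_pdivlMr // => h; rewrite expr2; lra.
Qed.

(** The constant is twice [2 * M]: the real and imaginary parts are estimated separately. *)
Lemma sqn_Cintegral_pointwise (F : R -> R[i]) (B : R -> R) M : 0 < M -> measurable_fun setT B ->
  (forall c, normc (F c) <= B c) -> (forall c, M < `|c| -> B c = 0) ->
  ((normc (Cintegral F) ^+ 2)%:E <= (4 * M)%:E * \int[mu1]_c (B c ^+ 2)%:E)%E.
Proof.
move=> M0 mB FB B0; rewrite sqr_normcE EFinD.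
have -> : (4 * M)%:E = ((2 * M)%:E + (2 * M)%:E :> \bar R)%E by rewrite -EFinD; congr EFin; ring.
rewrite ge0_muleDl ?lee_fin ?mulr_ge0 ?(ltW M0) //.
apply: leeD; apply: Rintegral_sqr_le => // c; apply: le_trans (FB c).
  exact: Re_le_normc.
exact: Im_le_normc.
Qed.

Lemma sqn_Cintegral_le (F : R -> T2 -> R[i]) (B : T1 * T2 -> R) M : 0 < M ->
  measurable_fun setT B ->
  (forall c p, normc (F c p) <= B (c, p)) -> (forall c p, M < `|c| -> B (c, p) = 0) ->
  (sqn (fun p => Cintegral (F^~ p)) <=
    (4 * M)%:E * \int[mu1]_c \int[mu2]_p (B (c, p) ^+ 2 * wt p.2)%:E)%E.
Proof.
move=> M0 mB FB B0; rewrite /sqn.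
pose W (z : T1 * T2) := (B z ^+ 2 * wt z.2.2)%:E.
have W0 z : (0 <= W z)%E by rewrite lee_fin mulr_ge0 ?sqr_ge0 ?wt_ge0.
have mW : measurable_fun setT W.
  apply/measurable_EFinP; apply: measurable_funM; first exact: measurable_funX.
  apply: (measurableT_comp measurable_wt).
  by apply: measurableT_comp => //.
have mBp p : measurable_fun setT (fun c => B (c, p)).
  by apply: measurableT_comp => //.
have E := fubini_tonelli (m1 := mu1) (m2 := lebesgue2) W mW W0.
apply: (@le_trans _ _ ((4 * M)%:E * \int[mu2]_p \int[mu1]_c W (c, p))%E); last by rewrite -E.
have mG := measurable_fun_fubini_tonelli_G (m1 := mu1) W mW W0.
have M4 : 0 <= 4 * M by rewrite mulr_ge0 // ltW.
rewrite -(ge0_integralZl_EFin mu2 measurableT _ mG M4); last first.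
  by move=> p _; apply: integral_ge0.
apply: ge0_le_integral_nonmeasurable => p.
  by rewrite lee_fin mulr_ge0 ?sqr_ge0 ?wt_ge0.
rewrite /W.
under [X in (_ * X)%E]eq_integral do rewrite /= EFinM.
rewrite ge0_integralZr //; last 3 first.
- by apply/measurable_EFinP; exact: measurable_funX.
- by move=> x _; rewrite lee_fin sqr_ge0.
- by rewrite lee_fin wt_ge0.
rewrite EFinM muleA lee_wpmul2r ?lee_fin ?wt_ge0 //.
exact: (sqn_Cintegral_pointwise M0 (mBp p) (fun c => FB c p) (fun c => B0 c p)).
Qed.


Lemma measurable_normc d (T : measurableType d) (g : T -> R[i]) :
  measurable_fun setT (fun p => complex.Re (g p)) -> measurable_fun setT (fun p => complex.Im (g p)) ->
  measurable_fun setT (fun p => normc (g p)).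
Proof.
move=> mr mi.
have -> : (fun p => normc (g p)) = (fun p => Num.sqrt (complex.Re (g p) ^+ 2 + complex.Im (g p) ^+ 2)).
  by apply/funext => p; rewrite -sqr_normcE sqrtr_sqr ger0_norm ?normc_ge0.
apply: (measurableT_comp (continuous_measurable_fun (@sqrt_continuous R))).
by apply: measurable_funD; exact: measurable_funX.
Qed.

(** The point at which [convol s] evaluates its second factor. *)
Definition tau s (c : R) (p : T2) : T2 := ((p.1 - c) / (1 + s * c), p.2 / (1 + s * c)).

Lemma measurable_tau s : measurable_fun setT (fun z : T1 * T2 => tau s z.1 z.2).
Proof.
have m1 : measurable_fun setT (fun z : T1 * T2 => (1 + s * z.1)^-1).
  apply: (measurableT_comp measurable_invr).
  by apply: measurable_funD => //; apply: measurable_funM.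
apply: measurable_fun_pair; apply: measurable_funM => //.
- apply: measurable_funB => //; by apply: measurableT_comp => //.
- by apply: measurableT_comp => //.
Qed.

Lemma measurable_tau_c s c : measurable_fun setT (tau s c).
Proof. by apply: measurable_fun_pair; apply: measurable_funM => //; exact: measurable_funB. Qed.

Lemma integral_tau s c (phi : T2 -> R) : 0 < 1 + s * c -> measurable_fun setT phi ->
  (forall p, 0 <= phi p) ->
  (\int[mu2]_p (phi (tau s c p) * wt p.2)%:E = \int[mu2]_p (phi p * wt p.2)%:E)%E.
Proof.
move=> k0 mphi phi0.
have := @ge0_integral_affine2 R c (1 + s * c) (EFin \o phi) k0.
have mE : measurable_fun setT (EFin \o phi) by exact/measurable_EFinP.
move=> /(_ mE (fun p => phi0 p)) H.
under eq_integral do rewrite EFinM.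
under [in RHS]eq_integral do rewrite EFinM.
exact: H.
Qed.

Lemma sqn_convol_measurable_le s (h g : R * R -> R[i]) M A e : 0 < M -> 0 < e -> 0 <= A ->
  (forall p, normc (h p) <= A) -> (forall p, M < `|p.1| -> h p = 0) ->
  (forall c, `|c| <= M -> e <= 1 + s * c) ->
  measurable_fun [set: T2] (fun p => complex.Re (g p)) ->
  measurable_fun [set: T2] (fun p => complex.Im (g p)) ->
  (sqn (convol s h g) <= ((3 * M * A / e) ^+ 2)%:E * sqn g)%E.
Proof.
move=> M0 e0 A0 hA hM se mr mi.
have mn := measurable_normc mr mi.
pose B (z : T1 * T2) := \1_(symitv M) z.1 * (A / e * normc (g (tau s z.1 z.2))).
have mB : measurable_fun setT B.
  apply: measurable_funM.
    apply: (measurableT_comp (measurable_indic (measurable_symitv M))) => //.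
  apply: measurable_funM => //.
  exact: (measurableT_comp mn (measurable_tau s)).
have inM c : c \in symitv M -> `|c| <= M by rewrite inE /symitv /= in_itv /= -ler_norml.
have notM c : c \notin symitv M -> M < `|c|.
  by rewrite notin_setE /symitv /= in_itv /= -ler_norml => /negP; rewrite -ltNge.
pose F c (p : T2) := (`|1 + s * c|^-1)%:C * h (c, p.2 + s * (c - p.1)) *
                      g ((p.1 - c) / (1 + s * c), p.2 / (1 + s * c)).
have FB c p : normc (F c p) <= B (c, p).
  rewrite /F /B /= indicE; have [cM|cM] := boolP (c \in symitv M); last first.
    by rewrite hM ?notM //= mulr0 !mul0r ComplexField.Normc.normc0.
  have ec := se _ (inM _ cM).
  rewrite mul1r !normcM normc_real ler_pM ?mulr_ge0 ?normc_ge0 //.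
  rewrite mulrC ler_pM ?normc_ge0 //.
  rewrite ger0_norm ?invr_ge0 // lef_pV2 ?posrE //; last by rewrite normr_gt0; lra.
  by rewrite (le_trans ec) // ler_norm.
have B0 c p : M < `|c| -> B (c, p) = 0.
  move=> cM; rewrite /B /= indicE; case: (boolP (c \in _)) => [/inM|]; last by rewrite mul0r.
  by rewrite leNgt cM.
have -> : convol s h g = (fun p => Cintegral (F^~ p)) by apply/funext => -[b a].
apply: (le_trans (sqn_Cintegral_le M0 mB FB B0)).
have E c : (\int[mu2]_p (B (c, p) ^+ 2 * wt p.2)%:E)%E =
    (((fun=> ((A / e) ^+ 2)%:E * sqn g) \_ (symitv M)) c)%E.
  rewrite /B /= /patch; case: ifPn => cM; rewrite indicE ?cM ?(negbTE cM); last first.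
    by apply: integral0_eq => p _; rewrite mul0r expr0n mul0r.
  have ec : 0 < 1 + s * c by apply: (lt_le_trans e0); exact/se/inM.
  under eq_integral do rewrite mul1r exprMn -mulrA EFinM.
  have mphi : measurable_fun [set: T2] (fun p => normc (g p) ^+ 2) by exact: measurable_funX.
  rewrite ge0_integralZl_EFin ?sqr_ge0 //.
  - by rewrite (integral_tau ec mphi) // => p; rewrite sqr_ge0.
  - by move=> p _; rewrite lee_fin mulr_ge0 ?sqr_ge0 ?wt_ge0.
  - apply/measurable_EFinP; apply: measurable_funM; last exact: (measurableT_comp measurable_wt).
    apply: (measurableT_comp mphi).
    exact: measurable_tau_c.
under eq_integral do rewrite E.
rewrite -integral_mkcond integral_cst /=; last exact: measurable_symitv.
rewrite lebesgue_symitv // (muleC _ (2 * M)%:E) !muleA -!EFinM lee_wpmul2r ?sqn_ge0 // lee_fin.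
(* The factor [4 * M] of the fibre estimate and the length [2 * M] give [8 * M ^+ 2], rounded up to
   the square of [3 * M]. *)
rewrite -(mulrA _ A) [X in _ <= X]exprMn; have := sqr_ge0 (A / e); have := sqr_ge0 M; nra.
Qed.


(* Elements of L2 are only measurable off the line a = 0, which has measure zero:
   replacing g by [patch0 g] makes them measurable everywhere. *)
Definition patch0 (g : R * R -> R[i]) (p : R * R) : R[i] := if p.2 == 0 then 0 else g p.

Lemma measurable_RxRstar : measurable (RxRstar : set T2).
Proof.
have -> : (RxRstar : set T2) = setT `*` [set x : T1 | x != 0].
  by apply/seteqP; split => [[x y]|[x y] []] /=.
apply: measurableX => //; by apply: open_measurable; exact: open_neq.
Qed.

Let measurable_patch (G : R * R -> R) :
  @measurable_fun _ _ (R * R)%type R RxRstar G ->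
  measurable_fun [set: T2] (fun p : T2 => if p.2 == 0 then 0 else G p : R).
Proof.
move=> h.
have mG : measurable_fun [set: T2] (G \_ RxRstar).
  by apply: (measurable_restrictT _ measurable_RxRstar).1.
apply: (eq_measurable_fun (G \_ RxRstar)) => // -[x y] _.
rewrite /patch /RxRstar; case: (eqVneq y 0) => [->|y0] /=.
  by rewrite memNset //= eqxx.
by rewrite mem_set //= y0.
Qed.

Lemma patch0_measurable (g : R * R -> R[i]) : L2 g ->
  measurable_fun [set: T2] (fun p => complex.Re (patch0 g p)) /\
  measurable_fun [set: T2] (fun p => complex.Im (patch0 g p)).
Proof.
case=> mr mi _; split.
  have := measurable_patch mr; apply: eq_measurable_fun => // -[x y] _.
  by rewrite /patch0 /=; case: ifP.
have := measurable_patch mi; apply: eq_measurable_fun => // -[x y] _.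
by rewrite /patch0 /=; case: ifP.
Qed.

Lemma eq_sqn (X Y : T2 -> R[i]) : (forall p, p.2 != 0 -> X p = Y p) -> sqn X = sqn Y.
Proof.
move=> h; apply: eq_integral => -[b a] _ /=.
by have [->|a0] := eqVneq a 0; [rewrite wt0 !mulr0|rewrite h].
Qed.

Lemma sqn_patch0 (g : R * R -> R[i]) : sqn (patch0 g) = sqn g.
Proof. by apply: eq_sqn => p /negbTE p0; rewrite /patch0 p0. Qed.

(** For a != 0 the second factor is evaluated at second coordinate a/(1 + s c), which is nonzero
    unless 1 + s c = 0, and there the weight is 0. *)
Lemma convol_patch0 s h (g : R * R -> R[i]) p : p.2 != 0 ->
  convol s h (patch0 g) p = convol s h g p.
Proof.
case: p => b a /= a0; congr Cintegral; apply/funext => c.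
have [->|sc] := eqVneq (1 + s * c) 0; first by rewrite normr0 invr0 !mul0r.
by rewrite /patch0 /= mulf_eq0 invr_eq0 (negbTE sc) (negbTE a0).
Qed.

Lemma sqn_convol_patch0 s h (g : R * R -> R[i]) :
  sqn (convol s h (patch0 g)) = sqn (convol s h g).
Proof. by apply: eq_sqn => p p0; exact: convol_patch0. Qed.

Lemma L2norm_convol_le s (h g : R * R -> R[i]) M A e : 0 < M -> 0 < e -> 0 <= A ->
  (forall p, normc (h p) <= A) -> (forall p, M < `|p.1| -> h p = 0) ->
  (forall c, `|c| <= M -> e <= 1 + s * c) -> L2 g ->
  (L2norm (convol s h g) <= (3 * M * A / e)%:E * L2norm g)%E.
Proof.
move=> M0 e0 A0 hA hM se /patch0_measurable[mr mi].
apply: L2norm_le; first by rewrite !mulr_ge0 ?invr_ge0 ?(ltW M0) ?(ltW e0).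
rewrite -sqn_convol_patch0 -(sqn_patch0 g).
exact: sqn_convol_measurable_le.
Qed.

(** The zero function is an admissible test vector, so the supremum is not over an empty set. *)
Lemma opnorm_ge0 s (h : R * R -> R[i]) : (0 <= opnorm s h)%E.
Proof.
have L0 : L2norm (fun=> 0 : R[i]) = 0%E.
  rewrite L2normE /sqn integral0_eq ?poweR0r ?invr_eq0 ?pnatr_eq0 // => p _.
  by rewrite ComplexField.Normc.normc0 expr0n mul0r.
apply: (le_trans (L2norm_ge0 (convol s h (fun=> 0)))); apply: ereal_sup_ubound.
exists (fun=> 0) => //; split; rewrite /= ?L0 //.
by split; rewrite ?L0 ?ltry //; exact: measurable_cst.
Qed.

Lemma opnorm_le s (h : R * R -> R[i]) M A e : 0 < M -> 0 < e -> 0 <= A ->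
  (forall p, normc (h p) <= A) -> (forall p, M < `|p.1| -> h p = 0) ->
  (forall c, `|c| <= M -> e <= 1 + s * c) ->
  (opnorm s h <= (3 * M * A / e)%:E)%E.
Proof.
move=> M0 e0 A0 hA hM se; apply: ge_ereal_sup => _ [g [Lg g1] <-].
apply: (le_trans (L2norm_convol_le M0 e0 A0 hA hM se Lg)).
by rewrite -[leRHS]mule1 lee_wpmul2l // lee_fin !mulr_ge0 ?invr_ge0 ?(ltW M0) ?(ltW e0).
Qed.

End SquareNorm.

(** * First-order expansion of the twisted convolution *)

Section Taylor.
Context {R : realType}.
Implicit Types (u v : R * R -> R) (M e L C s : R).
Local Notation mu1 := (@lebesgue_measure R).

(** The mean value theorem yields a slope at a point within |h| of [x], and the Lipschitz bound
    replaces a second derivative. *)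
Lemma taylor1_lipschitz (f : R -> R) L : (forall x, derivable f x 1) ->
  (forall x y, `|'D_1 f x - 'D_1 f y| <= L * `|x - y|) ->
  forall x h, `|f (x + h) - f x - h * 'D_1 f x| <= L * h ^+ 2.
Proof.
move=> df fL x h.
have L0 : 0 <= L by have := fL 1 0; rewrite subr0 normr1 mulr1; exact: le_trans.
have cf i : {within i, continuous f}.
  by apply: continuous_subspaceT => z; apply: differentiable_continuous; exact/derivable1_diffP.
have [c [E ch]] : exists c, f (x + h) - f x = 'D_1 f c * h /\ `|c - x| <= `|h|.
  have [h0|h0] := leP 0 h.
    have [|c] := @MVT_segment _ f ('D_1 f) x (x + h) _ (fun x _ => derivableP (df x)) (cf _).
      by rewrite lerDl.
    rewrite in_itv /= => /andP[c1 c2] E; exists c; split; first by rewrite E (addrC x) addrK.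
    by rewrite !ger0_norm //; lra.
  have [|c] := @MVT_segment _ f ('D_1 f) (x + h) x _ (fun x _ => derivableP (df x)) (cf _).
    by rewrite gerDl ltW.
  rewrite in_itv /= => /andP[c1 c2] E; exists c; split.
    by rewrite -opprB E; ring.
  by rewrite (ltr0_norm h0) ler_norml; apply/andP; split; lra.
rewrite E (mulrC h) -mulrBl normrM -[X in L * X](real_normK (num_real h)) expr2 mulrA ler_wpM2r //.
by rewrite (le_trans (fL _ _)) // ler_wpM2l.
Qed.

(** First move in [a], then in [b] at height [y + k]; returning the [b]-derivative from [y + k] to
    [y] costs a term of size |h| |k|. *)
Lemma taylor2_lipschitz M e v : boxed M e v -> Ck 2 v ->
  exists L : R, 0 <= L /\ forall (x y h k : R),
    `|v (x + h, y + k) - v (x, y) - h * 'D_db v (x, y) - k * 'D_da v (x, y)|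
      <= L * (`|h| + `|k|) ^+ 2.
Proof.
move=> bv /CkSE[_ [dv cb ca]].
have [L1 [L10 H1]] := boxed_lipschitz (boxed_derive (w := db) bv) cb.
have [L2 [L20 H2]] := boxed_lipschitz (boxed_derive (w := da) bv) ca.
exists (L1 + L2); split; first by rewrite addr_ge0.
move=> x y h k.
have A1 : `|v (x + h, y + k) - v (x, y + k) - h * 'D_db v (x, y + k)| <= L1 * h ^+ 2.
  rewrite derive_dbE; apply: (@taylor1_lipschitz (fun x => v (x, y + k))).
    by move=> z; rewrite -derivable_dbE; apply (dv _).1.
  by move=> z z'; rewrite -!derive_dbE (le_trans (H1 _ _)) //= subrr normr0 addr0.
have A2 : `|v (x, y + k) - v (x, y) - k * 'D_da v (x, y)| <= L2 * k ^+ 2.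
  rewrite derive_daE; apply: (@taylor1_lipschitz (fun y => v (x, y))).
    by move=> z; rewrite -derivable_daE; apply (dv _).2.
  by move=> z z'; rewrite -!derive_daE (le_trans (H2 _ _)) //= subrr normr0 add0r.
have A3 : `|'D_db v (x, y + k) - 'D_db v (x, y)| <= L1 * `|k|.
  by rewrite (le_trans (H1 _ _)) //= subrr normr0 add0r (addrC y) addrK.
have -> : v (x + h, y + k) - v (x, y) - h * 'D_db v (x, y) - k * 'D_da v (x, y) =
  (v (x + h, y + k) - v (x, y + k) - h * 'D_db v (x, y + k)) +
  (v (x, y + k) - v (x, y) - k * 'D_da v (x, y)) +
  h * ('D_db v (x, y + k) - 'D_db v (x, y)) by ring.
rewrite (le_trans (ler_normD _ _)) //.
have -> : (L1 + L2) * (`|h| + `|k|) ^+ 2 = (L1 * h ^+ 2 + L2 * k ^+ 2) + `|h| * (L1 * `|k|) +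
   (L2 * h ^+ 2 + L1 * k ^+ 2 + (L1 + L2 + L2) * (`|h| * `|k|)).
  by rewrite -(real_normK (num_real h)) -(real_normK (num_real k)); ring.
have P0 : 0 <= L2 * h ^+ 2 + L1 * k ^+ 2 + (L1 + L2 + L2) * (`|h| * `|k|).
  have Ls : 0 <= L1 + L2 + L2 by lra.
  have := mulr_ge0 L20 (sqr_ge0 h); have := mulr_ge0 L10 (sqr_ge0 k).
  have := mulr_ge0 Ls (mulr_ge0 (normr_ge0 h) (normr_ge0 k)); lra.
apply: (@le_trans _ _ (L1 * h ^+ 2 + L2 * k ^+ 2 + `|h| * (L1 * `|k|))); last by rewrite lerDl.
apply: lerD; last by rewrite normrM ler_wpM2l.
by rewrite (le_trans (ler_normD _ _)) // lerD.
Qed.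

(* X = x0 + s x1 + O(s^2), with one constant for all bounds so that products stay
   in this form. *)
Definition approx2 C s (X x0 x1 : R) :=
  [/\ `|X - x0 - s * x1| <= C * s ^+ 2, `|x0| <= C & `|x1| <= C].

Lemma approx2_ge0 C s X x0 x1 : approx2 C s X x0 x1 -> 0 <= C.
Proof. by case=> _ h _; exact: le_trans h. Qed.

(** The four error terms weigh 1, 2, 2 and 1 times [C * C'], which is the factor 6; [|s| <= 1]
    reduces s^4 to s^2. *)
Lemma approx2M C C' s X x0 x1 Y y0 y1 : `|s| <= 1 ->
  approx2 C s X x0 x1 -> approx2 C' s Y y0 y1 ->
  approx2 (6 * C * C') s (X * Y) (x0 * y0) (x0 * y1 + x1 * y0).
Proof.
move=> s1 aX aY; have C0 := approx2_ge0 aX; have C'0 := approx2_ge0 aY.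
have CC : 0 <= C * C' by exact: mulr_ge0.
case: aX => [h1 h2 h3]; case: aY => [k1 k2 k3]; split.
- have -> : X * Y - x0 * y0 - s * (x0 * y1 + x1 * y0) =
    (X - x0 - s * x1) * (Y - y0 - s * y1) + (X - x0 - s * x1) * (y0 + s * y1) +
     (x0 + s * x1) * (Y - y0 - s * y1) + s ^+ 2 * (x1 * y1) by ring.
  have s2 : s ^+ 2 <= 1 by rewrite -(real_normK (num_real s)) expr_le1.
  have s20 := sqr_ge0 s.
  have e1 : `|(X - x0 - s * x1) * (Y - y0 - s * y1)| <= C * C' * s ^+ 2.
    rewrite normrM (le_trans (ler_pM _ _ h1 k1)) //.
    have -> : C * s ^+ 2 * (C' * s ^+ 2) = C * C' * s ^+ 2 * s ^+ 2 by ring.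
    by rewrite ler_piMr // mulr_ge0.
  have sx (z z' D : R) : `|z| <= D -> `|z'| <= D -> `|z + s * z'| <= 2 * D.
    move=> hz hz'; rewrite (le_trans (ler_normD _ _)) // mulr_natl mulr2n lerD //.
    by rewrite normrM (le_trans _ hz') // ler_piMl.
  have e2 : `|(X - x0 - s * x1) * (y0 + s * y1)| <= 2 * (C * C') * s ^+ 2.
    rewrite normrM (le_trans (ler_pM _ _ h1 (sx _ _ _ k2 k3))) //; lra.
  have e3 : `|(x0 + s * x1) * (Y - y0 - s * y1)| <= 2 * (C * C') * s ^+ 2.
    rewrite normrM (le_trans (ler_pM _ _ (sx _ _ _ h2 h3) k1)) //; lra.
  have e4 : `|s ^+ 2 * (x1 * y1)| <= C * C' * s ^+ 2.
    by rewrite normrM ger0_norm // mulrC ler_wpM2r // normrM ler_pM.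
  have -> : 6 * C * C' * s ^+ 2 = C * C' * s ^+ 2 + 2 * (C * C') * s ^+ 2 +
     2 * (C * C') * s ^+ 2 + C * C' * s ^+ 2 by ring.
  by do 3! [rewrite (le_trans (ler_normD _ _)) //; apply: lerD => //].
- rewrite normrM (le_trans (ler_pM _ _ h2 k2)) //; lra.
- rewrite (le_trans (ler_normD _ _)) // !normrM.
  have := ler_pM (normr_ge0 x0) (normr_ge0 y1) h2 k3.
  have := ler_pM (normr_ge0 x1) (normr_ge0 y0) h3 k2; lra.
Qed.

(* The integrand of the twisted convolution of real functions; [dkern] is its
   derivative in s at s = 0. *)
Definition kern s u v (b a c : R) : R :=
  `|1 + s * c|^-1 * u (c, a + s * (c - b)) * v ((b - c) / (1 + s * c), a / (1 + s * c)).

Definition dkern u v (b a c : R) : R :=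
  - c * (u (c, a) * v (b - c, a)) + (c - b) * 'D_da u (c, a) * v (b - c, a)
  - c * (b - c) * (u (c, a) * 'D_db v (b - c, a)) - c * a * (u (c, a) * 'D_da v (b - c, a)).

Lemma kern0E u v b a c : kern 0 u v b a c = u (c, a) * v (b - c, a).
Proof. by rewrite /kern !mul0r !addr0 normr1 invr1 mul1r !mulr1. Qed.

Lemma kern_supp M e u v s b a c : boxed M e u -> M < `|c| -> kern s u v b a c = 0.
Proof. by move=> bu h; rewrite /kern (boxedW bu) ?mulr0 ?mul0r //; left. Qed.

Lemma dkern_supp M e u v b a c : boxed M e u -> M < `|c| -> dkern u v b a c = 0.
Proof.
move=> bu h; rewrite /dkern (boxedW bu); last by left.
by rewrite (boxedW (boxed_derive (w := da) bu)) ?mulr0 ?mul0r ?mulr0 ?addr0 ?subr0 //; left.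
Qed.

Lemma onepsc s M c : `|s| * M <= 2^-1 -> `|c| <= M -> 2^-1 <= 1 + s * c <= 3 / 2.
Proof.
move=> sM cM; have : `|s * c| <= 2^-1.
  by rewrite normrM (le_trans _ sM) // ler_wpM2l.
rewrite ler_norml => /andP[h1 h2]; apply/andP; split; lra.
Qed.

(** Since 1 + s c <= 3/2, the quotient still exceeds 4 M/3. *)
Lemma far_quotient s M c x : `|s| * M <= 2^-1 -> `|c| <= M -> 0 < M -> 2 * M < `|x| ->
  M < `|x / (1 + s * c)|.
Proof.
move=> sM cM M0 hx; have /andP[h1 h2] := onepsc sM cM.
have p0 : 0 < 1 + s * c by lra.
rewrite normrM normfV (gtr0_norm p0) ltr_pdivlMr //; nra.
Qed.

Lemma kern_far M e u v s b a c : 0 < M -> boxed M e u -> boxed M e v ->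
  `|s| * M <= 2^-1 -> 3 * M < `|b| \/ 2 * M < `|a| -> kern s u v b a c = 0.
Proof.
move=> M0 bu bv sM far; have [/(kern_supp _ _ _ _ bu)//|cM] := ltP M `|c|.
rewrite /kern (boxedW bv) ?mulr0 //; case: far => far /=; [left|right; left].
- apply: (@far_quotient s M c _ sM cM M0); have := ler_normD (b - c) c; rewrite subrK; lra.
- exact: (@far_quotient s M c _ sM cM M0).
Qed.

Lemma dkern_far M e u v b a c : 0 < M -> boxed M e u -> boxed M e v ->
  3 * M < `|b| \/ 2 * M < `|a| -> dkern u v b a c = 0.
Proof.
move=> M0 bu bv far; have [/(dkern_supp _ _ _ bu)//|cM] := ltP M `|c|.
have h : M < `|(b - c, a).1| \/ M < `|(b - c, a).2| \/ `|(b - c, a).2| < e.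
  case: far => far /=; [left|right; left].
    by have := ler_normD (b - c) c; rewrite subrK; lra.
  lra.
rewrite /dkern (boxedW bv h) (boxedW (boxed_derive (w := da) bv) h)
  (boxedW (boxed_derive (w := db) bv) h) !mulr0 !subr0 addr0 //.
Qed.

(** The remainder of the geometric series is s^2 c^2/(1 + s c), at most 2 M^2 s^2. *)
Lemma approx2_weight s M c : 0 < M -> `|s| * M <= 2^-1 -> `|c| <= M ->
  approx2 (1 + M + 2 * M ^+ 2) s (`|1 + s * c|^-1) 1 (- c).
Proof.
move=> M0 sM cM; have /andP[q1 q2] := onepsc sM cM.
have q0 : 0 < 1 + s * c by lra.
have M2 := sqr_ge0 M; have s20 := sqr_ge0 s.
rewrite (gtr0_norm q0); split; [|rewrite normr1; lra|rewrite normrN; lra].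
have -> : (1 + s * c)^-1 - 1 - s * - c = s ^+ 2 * (c ^+ 2 * (1 + s * c)^-1).
  by field; rewrite gt_eqF.
rewrite normrM (ger0_norm s20) mulrC ler_wpM2r // normrM normfV (gtr0_norm q0) normrX.
apply: (@le_trans _ _ (M ^+ 2 * 2)); last by lra.
apply: ler_pM; rewrite ?invr_ge0 ?(ltW q0) ?exprn_ge0 //.
  by rewrite ler_pXn2r // ?nnegrE // ltW.
by rewrite -[leRHS]invrK lef_pV2 ?posrE.
Qed.

(** The displacement is vertical and exactly linear in [s]; its length at most [4 * M * |s|] gives
    the factor 16. *)
Lemma approx2_left u M A B L s b a c : 0 < M -> 0 <= L -> 0 <= A -> 0 <= B ->
  (forall p, `|u p| <= A) -> (forall p, `|'D_da u p| <= B) ->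
  (forall x y h k : R,
    `|u (x + h, y + k) - u (x, y) - h * 'D_db u (x, y) - k * 'D_da u (x, y)|
      <= L * (`|h| + `|k|) ^+ 2) ->
  `|b - c| <= 4 * M ->
  approx2 (A + 4 * M * B + 16 * L * M ^+ 2) s
    (u (c, a + s * (c - b))) (u (c, a)) ((c - b) * 'D_da u (c, a)).
Proof.
move=> M0 L0 A0 B0 hA hB hL bc; have s20 := sqr_ge0 s.
have h0 : 0 <= 4 * M * B by rewrite !mulr_ge0 // ltW.
have h1 : 0 <= 16 * L * M ^+ 2 by rewrite mulr_ge0 ?sqr_ge0 // mulr_ge0.
split.
- have := hL c a 0 (s * (c - b)); rewrite addr0 mul0r subr0 normr0 add0r real_normK ?num_real // -mulrA => h.
  apply: (le_trans h); rewrite exprMn mulrCA mulrC ler_wpM2r //.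
  apply: (@le_trans _ _ (16 * L * M ^+ 2)); last by lra.
  have -> : 16 * L * M ^+ 2 = L * (4 * M) ^+ 2 by ring.
  rewrite ler_wpM2l // -(real_normK (num_real (c - b))) ler_pXn2r //.
  + by rewrite distrC.
  + by rewrite nnegrE mulr_ge0 // ltW.
- by rewrite (le_trans (hA _)) // -addrA lerDl addr_ge0.
- rewrite normrM distrC (le_trans (ler_pM _ _ bc (hB _))) //; lra.
Qed.

(** Here the displacement (h, k) is itself a series in [s]: its linear part gives the first-order
    term, its quadratic remainder the terms in M^3. With |h| <= 8 M^2 |s| and |k| <= 4 M^2 |s|, the
    Taylor remainder has the factor 144 = (8 + 4)^2. *)
Lemma approx2_right v M A B B' L s b a c : 0 < M -> 0 <= L -> 0 <= A -> 0 <= B -> 0 <= B' ->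
  (forall p, `|v p| <= A) -> (forall p, `|'D_db v p| <= B) -> (forall p, `|'D_da v p| <= B') ->
  (forall x y h k : R,
    `|v (x + h, y + k) - v (x, y) - h * 'D_db v (x, y) - k * 'D_da v (x, y)|
      <= L * (`|h| + `|k|) ^+ 2) ->
  `|s| * M <= 2^-1 -> `|c| <= M -> `|b - c| <= 4 * M -> `|a| <= 2 * M ->
  approx2 (A + (4 * M ^+ 2 * B + 2 * M ^+ 2 * B') +
           (144 * L * M ^+ 4 + 8 * M ^+ 3 * B + 4 * M ^+ 3 * B')) s
    (v ((b - c) / (1 + s * c), a / (1 + s * c))) (v (b - c, a))
    (- c * (b - c) * 'D_db v (b - c, a) - c * a * 'D_da v (b - c, a)).
Proof.
move=> M0 L0 A0 B0 B'0 hA hB hB' hL sM cM bc aM.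
have /andP[q1 q2] := onepsc sM cM.
have q0 : 0 < 1 + s * c by lra.
have M0' := ltW M0; have M2 := sqr_ge0 M.
have M3 : 0 <= M ^+ 3 by exact: exprn_ge0.
have M4 : 0 <= M ^+ 4 by exact: exprn_ge0.
pose vb := 'D_db v (b - c, a); pose va := 'D_da v (b - c, a).
rewrite -/vb -/va.
have hvb : `|vb| <= B by exact: hB.
have hva : `|va| <= B' by exact: hB'.
have qi : (1 + s * c)^-1 <= 2 by rewrite -[leRHS]invrK lef_pV2 ?posrE.
have qi0 : 0 <= (1 + s * c)^-1 by rewrite invr_ge0 ltW.
pose r := (1 + s * c)^-1; rewrite -/r in qi qi0 *.
have rq : r * (1 + s * c) = 1 by rewrite mulVf // gt_eqF.
have ids x : x * r = x + - (x * (s * c) * r).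
  have -> : x + - (x * (s * c) * r) = x * r + x * (1 - r * (1 + s * c)) by ring.
  by rewrite rq subrr mulr0 addr0.
have idt x : - (x * (s * c) * r) + s * (c * x) = x * ((s * c) ^+ 2 * r).
  have -> : x * ((s * c) ^+ 2 * r) = x * (s * c) * (r * (1 + s * c) - r) by ring.
  by rewrite rq; ring.
have scM : `|s * c| <= `|s| * M by rewrite normrM ler_wpM2l.
have sr : (s * c) ^+ 2 * r <= s ^+ 2 * M ^+ 2 * 2.
  apply: ler_pM => //; first exact: sqr_ge0.
  rewrite exprMn ler_wpM2l ?sqr_ge0 // -(real_normK (num_real c)).
  by rewrite ler_pXn2r // nnegrE.
have sr0 : 0 <= (s * c) ^+ 2 * r by apply: mulr_ge0 => //; exact: sqr_ge0.
have b1 : 0 <= 4 * M ^+ 2 * B by apply: mulr_ge0 => //; apply: mulr_ge0.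
have b2 : 0 <= 2 * M ^+ 2 * B' by apply: mulr_ge0 => //; apply: mulr_ge0.
have b3 : 0 <= 144 * L * M ^+ 4 by apply: mulr_ge0 => //; apply: mulr_ge0.
have b4 : 0 <= 8 * M ^+ 3 * B by apply: mulr_ge0 => //; apply: mulr_ge0.
have b5 : 0 <= 4 * M ^+ 3 * B' by apply: mulr_ge0 => //; apply: mulr_ge0.
split; last 2 first.
- by rewrite (le_trans (hA _)) // -addrA lerDl !addr_ge0.
- have f1 : `|- c * (b - c) * vb| <= 4 * M ^+ 2 * B.
    rewrite !normrM normrN; have -> : 4 * M ^+ 2 * B = M * (4 * M) * B by ring.
    by apply: ler_pM; [exact: mulr_ge0|by []|exact: ler_pM|by []].
  have f2 : `|c * a * va| <= 2 * M ^+ 2 * B'.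
    rewrite !normrM; have -> : 2 * M ^+ 2 * B' = M * (2 * M) * B' by ring.
    by apply: ler_pM; [exact: mulr_ge0|by []|exact: ler_pM|by []].
  rewrite (le_trans (ler_normB _ _)) //.
  rewrite -[leLHS]addr0 lerD ?addr_ge0 //.
  by rewrite -[leLHS]add0r !lerD.
rewrite (ids (b - c)) (ids a); set h := - ((b - c) * (s * c) * r); set k := - (a * (s * c) * r).
have hM : `|h| <= 8 * M ^+ 2 * `|s|.
  rewrite /h normrN !normrM -normrM (ger0_norm qi0).
  have -> : 8 * M ^+ 2 * `|s| = 4 * M * (`|s| * M) * 2 by ring.
  by apply: ler_pM; [exact: mulr_ge0|by []|exact: ler_pM|by []].
have kM : `|k| <= 4 * M ^+ 2 * `|s|.
  rewrite /k normrN !normrM -normrM (ger0_norm qi0).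
  have -> : 4 * M ^+ 2 * `|s| = 2 * M * (`|s| * M) * 2 by ring.
  by apply: ler_pM; [exact: mulr_ge0|by []|exact: ler_pM|by []].
have -> : v (b - c + h, a + k) - v (b - c, a) - s * (- c * (b - c) * vb - c * a * va) =
  (v (b - c + h, a + k) - v (b - c, a) - h * vb - k * va) +
  (h + s * (c * (b - c))) * vb + (k + s * (c * a)) * va by ring.
have e1 : `|v (b - c + h, a + k) - v (b - c, a) - h * vb - k * va| <= 144 * L * M ^+ 4 * s ^+ 2.
  apply: (le_trans (hL _ _ _ _)).
  have -> : 144 * L * M ^+ 4 * s ^+ 2 = L * (8 * M ^+ 2 * `|s| + 4 * M ^+ 2 * `|s|) ^+ 2.
    by rewrite -(real_normK (num_real s)); ring.
  rewrite ler_wpM2l // ler_pXn2r // ?nnegrE ?addr_ge0 ?lerD //; apply: mulr_ge0 => //; exact: mulr_ge0.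
have e2 : `|(h + s * (c * (b - c))) * vb| <= 8 * M ^+ 3 * B * s ^+ 2.
  rewrite idt normrM normrM (ger0_norm sr0).
  have -> : 8 * M ^+ 3 * B * s ^+ 2 = 4 * M * (s ^+ 2 * M ^+ 2 * 2) * B by ring.
  by apply: ler_pM; [exact: mulr_ge0|by []|exact: ler_pM|by []].
have e3 : `|(k + s * (c * a)) * va| <= 4 * M ^+ 3 * B' * s ^+ 2.
  rewrite idt normrM normrM (ger0_norm sr0).
  have -> : 4 * M ^+ 3 * B' * s ^+ 2 = 2 * M * (s ^+ 2 * M ^+ 2 * 2) * B' by ring.
  by apply: ler_pM; [exact: mulr_ge0|by []|exact: ler_pM|by []].
apply: (@le_trans _ _ ((144 * L * M ^+ 4 + 8 * M ^+ 3 * B + 4 * M ^+ 3 * B') * s ^+ 2)).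
  rewrite [leRHS]mulrDl [X in _ <= X + _]mulrDl.
  apply: (le_trans (ler_normD _ _)); apply: lerD; last exact: e3.
  by apply: (le_trans (ler_normD _ _)); apply: lerD; [exact: e1|exact: e2].
by rewrite ler_wpM2r ?sqr_ge0 // lerDr !addr_ge0.
Qed.

(** Uniformity comes from the supports: unless |c| <= M, |b| <= 3 M and |a| <= 2 M, the kernels and
    their derivative vanish; in this range the three factor expansions are multiplied. *)
Lemma kern_approx M e u v : 0 < M -> boxed M e u -> boxed M e v -> Ck 2 u -> Ck 2 v ->
  exists C : R, 0 <= C /\ forall s, `|s| <= 1 -> `|s| * M <= 2^-1 -> forall b a c,
    approx2 C s (kern s u v b a c) (kern 0 u v b a c) (dkern u v b a c).
Proof.
move=> M0 bu bv su sv.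
have [A [A0 hA]] := boxed_bounded bu (Ck_continuous su).
have [A' [A'0 hA']] := boxed_bounded bv (Ck_continuous sv).
have /CkSE[_ [_ _ cua]] := su; have /CkSE[_ [_ cvb cva]] := sv.
have [B [B0 hB]] := boxed_bounded (boxed_derive (w := da) bu) (Ck_continuous cua).
have [B' [B'0 hB']] := boxed_bounded (boxed_derive (w := da) bv) (Ck_continuous cva).
have [B2 [B20 hB2]] := boxed_bounded (boxed_derive (w := db) bv) (Ck_continuous cvb).
have [L [L0 hL]] := taylor2_lipschitz bu su.
have [L' [L'0 hL']] := taylor2_lipschitz bv sv.
set C1 := 1 + M + 2 * M ^+ 2.
set C2 := A + 4 * M * B + 16 * L * M ^+ 2.
set C3 := A' + (4 * M ^+ 2 * B2 + 2 * M ^+ 2 * B') +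
           (144 * L' * M ^+ 4 + 8 * M ^+ 3 * B2 + 4 * M ^+ 3 * B').
(* The expansions are evaluated at [s = 0] and at the origin only to read off that their constants
   are nonnegative. *)
have M00 : `|0 : R| <= M by rewrite normr0 ltW.
have M0s : `|0 : R| * M <= 2^-1 by rewrite normr0 mul0r.
have M04 : `|0 - 0 : R| <= 4 * M by rewrite subr0 normr0 mulr_ge0 // ltW.
have M02 : `|0 : R| <= 2 * M by rewrite normr0 mulr_ge0 // ltW.
have C10 : 0 <= C1 := approx2_ge0 (approx2_weight M0 M0s M00).
have C20 : 0 <= C2 := approx2_ge0 (approx2_left 0 0 M0 L0 A0 B0 hA hB hL M04).
have C30 : 0 <= C3 := approx2_ge0 (approx2_right M0 L'0 A'0 B20 B'0 hA' hB2 hB' hL' M0s M00 M04 M02).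
exists (6 * (6 * C1 * C2) * C3); split; first by rewrite !mulr_ge0.
move=> s s1 sM b a c.
have Z : approx2 (6 * (6 * C1 * C2) * C3) s 0 0 0.
  have K0 : 0 <= 6 * (6 * C1 * C2) * C3 by rewrite !mulr_ge0.
  by split; rewrite ?(mulr0, subr0) normr0 // mulr_ge0 // sqr_ge0.
have [cM|cM] := ltP M `|c|.
  by rewrite !(kern_supp _ _ _ _ bu) // (dkern_supp _ _ _ bu).
have [far|[bM aM]] : (3 * M < `|b| \/ 2 * M < `|a|) \/ (`|b| <= 3 * M /\ `|a| <= 2 * M).
  have [h|h] := ltP (3 * M) `|b|; first by left; left.
  by have [h'|h'] := ltP (2 * M) `|a|; [left; right|right].
  by rewrite (kern_far c M0 bu bv sM far) (kern_far c M0 bu bv M0s far) (dkern_far c M0 bu bv far).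
have bc : `|b - c| <= 4 * M.
  by rewrite (le_trans (ler_normB _ _)) // (_ : 4 * M = 3 * M + M) ?lerD //; ring.
have := approx2M s1 (approx2M s1 (approx2_weight M0 sM cM) (approx2_left s a M0 L0 A0 B0 hA hB hL bc))
  (approx2_right M0 L'0 A'0 B20 B'0 hA' hB2 hB' hL' sM cM bc aM).
rewrite kern0E /kern /dkern mul1r -/C1 -/C2 -/C3.
set ua := 'D_da u _; set va := 'D_da v _; set vb := 'D_db v _.
by congr approx2; ring.
Qed.

Lemma continuous_u_line u (f g : R -> R) : continuous u ->
  measurable_fun setT f -> measurable_fun setT g -> measurable_fun setT (fun c => u (f c, g c)).
Proof.
move=> cu mf mg; have mu := continuous_measurable2 cu.
by apply: (measurableT_comp mu); exact: measurable_fun_pair.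
Qed.

Lemma measurable_kern s u v b a : continuous u -> continuous v ->
  measurable_fun setT (kern s u v b a).
Proof.
move=> cu cv.
have m1 : measurable_fun setT (fun c : R => 1 + s * c).
  by apply: measurable_funD => //; exact: measurable_funM.
have mi : measurable_fun setT (fun c : R => (1 + s * c)^-1).
  exact: (measurableT_comp measurable_invr).
apply: measurable_funM; first apply: measurable_funM.
- apply: (measurableT_comp measurable_invr); exact: measurableT_comp.
- apply: continuous_u_line => //; apply: measurable_funD => //; apply: measurable_funM => //.
  exact: measurable_funB.
- apply: continuous_u_line => //; apply: measurable_funM => //; exact: measurable_funB.
Qed.

Lemma measurable_dkern u v b a : Ck 1 u -> Ck 1 v -> measurable_fun setT (dkern u v b a).
Proof.
move=> /CkSE[cu [_ _ [cua _]]] /CkSE[cv [_ [cvb _] [cva _]]].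
have mB : measurable_fun setT (fun c : R => b - c) by exact: measurable_funB.
have mB' : measurable_fun setT (fun c : R => c - b) by exact: measurable_funB.
have mu := continuous_u_line cu (@measurable_id _ R setT) (measurable_cst a).
have mua := continuous_u_line cua (@measurable_id _ R setT) (measurable_cst a).
have mv := continuous_u_line cv mB (measurable_cst a).
have mvb := continuous_u_line cvb mB (measurable_cst a).
have mva := continuous_u_line cva mB (measurable_cst a).
have mid := @measurable_id _ R setT.
have mca : measurable_fun setT (fun c : R => c * a) by exact: measurable_funM.
have mcb : measurable_fun setT (fun c : R => c * (b - c)) by exact: measurable_funM.
have mN : measurable_fun setT (fun c : R => - c) by apply: (eq_measurable_fun (fun c : R => 0 - c)); [move=> c _; rewrite sub0r|exact: measurable_funB].
apply: measurable_funB; last exact: (measurable_funM mca (measurable_funM mu mva)).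
apply: measurable_funB; last exact: (measurable_funM mcb (measurable_funM mu mvb)).
apply: measurable_funD; first exact: (measurable_funM mN (measurable_funM mu mv)).
exact: (measurable_funM (measurable_funM mB' mua) mv).
Qed.

Lemma integrable_measurable_compact (F : R -> R) M C : measurable_fun setT F ->
  (forall c, M < `|c| -> F c = 0) -> (forall c, `|F c| <= C) -> mu1.-integrable setT (EFin \o F).
Proof.
move=> mF F0 FC.
have M0 : 0 < `|M| + 1 by rewrite ltr_wpDl.
have F0' c : `|M| + 1 < `|c| -> F c = 0.
  by move=> h; apply: F0; apply: le_lt_trans h; rewrite (le_trans (ler_norm M)) // lerDl.
have : mu1.-integrable (symitv (`|M| + 1)) (EFin \o F).
  apply: measurable_bounded_integrable; first exact: measurable_symitv.
  - by rewrite /= lebesgue_symitv // ltry.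
  - exact: measurable_funTS.
  - exists C; split; first exact: num_real.
    by move=> x hx c _ /=; rewrite (le_trans (FC c)) // ltW.
move=> h; have := (@integrable_mkcond _ _ R mu1 _ (EFin \o F) (measurable_symitv _)).1 h.
congr (_.-integrable _ _); apply/funext => c; rewrite /patch.
case: ifPn => //; rewrite notin_setE /symitv /= in_itv /= -ler_norml => /negP.
by rewrite -ltNge => /F0' ->.
Qed.

Lemma Rintegral_bound (F : R -> R) M C : 0 < M ->
  (forall c, M < `|c| -> F c = 0) -> (forall c, `|F c| <= C) ->
  `|\int[mu1]_c F c| <= 2 * M * C.
Proof.
move=> M0 F0 FC; have C0 : 0 <= C by exact: le_trans (FC 0).
have : (`|\int[mu1]_c (F c)%:E| <= (2 * M * C)%:E)%E.
  rewrite -integral_itv_sym_cst // [leRHS]integral_mkcond.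
  apply: abse_integral_le_nonmeasurable => c; rewrite /patch; case: ifPn.
    by rewrite lee_fin.
  rewrite notin_setE /symitv /= in_itv /= -ler_norml => /negP.
  by rewrite -ltNge => /F0 ->; rewrite normr0.
rewrite /Rintegral; case: (\int[mu1]_c _)%E => [r||] //=; rewrite ?normr0 ?mulr_ge0 // ltW //.
Qed.

(** The twisted convolution of real functions; [bdconv] is its first-order coefficient at
    [s = 0]. *)
Definition bconv s u v (p : R * R) : R := \int[mu1]_c kern s u v p.1 p.2 c.
Definition bdconv u v (p : R * R) : R := \int[mu1]_c dkern u v p.1 p.2 c.

Lemma bconv0 u v p : bconv 0 u v p = fconv u v p.
Proof. by apply: eq_Rintegral => c _; rewrite kern0E. Qed.

Lemma bconv_far M e u v s p : 0 < M -> boxed M e u -> boxed M e v ->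
  `|s| * M <= 2^-1 -> 3 * M < `|p.1| -> bconv s u v p = 0.
Proof.
move=> M0 bu bv sM far.
apply/eqP; rewrite -normr_eq0 eq_le normr_ge0 andbT.
have := @Rintegral_bound (kern s u v p.1 p.2) M 0 M0; rewrite mulr0; apply.
- by move=> c; exact: kern_supp bu.
- by move=> c; rewrite (kern_far c M0 bu bv sM) ?normr0 //; left.
Qed.

Lemma bconv_approx M e u v : 0 < M -> boxed M e u -> boxed M e v -> Ck 2 u -> Ck 2 v ->
  exists C : R, 0 <= C /\ forall s, `|s| <= 1 -> `|s| * M <= 2^-1 -> forall p,
    approx2 C s (bconv s u v p) (fconv u v p) (bdconv u v p).
Proof.
move=> M0 bu bv su sv; have [C [C0 H]] := kern_approx M0 bu bv su sv.
exists (2 * M * C); split; first by rewrite !mulr_ge0 // ltW.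
move=> s s1 sM p; rewrite -bconv0.
have M0s : `|0 : R| * M <= 2^-1 by rewrite normr0 mul0r.
have z1 : `|0 : R| <= 1 by rewrite normr0.
have cu := Ck_continuous su; have cv := Ck_continuous sv.
have mk t := measurable_kern t p.1 p.2 cu cv.
have mD := measurable_dkern p.1 p.2 (CkS su) (CkS sv).
have Z t c : M < `|c| -> kern t u v p.1 p.2 c = 0 by exact: kern_supp bu.
have ZD c : M < `|c| -> dkern u v p.1 p.2 c = 0 by exact: dkern_supp bu.
have b0 c : `|kern 0 u v p.1 p.2 c| <= C by have [] := H s s1 sM p.1 p.2 c.
have bD c : `|dkern u v p.1 p.2 c| <= C by have [] := H s s1 sM p.1 p.2 c.
have i0 := integrable_measurable_compact (mk 0) (Z 0) b0.
have iD := integrable_measurable_compact mD ZD bD.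
have bs c : `|kern s u v p.1 p.2 c| <= C * s ^+ 2 + C + `|s| * C.
  have [h1 h2 h3] := H s s1 sM p.1 p.2 c.
  have -> : kern s u v p.1 p.2 c = (kern s u v p.1 p.2 c - kern 0 u v p.1 p.2 c - s * dkern u v p.1 p.2 c)
     + kern 0 u v p.1 p.2 c + s * dkern u v p.1 p.2 c by ring.
  rewrite (le_trans (ler_normD _ _)) // lerD //; last by rewrite normrM ler_wpM2l.
  by rewrite (le_trans (ler_normD _ _)) // lerD.
have is_ := integrable_measurable_compact (mk s) (Z s) bs.
split.
- have iDs : mu1.-integrable setT (EFin \o (fun c => s * dkern u v p.1 p.2 c)).
    apply: (@integrable_measurable_compact _ M (`|s| * C)); first exact: measurable_funM.
      by move=> c /ZD ->; rewrite mulr0.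
    by move=> c; rewrite normrM ler_wpM2l.
  have i0s : mu1.-integrable setT (EFin \o (fun c => kern s u v p.1 p.2 c - kern 0 u v p.1 p.2 c)).
    apply: (@integrable_measurable_compact _ M (C * s ^+ 2 + C + `|s| * C + C)); first exact: measurable_funB.
      by move=> c cM; rewrite !Z // subrr.
    by move=> c; rewrite (le_trans (ler_normB _ _)) // lerD.
  have -> : bconv s u v p - bconv 0 u v p - s * bdconv u v p =
     \int[mu1]_c (kern s u v p.1 p.2 c - kern 0 u v p.1 p.2 c - s * dkern u v p.1 p.2 c).
    rewrite (RintegralB measurableT i0s iDs) (RintegralB measurableT is_ i0).
    by rewrite (RintegralZl s measurableT iD).
  rewrite -mulrA; apply: (@Rintegral_bound _ M) => //.
    by move=> c cM; rewrite !Z // ZD // mulr0 !subr0.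
  by move=> c; have [] := H s s1 sM p.1 p.2 c.
- by apply: (@Rintegral_bound _ M) => //; exact: Z.
- by apply: (@Rintegral_bound _ M).
Qed.

End Taylor.

(** * Substitutions and total derivatives in signed integrals *)

Section Substitution.
Context {R : realType}.
Local Notation mu1 := (@lebesgue_measure R).

(** The positive and negative parts scale separately. Infinite parts stay infinite under [k > 0], so
    the formula also holds for the default value of a divergent integral. *)
Lemma Rintegral_comp (phi : R -> R) (k : R) : 0 < k ->
  (forall f : measurableTypeR R -> \bar R, measurable_fun setT f -> (forall x, 0 <= f x)%E ->
    \int[mu1]_x f (phi x) = k%:E * \int[mu1]_x f x)%E ->
  forall F : R -> R, measurable_fun setT F ->
    \int[mu1]_x F (phi x) = k * \int[mu1]_x F x.
Proof.
move=> k0 H F mF; rewrite /Rintegral.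
have mE : measurable_fun [set: measurableTypeR R] (EFin \o F) by exact/measurable_EFinP.
rewrite (integralE mu1 setT (fun x => (F (phi x))%:E)) (integralE mu1 setT (fun x => (F x)%:E)).
have Ep : (\int[mu1]_x ((fun x => (F (phi x))%:E)^\+ x) = k%:E * \int[mu1]_x ((EFin \o F)^\+ x))%E.
  rewrite -H; [|exact: measurable_funepos|by move=> x].
  by apply: eq_integral => x _; rewrite !funeposE.
have En : (\int[mu1]_x ((fun x => (F (phi x))%:E)^\- x) = k%:E * \int[mu1]_x ((EFin \o F)^\- x))%E.
  rewrite -H; [|exact: measurable_funeneg|by move=> x].
  by apply: eq_integral => x _; rewrite !funenegE.
rewrite Ep En.
have : (0 <= \int[mu1]_x (EFin \o F)^\+ x)%E by apply: integral_ge0.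
have : (0 <= \int[mu1]_x (EFin \o F)^\- x)%E by apply: integral_ge0.
move: (\int[mu1]_x (EFin \o F)^\+ x)%E (\int[mu1]_x (EFin \o F)^\- x)%E.
move=> [x| |] [y| |] //= _ _; rewrite ?gt0_muley ?lte_fin //= ?mulr0 //.
by rewrite mulrBr.
Qed.

(** The affine substitution covers positive slopes, so the reflection is composed from the
    invariance under sign change and a translation. *)
Lemma Rintegral_reflect (b : R) (F : R -> R) : measurable_fun setT F ->
  \int[mu1]_x F (b - x) = \int[mu1]_x F x.
Proof.
move=> mF; rewrite -[RHS]mul1r.
apply: (@Rintegral_comp (fun x => b - x) 1) => // f mf f0; rewrite mul1e.
have mN : measurable_fun [set: measurableTypeR R] (-%R : measurableTypeR R -> measurableTypeR R).
  by apply: (eq_measurable_fun (fun c : R => 0 - c)); [move=> c _; rewrite sub0r|exact: measurable_funB].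
have mb : measurable_fun [set: measurableTypeR R] (fun x => f (b + x)%R).
  by apply: (measurableT_comp mf); exact: measurable_funD.
transitivity (\int[pushforward mu1 (-%R : measurableTypeR R -> measurableTypeR R)]_x f (b + x)%R)%E.
  rewrite (ge0_integral_pushforward mN mu1 measurableT mb); last by move=> x _.
  by rewrite preimage_setT.
transitivity (\int[mu1]_x f (b + x)%R)%E.
  by apply: eq_measure_integral => A mA _; exact: lebesgue_measureN.
have := @ge0_integral_affine R (- b) 1 f ltr01 mf f0; rewrite mul1e => <-.
by apply: eq_integral => x _; rewrite opprK divr1 addrC.
Qed.

(** The fundamental theorem on [-M, M], with [G] zero at both endpoints. *)
Lemma Rintegral_derivative0 (G g : R -> R) (M : R) : 0 < M ->
  (forall c, M <= `|c| -> G c = 0) -> (forall c : R, is_derive c 1 G (g c)) ->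
  continuous g -> (forall c, M < `|c| -> g c = 0) -> \int[mu1]_c g c = 0.
Proof.
move=> M0 G0 dG cg g0.
rewrite (Rintegral_itv_sym g0) /Rintegral.
have dG' c : derivable G c 1 by have [] := dG c.
have cG : continuous G by move=> z; apply: differentiable_continuous; exact/derivable1_diffP.
rewrite (@continuous_FTC2 _ g G) /=.
- by rewrite G0 ?ger0_norm ?(ltW M0) // G0 ?normrN ?ger0_norm ?(ltW M0) // subrr.
- lra.
- exact: continuous_subspaceT.
- split.
  + by move=> x _; exact: dG'.
  + by apply: cvg_at_right_filter; exact: cG.
  + by apply: cvg_at_left_filter; exact: cG.
- by move=> x _; rewrite derive1E; have [_ ->] := dG x.
Qed.

End Substitution.

(** * The bracket as antisymmetrized first-order term *)

Section BracketIdentity.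
Context {R : realType}.
Implicit Types (u v : R * R -> R) (M e : R).
Local Notation mu1 := (@lebesgue_measure R).

Definition mulfst u (p : R * R) : R := p.1 * u p.

(** In the factor a - 1, the a comes from the argument a/(1 + s c) of the second function and the -1
    from the argument a + s (c - b) of the first. The weight and the [b]-derivatives combine into a
    total derivative in [c]. *)
Lemma bdconv_antisym M e u v : 0 < M -> boxed M e u -> boxed M e v -> Ck 1 u -> Ck 1 v ->
  forall p, bdconv u v p - bdconv v u p =
    (p.2 - 1) * (fconv ('D_da u) (mulfst v) p - fconv ('D_da v) (mulfst u) p).
Proof.
move=> M0 bu bv su sv [b a]; rewrite /bdconv /fconv /mulfst /=.
have /CkSE[cu [du [cub _] [cua _]]] := su; have /CkSE[cv [dv [cvb _] [cva _]]] := sv.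
have lc (w : R * R -> R) : continuous w -> continuous (fun c : R => w (c, a)).
  move=> cw c; apply: (@continuous_comp _ _ _ (fun c : R => (c, a)) w); last exact: cw.
  by apply: continuous_pairf => x; [exact: cvg_id|exact: cvg_cst].
have cB : continuous (fun c : R => b - c).
  by move=> c; apply: cvgB; [exact: cvg_cst|exact: cvg_id].
have lb (w : R * R -> R) : continuous w -> continuous (fun c : R => w (b - c, a)).
  move=> cw c; apply: (@continuous_comp _ _ _ (fun c : R => b - c) (fun c : R => w (c, a))); last exact: lc.
  exact: cB.
have cid : continuous (fun c : R => c) by move=> c; exact: cvg_id.
have cst' (r : R) : continuous (fun c : R => r) by move=> c; exact: cvg_cst.
have cM (f g : R -> R) : continuous f -> continuous g -> continuous (fun c => f c * g c).
  by move=> cf cg c; apply: cvgM; [exact: cf|exact: cg].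
have cBB (f g : R -> R) : continuous f -> continuous g -> continuous (fun c => f c - g c).
  by move=> cf cg c; apply: cvgB; [exact: cf|exact: cg].
have zu c : M < `|c| -> u (c, a) = 0 by move=> h; rewrite (boxedW bu) //; left.
have zua c : M < `|c| -> 'D_da u (c, a) = 0.
  by move=> h; rewrite (boxedW (boxed_derive (w := da) bu)) //; left.
have zub c : M < `|c| -> 'D_db u (c, a) = 0.
  by move=> h; rewrite (boxedW (boxed_derive (w := db) bu)) //; left.
have mc (f : R -> R) : continuous f -> measurable_fun setT f by exact: continuous_measurable_fun.
(* The derivative in c of c (b - c) u(c, a) v(b - c, a). *)
pose g c := (b - c - c) * (u (c, a) * v (b - c, a)) + c * (b - c) *
  ('D_db u (c, a) * v (b - c, a) - u (c, a) * 'D_db v (b - c, a)).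
have cg : continuous g.
  move=> c; apply: cvgD.
    by apply: (cM _ _ (cBB _ _ cB cid) (cM _ _ (lc _ cu) (lb _ cv))).
  apply: (cM _ _ (cM _ _ cid cB) (cBB _ _ (cM _ _ (lc _ cub) (lb _ cv)) (cM _ _ (lc _ cu) (lb _ cvb)))).
have g0 c : M < `|c| -> g c = 0.
  by move=> h; rewrite /g zu // zub // !mul0r subrr !mulr0 addr0.
have gint : \int[mu1]_c g c = 0.
  (* Boxedness gives zeros only for |c| > M, whereas the endpoints themselves must be zeros; hence
     the larger interval. *)
  have M1 : 0 < M + 1 by rewrite addr_gt0.
  apply: (@Rintegral_derivative0 _ (fun c => c * (b - c) * (u (c, a) * v (b - c, a))) _ (M + 1)) => //.
  - by move=> c h; rewrite zu ?mul0r ?mulr0 //; lra.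
  - move=> c.
    have Du : is_derive c 1 (fun x : R => u (x, a)) ('D_db u (c, a)).
      by rewrite derive_dbE; apply: derivableP; rewrite -derivable_dbE; apply (du _).1.
    have Dv : is_derive c 1 (fun x : R => v (b - x, a)) (- 'D_db v (b - c, a)).
      have Hi : is_derive (b - c) 1 (fun y : R => v (y, a)) ('D_db v (b - c, a)).
        by rewrite derive_dbE; apply: derivableP; rewrite -derivable_dbE; apply (dv _).1.
      have Ho : is_derive c 1 (fun y : R => b - y) (- 1).
        by have := is_deriveB (is_derive_cst b c (1 : R)) (is_derive_id c (1 : R)); rewrite sub0r.
      have := @is_derive1_comp _ (fun y => v (y, a)) (fun y => b - y) c _ _ Hi Ho.
      by rewrite mulrN1.
    have DB : is_derive c 1 (fun y : R => b - y) (- 1).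
      by have := is_deriveB (is_derive_cst b c (1 : R)) (is_derive_id c (1 : R)); rewrite sub0r.
    have DP : is_derive c 1 (fun y : R => y * (b - y)) (c * (- 1) + (b - c) * 1).
      exact: is_deriveM.
    have DQ := is_deriveM Du Dv.
    have [d3 e3] := is_deriveM DP DQ.
    apply: DeriveDef; first exact: d3.
    apply: (etrans e3); rewrite /g /GRing.scale /= fctE; ring.
  - by move=> c h; rewrite g0 //; lra.
(* The reflection c -> b - c brings the exchanged integrands to the form with [u] at (c, a) and [v]
   at (b - c, a), where they can be compared pointwise. *)
rewrite -(@Rintegral_reflect _ b (dkern v u b a)); last exact: measurable_dkern.
rewrite -(@Rintegral_reflect _ b (fun c => 'D_da v (c, a) * ((b - c) * u (b - c, a)))); last first.
  exact: (mc _ (cM _ _ (lc _ cva) (cM _ _ cB (lb _ cu)))).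
have int (f : R -> R) : continuous f -> (forall c, M < `|c| -> f c = 0) -> mu1.-integrable setT (EFin \o f).
  exact: integrable_of_compact.
pose F1 := dkern u v b a.
pose F2 c := dkern v u b a (b - c).
pose F3 c := 'D_da u (c, a) * ((b - c) * v (b - c, a)).
pose F4 c := 'D_da v (b - c, a) * ((b - (b - c)) * u (b - (b - c), a)).
have E2 c : F2 c = - (b - c) * (v (b - c, a) * u (c, a)) - c * ('D_da v (b - c, a) * u (c, a))
    - (b - c) * c * (v (b - c, a) * 'D_db u (c, a)) - (b - c) * a * (v (b - c, a) * 'D_da u (c, a)).
  by rewrite /F2 /dkern subKr; ring.
have E4 c : F4 c = 'D_da v (b - c, a) * (c * u (c, a)) by rewrite /F4 subKr.
have i1 : mu1.-integrable setT (EFin \o F1).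
  apply: int; last by move=> c; exact: dkern_supp bu.
  move=> c; apply: cvgB; last exact: (cM _ _ (cM _ _ cid (cst' a)) (cM _ _ (lc _ cu) (lb _ cva))).
  apply: cvgB; last exact: (cM _ _ (cM _ _ cid cB) (cM _ _ (lc _ cu) (lb _ cvb))).
  apply: cvgD; last exact: (cM _ _ (cM _ _ (cBB _ _ cid (cst' b)) (lc _ cua)) (lb _ cv)).
  apply: cvgM; last exact: (cM _ _ (lc _ cu) (lb _ cv)).
  by apply: cvgN; exact: cvg_id.
have i2 : mu1.-integrable setT (EFin \o F2).
  apply: int; last by move=> c h; rewrite E2 zu // zua // zub // !mulr0 !subr0.
  rewrite (funext E2) => c.
  apply: cvgB; last exact: (cM _ _ (cM _ _ cB (cst' a)) (cM _ _ (lb _ cv) (lc _ cua))).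
  apply: cvgB; last exact: (cM _ _ (cM _ _ cB cid) (cM _ _ (lb _ cv) (lc _ cub))).
  apply: cvgB; last exact: (cM _ _ cid (cM _ _ (lb _ cva) (lc _ cu))).
  apply: cvgM; last exact: (cM _ _ (lb _ cv) (lc _ cu)).
  by apply: cvgN; exact: cB.
have i3 : mu1.-integrable setT (EFin \o F3).
  apply: int; last by move=> c h; rewrite /F3 zua // mul0r.
  exact: (cM _ _ (lc _ cua) (cM _ _ cB (lb _ cv))).
have i4 : mu1.-integrable setT (EFin \o F4).
  apply: int; last by move=> c h; rewrite E4 zu // !mulr0.
  rewrite (funext E4); exact: (cM _ _ (lb _ cva) (cM _ _ cid (lc _ cu))).
have ig : mu1.-integrable setT (EFin \o g) by exact: int.
rewrite -(RintegralB measurableT i1 i2) -(RintegralB measurableT i3 i4).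
have c34 : continuous (fun c => F3 c - F4 c).
  have c3 : continuous F3 by exact: (cM _ _ (lc _ cua) (cM _ _ cB (lb _ cv))).
  have c4 : continuous F4 by rewrite (funext E4); exact: (cM _ _ (lb _ cva) (cM _ _ cid (lc _ cu))).
  exact: (cBB _ _ c3 c4).
have z34 c : M < `|c| -> F3 c - F4 c = 0.
  by move=> h; rewrite /F3 zua // E4 zu // !mulr0 mul0r subrr.
have i34 := int _ c34 z34.
rewrite -(RintegralZl (a - 1) measurableT i34) -[RHS]addr0 -gint.
have i34a : mu1.-integrable setT (EFin \o (fun c => (a - 1) * (F3 c - F4 c))).
  by apply: (int _ (cM _ _ (cst' (a - 1)) c34)) => c h; rewrite z34 // mulr0.
rewrite -(RintegralD measurableT i34a ig).
apply: eq_Rintegral => c _; rewrite E2 E4 /F1 /F3 /g /dkern; ring.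
Qed.

End BracketIdentity.

(** * The limits as s tends to 0 *)

Section ComplexTestFunctions.
Context {R : realType}.
Implicit Types (f g : R * R -> R[i]) (u v : R * R -> R) (M e s : R).
Local Notation mu1 := (@lebesgue_measure R).
Local Notation normc := (@ComplexField.Normc.normc R).

Definition re f (p : R * R) : R := complex.Re (f p).
Definition im f (p : R * R) : R := complex.Im (f p).

Lemma boxed_re M e f : boxed M e f -> boxed M e (re f).
Proof. by move=> bf p h; apply: bf; apply: contraNneq h => E; rewrite /re E. Qed.

Lemma boxed_im M e f : boxed M e f -> boxed M e (im f).
Proof. by move=> bf p h; apply: bf; apply: contraNneq h => E; rewrite /im E. Qed.

Lemma boxed_complex M e f : boxed M e (re f) -> boxed M e (im f) -> boxed M e f.
Proof.
move=> br bi p h; have [r0|/br//] := eqVneq (re f p) 0.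
have [i0|/bi//] := eqVneq (im f p) 0.
by case/eqP: h; apply: complex_ext; [exact: r0|exact: i0].
Qed.

Lemma smooth_re f k : smooth f -> Ck k (re f). Proof. by move=> /(_ k)[]. Qed.
Lemma smooth_im f k : smooth f -> Ck k (im f). Proof. by move=> /(_ k)[]. Qed.

Lemma boxed_supp M e f : boxed M e f ->
  supp f `<=` [set p | [/\ `|p.1| <= M, `|p.2| <= M & e <= `|p.2|]].
Proof.
move=> bf; rewrite /supp closureE; apply: smallest_sub; last by move=> p /bf.
have c1 : continuous (fun p : R * R => `|p.1|) by move=> p; apply: cvg_norm; exact: cvg_fst.
have c2 : continuous (fun p : R * R => `|p.2|) by move=> p; apply: cvg_norm; exact: cvg_snd.
have -> : [set p : R * R | [/\ `|p.1| <= M, `|p.2| <= M & e <= `|p.2|]] =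
   ((fun p : R * R => `|p.1|) @^-1` [set x | x <= M]) `&`
   (((fun p : R * R => `|p.2|) @^-1` [set x | x <= M]) `&`
   ((fun p : R * R => `|p.2|) @^-1` [set x | e <= x])).
  by apply/seteqP; split => [p [? ? ?]|p [? [? ?]]].
apply: closedI; last apply: closedI.
- by apply: closed_comp => [p _|]; [exact: c1|exact: closed_le].
- by apply: closed_comp => [p _|]; [exact: c2|exact: closed_le].
- by apply: closed_comp => [p _|]; [exact: c2|exact: closed_ge].
Qed.

(** On the box, |s b| < 1 keeps 1 + s b away from 0, and |s b| < e <= |a| does the same for a - s
    b. *)
Lemma boxed_testfun M e f s : 0 < e -> `|s| * M < 1 -> `|s| * M < e ->
  smooth f -> boxed M e f -> testfun s f.
Proof.
move=> e0 s1 se sf bf; have sub := boxed_supp bf; split=> //.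
- apply: (@subclosed_compact _ _ (`[-M, M] `*` `[-M, M])).
  + exact: closed_closure.
  + by apply: compact_setX; exact: segment_compact.
  + by move=> p /sub[h1 h2 _]; split; rewrite /= in_itv /= -ler_norml.
- move=> p /sub[h1 h2 h3].
  have p2 : p.2 != 0 by rewrite -normr_gt0 (lt_le_trans e0).
  have sp : `|s * p.1| <= `|s| * M by rewrite normrM ler_wpM2l.
  split=> //=; rewrite mulf_neq0 //.
    apply/eqP => h; have : `|s * p.1| = 1.
      by rewrite (_ : s * p.1 = -1) ?normrN1 //; apply/eqP; rewrite -addr_eq0 addrC h.
    lra.
  rewrite subr_eq0; apply/eqP => h; move: h3; rewrite h; lra.
Qed.

Lemma boxed_domQ M e f s : 0 < e -> 0 <= M -> `|s| * M < 1 -> `|s| * M < e ->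
  smooth f -> boxed M e f -> domQ s f.
Proof.
move=> e0 M0 s1 se sf bf; split.
  by apply: (boxed_testfun e0 _ _ sf bf); rewrite normr0 mul0r.
move=> d ds; have dM : `|d| * M <= `|s| * M by rewrite ler_wpM2r.
by apply: (boxed_testfun e0 _ _ sf bf); apply: le_lt_trans dM _.
Qed.

(** A bound for the image of [K] under [w^-1] takes the place of a minimum of [w], which covers
    empty [K] as well. *)
Lemma compact_inv_bound (K : set (R * R)) (w : R * R -> R) : compact K -> continuous w ->
  (forall p, K p -> 0 < w p) -> exists d : R, 0 < d /\ forall p, K p -> d <= w p.
Proof.
move=> cK cw w0.
have : compact ((fun p => (w p)^-1) @` K).
  apply: continuous_compact => //; apply: continuous_in_subspaceT => p /set_mem /w0 wp.
  by apply: (@continuous_comp _ _ _ w GRing.inv); [exact: cw|apply: inv_continuous; rewrite gt_eqF].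
move=> /compact_bounded[A [_ HA]].
have A1 : 0 < `|A| + 1 by rewrite ltr_wpDl.
exists (`|A| + 1)^-1; split; first by rewrite invr_gt0.
move=> p Kp; have wp := w0 _ Kp.
have := HA (`|A| + 1); rewrite ltr_pwDr ?ler_norm // => /(_ isT) /(_ (w p)^-1) /=.
move=> H; have {}H : `|(w p)^-1| <= `|A| + 1 by apply: H; exists p.
rewrite gtr0_norm ?invr_gt0 // in H.
by rewrite -[leRHS]invrK lef_pV2 // posrE invr_gt0.
Qed.

Lemma testfun_boxed f : testfun 0 f -> exists M e : R, [/\ 0 < M, 0 < e & boxed M e f].
Proof.
case=> sf cK sub.
have inK p : f p != 0 -> supp f p by move=> h; exact: subset_closure.
have [A [_ HA]] := compact_bounded cK.
have [d [d0 hd]] : exists d : R, 0 < d /\ forall p, supp f p -> d <= `|p.2|.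
  apply: compact_inv_bound => //.
    by move=> p; apply: cvg_norm; exact: cvg_snd.
  by move=> p /sub[/= p2 _]; rewrite normr_gt0.
exists (`|A| + 1), d; split=> //.
move=> p /inK Kp; have := HA (`|A| + 1); rewrite ltr_pwDr ?ler_norm // => /(_ isT) /(_ p Kp) /=.
rewrite /Num.norm /= ge_max => /andP[h1 h2]; split=> //; exact: hd.
Qed.

Lemma testfun_smooth s f : testfun s f -> smooth f. Proof. by case. Qed.

Lemma kern_integrable M e u v s b a : 0 < M -> boxed M e u -> boxed M e v ->
  continuous u -> continuous v -> `|s| * M <= 2^-1 ->
  mu1.-integrable setT (EFin \o kern s u v b a).
Proof.
move=> M0 bu bv cu cv sM.
have [A [A0 hA]] := boxed_bounded bu cu.
have [B [B0 hB]] := boxed_bounded bv cv.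
apply: (@integrable_measurable_compact _ _ M (2 * A * B)).
- exact: measurable_kern.
- by move=> c; exact: kern_supp bu.
- move=> c; have [cM|cM] := ltP M `|c|.
    by rewrite (kern_supp _ _ _ _ bu) // normr0 !mulr_ge0.
  have /andP[q1 q2] := onepsc sM cM.
  have q0 : 0 < 1 + s * c by lra.
  rewrite /kern !normrM normfV normr_id (gtr0_norm q0).
  apply: ler_pM => //; first by rewrite mulr_ge0 // invr_ge0 ltW.
  apply: ler_pM => //; first by rewrite invr_ge0 ltW.
  by rewrite -[leRHS]invrK lef_pV2 ?posrE.
Qed.

(** Bilinearity, once the four real integrals converge; [|s| * M <= 2^-1] bounds the weight by 2 on
    the support. *)
Lemma convolE M e f g s : 0 < M -> boxed M e f -> boxed M e g -> smooth f -> smooth g ->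
  `|s| * M <= 2^-1 -> forall p,
  complex.Re (convol s f g p) = bconv s (re f) (re g) p - bconv s (im f) (im g) p /\
  complex.Im (convol s f g p) = bconv s (re f) (im g) p + bconv s (im f) (re g) p.
Proof.
move=> M0 bf bg sf sg sM [b a].
have i11 := kern_integrable b a M0 (boxed_re bf) (boxed_re bg)
  (Ck_continuous (smooth_re 0 sf)) (Ck_continuous (smooth_re 0 sg)) sM.
have i12 := kern_integrable b a M0 (boxed_re bf) (boxed_im bg)
  (Ck_continuous (smooth_re 0 sf)) (Ck_continuous (smooth_im 0 sg)) sM.
have i21 := kern_integrable b a M0 (boxed_im bf) (boxed_re bg)
  (Ck_continuous (smooth_im 0 sf)) (Ck_continuous (smooth_re 0 sg)) sM.
have i22 := kern_integrable b a M0 (boxed_im bf) (boxed_im bg)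
  (Ck_continuous (smooth_im 0 sf)) (Ck_continuous (smooth_im 0 sg)) sM.
rewrite /convol /Cintegral /bconv /=; split.
  rewrite -(RintegralB measurableT i11 i22); apply: eq_Rintegral => c _.
  by rewrite !cReM !cImM /kern /re /im /=; ring.
rewrite -(RintegralD measurableT i12 i21); apply: eq_Rintegral => c _.
by rewrite !cImM !cReM /kern /re /im /=; ring.
Qed.

(** The algebra at [s = 0] is commutative; this cancels the zeroth-order terms of the commutator. *)
Lemma fconv_comm u v p : continuous u -> continuous v -> fconv u v p = fconv v u p.
Proof.
case: p => b a cu cv; rewrite /fconv /= -(@Rintegral_reflect _ b).
  by apply: eq_Rintegral => c _; rewrite subKr mulrC.
apply: continuous_measurable_fun; exact: continuous_conv_integrand.
Qed.

Lemma convol0E M e f g : 0 < M -> boxed M e f -> boxed M e g -> smooth f -> smooth g -> forall p,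
  complex.Re (convol 0 f g p) = fconv (re f) (re g) p - fconv (im f) (im g) p /\
  complex.Im (convol 0 f g p) = fconv (re f) (im g) p + fconv (im f) (re g) p.
Proof.
move=> M0 bf bg sf sg p.
have M0s : `|0 : R| * M <= 2^-1 by rewrite normr0 mul0r.
by have := convolE M0 bf bg sf sg M0s p; rewrite !bconv0.
Qed.

Lemma smooth_complex f : (forall k, Ck k (re f)) -> (forall k, Ck k (im f)) -> smooth f.
Proof. by move=> h1 h2 k. Qed.

(** Puts [convol 0 f g] in the domain of [Q s] for small [s], so that [Q s] does not return its
    default value 0. *)
Lemma smooth_convol0 M e f g : 0 < M -> boxed M e f -> boxed M e g -> smooth f -> smooth g ->
  smooth (convol 0 f g) /\ boxed (M + M) e (convol 0 f g).
Proof.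
move=> M0 bf bg sf sg; have M0' := ltW M0.
have E := convol0E M0 bf bg sf sg.
have Er : re (convol 0 f g) = fconv (re f) (re g) \- fconv (im f) (im g).
  by apply/funext => p; have [] := E p.
have Ei : im (convol 0 f g) = fconv (re f) (im g) \+ fconv (im f) (re g).
  by apply/funext => p; have [] := E p.
have br := boxed_re bf; have bi := boxed_im bf; have br' := boxed_re bg; have bi' := boxed_im bg.
have sr k := smooth_re k sf; have si k := smooth_im k sf.
have sr' k := smooth_re k sg; have si' k := smooth_im k sg.
split.
  apply: smooth_complex => k.
    by rewrite Er; apply: CkB; apply: (@Ck_conv _ M e).
  by rewrite Ei; apply: CkD; apply: (@Ck_conv _ M e).
have sub u v : boxed (M + M) e u -> boxed (M + M) e v -> boxed (M + M) e (u \+ v).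
  move=> bu bv p /=; have [u0|/bu//] := eqVneq (u p) 0.
  by rewrite u0 add0r => /bv.
apply: boxed_complex.
  rewrite Er => p /= h; have [u0|] := eqVneq (fconv (re f) (re g) p) 0.
    have : fconv (im f) (im g) p != 0 by move: h; rewrite u0 sub0r oppr_eq0.
    by apply: boxed_conv.
  by apply: boxed_conv.
by rewrite Ei; apply: sub; exact: boxed_conv.
Qed.

End ComplexTestFunctions.

(** * Linear rates in the parameter and the product *)

Section SmallDeformation.
Context {R : realType}.
Implicit Types (f g : R * R -> R[i]) (u v : R * R -> R) (M e s : R).
Local Notation mu1 := (@lebesgue_measure R).
Local Notation normc := (@ComplexField.Normc.normc R).

Lemma opnorm_cvg0 (H : R -> R * R -> R[i]) (C d : R) : 0 < d -> 0 <= C ->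
  (forall s, s != 0 -> `|s| < d -> (opnorm s (H s) <= (C * `|s|)%:E)%E) ->
  opnorm s (H s) @[s --> (0 : R)^'] --> 0%E.
Proof.
move=> d0 C0 HC.
have near_d : \forall s \near (0 : R)^', s != 0 /\ `|s| < d.
  near=> s; split; first by near: s; exact: nbhs_dnbhs_neq.
  near: s; apply: nbhs_dnbhs; apply/nbhs_ballP; exists d => // s.
  by rewrite /ball /= sub0r normrN.
apply: (@squeeze_cvge _ _ _ _ (fun=> 0%E) _ (fun s => (C * `|s|)%:E)).
- by apply: filterS near_d => s [s0 sd]; rewrite opnorm_ge0 HC.
- exact: cvg_cst.
- apply: cvg_EFin; first exact: nearW.
  rewrite -[X in _ --> X](mulr0 C); apply: cvgM; first exact: cvg_cst.
  rewrite -[X in _ --> X](normr0 R); apply: cvg_norm.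
  by move=> A A0; exact: nbhs_dnbhs.
Unshelve. all: end_near. Qed.

Lemma opnorm_le_half s (h : R * R -> R[i]) M A : 0 < M -> 0 <= A -> `|s| * M <= 2^-1 ->
  (forall p, normc (h p) <= A) -> (forall p, M < `|p.1| -> h p = 0) ->
  (opnorm s h <= (6 * M * A)%:E)%E.
Proof.
move=> M0 A0 sM hA hM.
have -> : 6 * M * A = 3 * M * A / 2^-1 by rewrite invrK; ring.
apply: opnorm_le => // c cM; by have /andP[] := onepsc sM cM.
Qed.

Lemma Q_id s f : domQ s f -> Q s f = f.
Proof. by move=> h; rewrite /Q asboolT. Qed.

Lemma domQ0 f : testfun 0 f -> domQ 0 f.
Proof. by move=> h; split=> // d; rewrite normr0 normr_le0 => /eqP ->. Qed.

Lemma bconv_cvg M e u v : 0 < M -> boxed M e u -> boxed M e v -> Ck 2 u -> Ck 2 v ->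
  exists C : R, 0 <= C /\ forall s, `|s| <= 1 -> `|s| * M <= 2^-1 -> forall p,
    `|bconv s u v p - fconv u v p| <= C * `|s|.
Proof.
move=> M0 bu bv su sv; have [C [C0 H]] := bconv_approx M0 bu bv su sv.
exists (C + C); split; first by rewrite addr_ge0.
move=> s s1 sM p; have [h1 h2 h3] := H s s1 sM p.
have -> : bconv s u v p - fconv u v p = (bconv s u v p - fconv u v p - s * bdconv u v p) + s * bdconv u v p by ring.
rewrite (le_trans (ler_normD _ _)) // mulrDl lerD //.
  rewrite (le_trans h1) // ler_wpM2l // -(real_normK (num_real s)) expr2 ler_piMl //.
by rewrite normrM mulrC ler_wpM2r.
Qed.

(** The zeroth-order terms cancel by commutativity, the first-order ones are the bracket by
    [bdconv_antisym], and dividing the quadratic remainder by [s] leaves a linear one. *)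
Lemma bconv_comm_cvg M e u v : 0 < M -> boxed M e u -> boxed M e v -> Ck 2 u -> Ck 2 v ->
  exists C : R, 0 <= C /\ forall s, s != 0 -> `|s| <= 1 -> `|s| * M <= 2^-1 -> forall p,
    `|s^-1 * (bconv s u v p - bconv s v u p) - (p.2 - 1) *
      (fconv ('D_da u) (mulfst v) p - fconv ('D_da v) (mulfst u) p)| <= C * `|s|.
Proof.
move=> M0 bu bv su sv; have [C [C0 H]] := bconv_approx M0 bu bv su sv.
have [C' [C'0 H']] := bconv_approx M0 bv bu sv su.
exists (C + C'); split; first by rewrite addr_ge0.
move=> s s0 s1 sM p; have [h1 _ _] := H s s1 sM p; have [h1' _ _] := H' s s1 sM p.
rewrite -(bdconv_antisym M0 bu bv (CkS su) (CkS sv)).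
have Ec := fconv_comm p (Ck_continuous su) (Ck_continuous sv).
have -> : s^-1 * (bconv s u v p - bconv s v u p) - (bdconv u v p - bdconv v u p) =
   s^-1 * ((bconv s u v p - fconv u v p - s * bdconv u v p) -
     (bconv s v u p - fconv v u p - s * bdconv v u p)).
  move: (bdconv _ _ _) (bdconv _ _ _) (bconv _ _ _ _) (bconv _ _ _ _) Ec => x y z t.
  move: (fconv _ _ _) (fconv _ _ _) => q _ ->.
  rewrite -[in LHS](mulKf s0 (y - x)); ring.
rewrite normrM normfV mulrC ler_pdivrMr ?normr_gt0 //.
rewrite (le_trans (ler_normB _ _)) // (le_trans (lerD h1 h1')) //.
by rewrite -mulrDl -mulrA -expr2 real_normK ?num_real.
Qed.

Section TwoFunctions.
Variables (f g : R * R -> R[i]).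
Hypotheses (hf : testfun 0 f) (hg : testfun 0 g).

Lemma common_box : exists M e : R, [/\ 0 < M, 0 < e, boxed M e f & boxed M e g].
Proof.
have [M [e [M0 e0 bf]]] := testfun_boxed hf; have [M' [e' [M'0 e'0 bg]]] := testfun_boxed hg.
exists (M + M'), (Num.min e e'); split; first by rewrite addr_gt0.
- by rewrite lt_min e0.
- apply: boxed_le bf; first by rewrite lerDl ltW.
  by rewrite ge_min lexx.
- apply: boxed_le bg; first by rewrite lerDr ltW.
  by rewrite ge_min lexx orbT.
Qed.

(** One radius for all three limits. The defects live in |b| <= 3 M, so it provides
    [|s| * (3 * M) <= 2^-1] for the norm bound and the strict bounds by 1 and [e] for the domain of
    [Q s]. *)
Definition deform_radius M e : R := Num.min 1 (Num.min (12 * M)^-1 (e / (12 * M))).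

Lemma deform_radius_gt0 M e : 0 < M -> 0 < e -> 0 < deform_radius M e.
Proof. by move=> M0 e0; rewrite !lt_min ltr01 invr_gt0 divr_gt0 // mulr_gt0. Qed.

Lemma deform_radiusP M e s : 0 < M -> 0 < e -> `|s| < deform_radius M e ->
  [/\ `|s| <= 1, `|s| * (3 * M) <= 2^-1, `|s| * M <= 2^-1, `|s| * (3 * M) < 1 & `|s| * (3 * M) < e].
Proof.
move=> M0 e0; rewrite !lt_min => /andP[s1 /andP[s2 s3]].
have M12 : 0 < 12 * M by rewrite mulr_gt0.
have {}s2 : `|s| * (12 * M) < 1 by rewrite -ltr_pdivlMr // div1r.
have {}s3 : `|s| * (12 * M) < e by rewrite -ltr_pdivlMr.
have P : 0 <= `|s| * M by rewrite mulr_ge0 // ltW.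
by split; lra.
Qed.

Lemma product_defect_cvg0 : opnorm s (convol s (Q s f) (Q s g) \- Q s (convol 0 f g)) @[s --> (0 : R)^'] --> 0%E.
Proof.
have sf := testfun_smooth hf; have sg := testfun_smooth hg.
have [M [e [M0 e0 bf bg]]] := common_box.
have [C1 [C10 H1]] := bconv_cvg M0 (boxed_re bf) (boxed_re bg) (smooth_re 2 sf) (smooth_re 2 sg).
have [C2 [C20 H2]] := bconv_cvg M0 (boxed_im bf) (boxed_im bg) (smooth_im 2 sf) (smooth_im 2 sg).
have [C3 [C30 H3]] := bconv_cvg M0 (boxed_re bf) (boxed_im bg) (smooth_re 2 sf) (smooth_im 2 sg).
have [C4 [C40 H4]] := bconv_cvg M0 (boxed_im bf) (boxed_re bg) (smooth_im 2 sf) (smooth_re 2 sg).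
have [sc bc] := smooth_convol0 M0 bf bg sf sg.
pose C := C1 + C2 + (C3 + C4).
have C0 : 0 <= C by rewrite !addr_ge0.
apply: (@opnorm_cvg0 _ (6 * (3 * M) * C) (deform_radius M e)); first exact: deform_radius_gt0.
  by rewrite !mulr_ge0 // ltW.
move=> s s0 /(deform_radiusP M0 e0)[s1 s3M sM s3M1 s3Me].
have MM : `|s| * M <= `|s| * (3 * M) by rewrite ler_wpM2l //; lra.
have M2M : `|s| * (M + M) <= `|s| * (3 * M) by rewrite ler_wpM2l //; lra.
rewrite (Q_id (boxed_domQ e0 (ltW M0) _ _ sf bf)); [|lra|lra].
rewrite (Q_id (boxed_domQ e0 (ltW M0) _ _ sg bg)); [|lra|lra].
rewrite (Q_id (boxed_domQ e0 _ _ _ sc bc)); [|lra|lra|lra].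
rewrite -mulrA; apply: opnorm_le_half => //.
- by rewrite mulr_gt0.
- by rewrite mulr_ge0.
- move=> p; apply: (le_trans (normc_le_ReIm _)).
  have [Er Ei] := convolE M0 bf bg sf sg sM p; have [Er0 Ei0] := convol0E M0 bf bg sf sg p.
  rewrite cReB cImB Er Ei Er0 Ei0.
  have h1 := H1 s s1 sM p; have h2 := H2 s s1 sM p; have h3 := H3 s s1 sM p; have h4 := H4 s s1 sM p.
  rewrite /C mulrDl; apply: lerD.
  + have -> : bconv s (re f) (re g) p - bconv s (im f) (im g) p - (fconv (re f) (re g) p - fconv (im f) (im g) p)
      = (bconv s (re f) (re g) p - fconv (re f) (re g) p) - (bconv s (im f) (im g) p - fconv (im f) (im g) p) by ring.
    by rewrite (le_trans (ler_normB _ _)) // mulrDl lerD.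
  + have -> : bconv s (re f) (im g) p + bconv s (im f) (re g) p - (fconv (re f) (im g) p + fconv (im f) (re g) p)
      = (bconv s (re f) (im g) p - fconv (re f) (im g) p) + (bconv s (im f) (re g) p - fconv (im f) (re g) p) by ring.
    by rewrite (le_trans (ler_normD _ _)) // mulrDl lerD.
- move=> p far /=; rewrite (boxedW bc); last by left; lra.
  rewrite subr0; have [Er Ei] := convolE M0 bf bg sf sg sM p.
  have z := fun u v bu bv => @bconv_far _ M e u v s p M0 bu bv sM far.
  by apply: complex_ext; rewrite ?Er ?Ei !z ?subr0 ?addr0 //;
    first [exact: boxed_re|exact: boxed_im].
Qed.

End TwoFunctions.
End SmallDeformation.

(** * The bracket and the involution *)

Section StarBracket.
Context {R : realType}.
Implicit Types (f g : R * R -> R[i]) (u v : R * R -> R) (M e s : R).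
Local Notation normc := (@ComplexField.Normc.normc R).

Lemma re_mulb f : re (mulb f) = mulfst (re f).
Proof. by apply/funext => p; rewrite /re /mulb cReM /= mul0r subr0. Qed.

Lemma im_mulb f : im (mulb f) = mulfst (im f).
Proof. by apply/funext => p; rewrite /im /mulb cImM /= mul0r addr0. Qed.

Lemma smooth_mulb f : smooth f -> smooth (mulb f).
Proof.
move=> sf; apply: smooth_complex => k.
  by rewrite re_mulb; apply: CkM; [exact: Ck_fst|exact: smooth_re].
by rewrite im_mulb; apply: CkM; [exact: Ck_fst|exact: smooth_im].
Qed.

Lemma boxed_mulb M e f : boxed M e f -> boxed M e (mulb f).
Proof. by move=> bf p h; apply: bf; apply: contraNneq h => E; rewrite /mulb E mulr0. Qed.

Lemma smooth_partial_a f : smooth f -> smooth (partial_a f).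
Proof.
move=> sf; apply: smooth_complex => k.
  by have /CkSE[_ [_ _]] := smooth_re k.+1 sf.
by have /CkSE[_ [_ _]] := smooth_im k.+1 sf.
Qed.

Lemma boxed_partial_a M e f : boxed M e f -> boxed M e (partial_a f).
Proof.
move=> bf; apply: boxed_complex.
  by apply: (@boxed_derive _ M e (re f)); exact: boxed_re.
by apply: (@boxed_derive _ M e (im f)); exact: boxed_im.
Qed.

Lemma bracketE M e f g : 0 < M -> boxed M e f -> boxed M e g -> smooth f -> smooth g -> forall p,
  let comm u v := (p.2 - 1) * (fconv ('D_da u) (mulfst v) p - fconv ('D_da v) (mulfst u) p) in
  complex.Re (bracket f g p) = comm (re f) (re g) - comm (im f) (im g) /\
  complex.Im (bracket f g p) = comm (re f) (im g) + comm (im f) (re g).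
Proof.
move=> M0 bf bg sf sg p comm.
have [r1 i1] := convol0E M0 (boxed_partial_a bf) (boxed_mulb bg) (smooth_partial_a sf) (smooth_mulb sg) p.
have [r2 i2] := convol0E M0 (boxed_partial_a bg) (boxed_mulb bf) (smooth_partial_a sg) (smooth_mulb sf) p.
rewrite /bracket cReM cImM cReB cImB r1 i1 r2 i2 !re_mulb !im_mulb /comm /= !mul0r subr0 addr0.
have E1 h : re (partial_a h) = 'D_da (re h) by [].
have E2 h : im (partial_a h) = 'D_da (im h) by [].
rewrite !E1 !E2; split; ring.
Qed.

Lemma smooth_bracket M e f g : 0 < M -> boxed M e f -> boxed M e g -> smooth f -> smooth g ->
  smooth (bracket f g) /\ boxed (M + M) e (bracket f g).
Proof.
move=> M0 bf bg sf sg.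
have [s1 b1] := smooth_convol0 M0 (boxed_partial_a bf) (boxed_mulb bg) (smooth_partial_a sf) (smooth_mulb sg).
have [s2 b2] := smooth_convol0 M0 (boxed_partial_a bg) (boxed_mulb bf) (smooth_partial_a sg) (smooth_mulb sf).
set A := convol 0 _ _ in s1 b1; set B := convol 0 _ _ in s2 b2.
have BE : bracket f g = fun p => (p.2 - 1)%:C * (A p - B p) by [].
have cs k : Ck k ((snd : R * R -> R) \- (fun=> 1)) by apply: CkB; [exact: Ck_snd|exact: Ck_cst].
split.
  apply: smooth_complex => k.
    have -> : re (bracket f g) = ((snd : R * R -> R) \- (fun=> 1)) \* (re A \- re B).
      by apply/funext => p; rewrite /re BE cReM cReB /= mul0r subr0.
    by apply: CkM => //; apply: CkB; exact: smooth_re.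
  have -> : im (bracket f g) = ((snd : R * R -> R) \- (fun=> 1)) \* (im A \- im B).
    by apply/funext => p; rewrite /im BE cImM cImB /= mul0r addr0.
  by apply: CkM => //; apply: CkB; exact: smooth_im.
rewrite BE => p h; have [A0|/b1//] := eqVneq (A p) 0.
by apply: b2; apply: contraNneq h => B0; rewrite A0 B0 subrr mulr0.
Qed.

Section TwoFunctions.
Variables (f g : R * R -> R[i]).
Hypotheses (hf : testfun 0 f) (hg : testfun 0 g).

Lemma commutator_defect_cvg0 : opnorm s ((fun p => (s^-1)%:C * convol_comm s (Q s f) (Q s g) p) \- Q s (bracket f g))
  @[s --> (0 : R)^'] --> 0%E.
Proof.
have sf := testfun_smooth hf; have sg := testfun_smooth hg.
have [M [e [M0 e0 bf bg]]] := common_box hf hg.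
have [C1 [C10 H1]] := bconv_comm_cvg M0 (boxed_re bf) (boxed_re bg) (smooth_re 2 sf) (smooth_re 2 sg).
have [C2 [C20 H2]] := bconv_comm_cvg M0 (boxed_im bf) (boxed_im bg) (smooth_im 2 sf) (smooth_im 2 sg).
have [C3 [C30 H3]] := bconv_comm_cvg M0 (boxed_re bf) (boxed_im bg) (smooth_re 2 sf) (smooth_im 2 sg).
have [C4 [C40 H4]] := bconv_comm_cvg M0 (boxed_im bf) (boxed_re bg) (smooth_im 2 sf) (smooth_re 2 sg).
have [sc bc] := smooth_bracket M0 bf bg sf sg.
pose C := C1 + C2 + (C3 + C4).
have C0 : 0 <= C by rewrite !addr_ge0.
apply: (@opnorm_cvg0 _ _ (6 * (3 * M) * C) (deform_radius M e)); first exact: deform_radius_gt0.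
  by rewrite !mulr_ge0 // ltW.
move=> s s0 /(deform_radiusP M0 e0)[s1 s3M sM s3M1 s3Me].
have MM : `|s| * M <= `|s| * (3 * M) by rewrite ler_wpM2l //; lra.
have M2M : `|s| * (M + M) <= `|s| * (3 * M) by rewrite ler_wpM2l //; lra.
rewrite (Q_id (boxed_domQ e0 (ltW M0) _ _ sf bf)); [|lra|lra].
rewrite (Q_id (boxed_domQ e0 (ltW M0) _ _ sg bg)); [|lra|lra].
rewrite (Q_id (boxed_domQ e0 _ _ _ sc bc)); [|lra|lra|lra].
rewrite -mulrA; apply: opnorm_le_half => //.
- by rewrite mulr_gt0.
- by rewrite mulr_ge0.
- move=> p; apply: (le_trans (normc_le_ReIm _)).
  have [Er Ei] := convolE M0 bf bg sf sg sM p; have [Er' Ei'] := convolE M0 bg bf sg sf sM p.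
  have [Er0 Ei0] := bracketE M0 bf bg sf sg p.
  have h1 := H1 s s0 s1 sM p; have h2 := H2 s s0 s1 sM p; have h3 := H3 s s0 s1 sM p; have h4 := H4 s s0 s1 sM p.
  rewrite cReB cImB Er0 Ei0 cReM cImM cReB cImB Er Ei Er' Ei' /= !mul0r subr0 addr0.
  have split2 (a b c d x y : R) : `|a - x| <= b -> `|c - y| <= d ->
      `|(a - c) - (x - y)| <= b + d /\ `|(a + c) - (x + y)| <= b + d.
    move=> h h'; split.
      by rewrite (_ : _ - _ = (a - x) - (c - y)); [rewrite (le_trans (ler_normB _ _)) // lerD|ring].
    by rewrite (_ : _ - _ = (a - x) + (c - y)); [rewrite (le_trans (ler_normD _ _)) // lerD|ring].
  have swap4 (a b c d : R) : a - b - (c - d) = (a - c) - (b - d) by ring.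
  have swap4' (a b c d : R) : a + b - (c + d) = (a - c) + (b - d) by ring.
  have [k1 _] := split2 _ _ _ _ _ _ h1 h2; have [_ k2] := split2 _ _ _ _ _ _ h3 h4.
  rewrite (_ : C * `|s| = (C1 * `|s| + C2 * `|s|) + (C3 * `|s| + C4 * `|s|)); last by rewrite /C; ring.
  apply: lerD.
  + by apply: le_trans k1; rewrite -(mulrBr s^-1) swap4.
  + by apply: le_trans k2; rewrite -(mulrDr s^-1) (addrC (bconv s (re g) (im f) p)) swap4'.
- move=> p far /=; rewrite (boxedW bc); last by left; lra.
  rewrite subr0; have [Er Ei] := convolE M0 bf bg sf sg sM p; have [Er' Ei'] := convolE M0 bg bf sg sf sM p.
  have z := fun u v bu bv => @bconv_far _ M e u v s p M0 bu bv sM far.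
  have br := boxed_re bf; have bi := boxed_im bf; have br' := boxed_re bg; have bi' := boxed_im bg.
  by apply: complex_ext; rewrite ?cReM ?cImM ?cReB ?cImB ?Er ?Ei ?Er' ?Ei' !z //= ?addr0 ?subr0 ?mulr0 ?mul0r ?subr0 ?addr0.
Qed.

(** The inversion of the groupoid is an involution: for beta = -b/(1 + s b) one has b (1 + s beta) =
    -beta. As |beta| <= M makes 1 + s beta >= 1/2, it follows that |b| <= 2 M; then [a] is recovered
    from its image. *)
Lemma star_far M e u s b a : 0 < M -> 0 < e -> boxed M e u -> `|s| * M <= 2^-1 ->
  u (- b / (1 + s * b), (a - s * b) / (1 + s * b)) != 0 ->
  `|b| <= 2 * M /\ `|a| <= `|1 + s * b| * M + `|s * b|.
Proof.
move=> M0 e0 bu sM h; have /= [h1 h2 h3] := bu _ h.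
(* If 1 + s b = 0, both quotients are 0 by convention, and [u] vanishes at the origin because
   [e > 0]. *)
have k0 : 1 + s * b != 0.
  apply: contraTneq h3 => ->; by rewrite invr0 mulr0 normr0 -ltNge.
set beta := - b / (1 + s * b) in h1.
have Eb : b * (1 + s * beta) = - beta by rewrite /beta; field.
have /andP[q1 q2] := onepsc sM h1.
split.
  have : `|b| * 2^-1 <= M; last lra.
  apply: le_trans h1; rewrite -(normrN beta) -Eb normrM ler_wpM2l // gtr0_norm //; lra.
have -> : a = (1 + s * b) * ((a - s * b) / (1 + s * b)) + s * b by field.
by rewrite (le_trans (ler_normD _ _)) // lerD // normrM ler_wpM2l.
Qed.

(** Wherever one of the two values is nonzero, |b| <= 2 M and |a| <= 2 M + 1; there the Lipschitz
    bound applies to a displacement of order [s]. *)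
Lemma star_cvg M e u : 0 < M -> 0 < e -> boxed M e u -> Ck 1 u ->
  exists C : R, 0 <= C /\ forall s, `|s| <= 1 -> `|s| * (3 * M) <= 2^-1 -> forall b a,
   (`|u (- b, a) - u (- b / (1 + s * b), (a - s * b) / (1 + s * b))| <= C * `|s|) /\
   (2 * M < `|b| -> u (- b / (1 + s * b), (a - s * b) / (1 + s * b)) = 0).
Proof.
move=> M0 e0 bu cu; have [L [L0 HL]] := boxed_lipschitz bu cu.
(* The displacements are s b^2/(1 + s b) in modulus for [b] and s b (a + 1)/(1 + s b) for [a], with
   (1 + s b)^-1 <= 2. *)
exists (L * (8 * M ^+ 2 + 4 * M * (2 * M + 2))); split.
  by rewrite mulr_ge0 // addr_ge0 ?mulr_ge0 ?sqr_ge0 //; lra.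
move=> s s1 s3 b a; have sM : `|s| * M <= 2^-1 by lra.
have sb2 : `|b| <= 2 * M -> `|s * b| <= 3^-1.
  move=> hb; rewrite normrM; have : `|s| * `|b| <= `|s| * (2 * M) by rewrite ler_wpM2l.
  lra.
split; last first.
  by move=> hb; apply/eqP/negPn/negP => /(star_far M0 e0 bu sM)[]; lra.
have main : `|b| <= 2 * M -> `|a| <= 2 * M + 1 ->
    `|u (- b, a) - u (- b / (1 + s * b), (a - s * b) / (1 + s * b))| <= L * (8 * M ^+ 2 + 4 * M * (2 * M + 2)) * `|s|.
  move=> hb ha; have := sb2 hb; rewrite ler_norml => /andP[q1 q2].
  have k0 : 0 < 1 + s * b by lra.
  have k2 : (1 + s * b)^-1 <= 2 by rewrite -[leRHS]invrK lef_pV2 ?posrE //; lra.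
  have ki : 0 <= (1 + s * b)^-1 by rewrite invr_ge0 ltW.
  apply: (le_trans (HL _ _)) => /=; rewrite -mulrA ler_wpM2l // (mulrDl (8 * _)).
  have k1 : 1 + s * b != 0 by rewrite gt_eqF.
  apply: lerD.
    have -> : - b - - b / (1 + s * b) = s * (- (b ^+ 2) * (1 + s * b)^-1) by field.
    rewrite normrM mulrC ler_wpM2r // normrM normrN (ger0_norm ki).
    have -> : 8 * M ^+ 2 = (2 * M) ^+ 2 * 2 by ring.
    by apply: ler_pM => //; rewrite normrX ler_sqr ?nnegrE //; lra.
  have -> : a - (a - s * b) / (1 + s * b) = s * (b * (a + 1) * (1 + s * b)^-1) by field.
  rewrite normrM mulrC ler_wpM2r // 2!normrM (ger0_norm ki).
  have -> : 4 * M * (2 * M + 2) = 2 * M * (2 * M + 2) * 2 by ring.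
  apply: ler_pM => //.
  apply: ler_pM => //; rewrite (le_trans (ler_normD _ _)) // normr1; lra.
have [u1|u1] := eqVneq (u (- b, a)) 0; last first.
  have := bu _ u1; rewrite /= normrN => -[h1 h2 _]; apply: main; lra.
have [u2|/(star_far M0 e0 bu sM)[h1 h2]] := eqVneq (u (- b / (1 + s * b), (a - s * b) / (1 + s * b))) 0.
  rewrite u1 u2 subrr normr0 !mulr_ge0 // addr_ge0 ?mulr_ge0 ?sqr_ge0 //; lra.
apply: main => //; apply: (le_trans h2); have q := sb2 h1.
have q' : `|1 + s * b| <= 1 + 3^-1 by rewrite (le_trans (ler_normD _ _)) // normr1 lerD2l.
have : `|1 + s * b| * M <= (1 + 3^-1) * M by rewrite ler_wpM2r // ltW.
lra.
Qed.

Lemma starE s p : star s f p =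
  re f (- p.1 / (1 + s * p.1), (p.2 - s * p.1) / (1 + s * p.1)) -i*
  im f (- p.1 / (1 + s * p.1), (p.2 - s * p.1) / (1 + s * p.1)).
Proof. by case: p => b a; rewrite /star /re /im /=; case: (f _). Qed.

Lemma star0E p : star 0 f p = re f (- p.1, p.2) -i* im f (- p.1, p.2).
Proof. by rewrite starE mul0r addr0 subr0 !divr1. Qed.

Lemma star_defect_cvg0 : opnorm s (Q s (star 0 f) \- star s (Q s f)) @[s --> (0 : R)^'] --> 0%E.
Proof.
have sf := testfun_smooth hf.
have [M [e [M0 e0 bf]]] := testfun_boxed hf.
have [C1 [C10 H1]] := star_cvg M0 e0 (boxed_re bf) (smooth_re 1 sf).
have [C2 [C20 H2]] := star_cvg M0 e0 (boxed_im bf) (smooth_im 1 sf).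
have sc : smooth (star 0 f).
  apply: smooth_complex => k.
    have -> : re (star 0 f) = fun p => re f (- p.1, p.2) by apply/funext => p; rewrite /re star0E.
    by apply: Ck_reflect; exact: smooth_re.
  have -> : im (star 0 f) = fun p => - im f (- p.1, p.2) by apply/funext => p; rewrite /im star0E.
  apply: (@CkN _ k (fun p => im f (- p.1, p.2))); apply: Ck_reflect; exact: smooth_im.
have bc : boxed M e (star 0 f).
  apply: boxed_complex => p.
    by rewrite /re star0E /= => h; have := boxed_re bf h; rewrite /= normrN.
  by rewrite /im star0E /= oppr_eq0 => h; have := boxed_im bf h; rewrite /= normrN.
have C0 : 0 <= C1 + C2 by rewrite addr_ge0.
apply: (@opnorm_cvg0 _ _ (6 * (3 * M) * (C1 + C2)) (deform_radius M e)); first exact: deform_radius_gt0.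
  by rewrite !mulr_ge0 // ltW.
move=> s s0 /(deform_radiusP M0 e0)[s1 s3M sM s3M1 s3Me].
have MM : `|s| * M <= `|s| * (3 * M) by rewrite ler_wpM2l //; lra.
rewrite (Q_id (boxed_domQ e0 (ltW M0) _ _ sf bf)); [|lra|lra].
rewrite (Q_id (boxed_domQ e0 (ltW M0) _ _ sc bc)); [|lra|lra].
rewrite -mulrA; apply: opnorm_le_half => //.
- by rewrite mulr_gt0.
- by rewrite mulr_ge0.
- move=> p; apply: (le_trans (normc_le_ReIm _)); rewrite cReB cImB star0E starE (mulrDl C1) /=.
  have [h1 _] := H1 s s1 s3M p.1 p.2; have [h2 _] := H2 s s1 s3M p.1 p.2.
  by apply: lerD => //; rewrite -opprD normrN.
- move=> p far /=; rewrite (boxedW bc); last by left; lra.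
  have [_ k1] := H1 s s1 s3M p.1 p.2; have [_ k2] := H2 s s1 s3M p.1 p.2.
  have far2 : 2 * M < `|p.1| by lra.
  rewrite starE (k1 far2) (k2 far2).
  by rewrite sub0r; apply: complex_ext; rewrite /= ?oppr0.
Qed.

End TwoFunctions.
End StarBracket.

(** * Subadditivity of the operator norm *)

Section FiberIntegrals.
Context {R : realType}.
Implicit Types (M e s K : R).
Local Notation mu1 := (@lebesgue_measure R).
Local Notation mu2 := (mu1 \x mu1)%E.
Local Notation T1 := (measurableTypeR R).
Local Notation T2 := (measurableTypeR R * measurableTypeR R)%type.
Local Notation mu3 := (mu1 \x lebesgue2)%E.
Local Notation normc := (@ComplexField.Normc.normc R).

Definition cmeas d (T : measurableType d) (F : T -> R[i]) :=
  measurable_fun setT (fun z => complex.Re (F z)) /\ measurable_fun setT (fun z => complex.Im (F z)).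

Lemma cmeasB d (T : measurableType d) (F G : T -> R[i]) : cmeas F -> cmeas G -> cmeas (F \- G).
Proof.
move=> [h1 h2] [h3 h4]; split.
  by apply: (eq_measurable_fun _ _ (measurable_funB h1 h3)) => z _ /=; rewrite cReB.
by apply: (eq_measurable_fun _ _ (measurable_funB h2 h4)) => z _ /=; rewrite cImB.
Qed.

Lemma cmeasM d (T : measurableType d) (F G : T -> R[i]) : cmeas F -> cmeas G -> cmeas (F \* G).
Proof.
move=> [h1 h2] [h3 h4]; split.
  apply: (eq_measurable_fun _ _ (measurable_funB (measurable_funM h1 h3) (measurable_funM h2 h4))) => z _ /=.
  by rewrite cReM.
apply: (eq_measurable_fun _ _ (measurable_funD (measurable_funM h1 h4) (measurable_funM h2 h3))) => z _ /=.
by rewrite cImM.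
Qed.

Lemma cmeas_real d (T : measurableType d) (u : T -> R) : measurable_fun setT u ->
  cmeas (fun z => (u z)%:C).
Proof. by move=> mu; split => //=; exact: measurable_cst. Qed.

Lemma cmeas_comp d d' (T : measurableType d) (T' : measurableType d') (phi : T -> T') (F : T' -> R[i]) :
  measurable_fun setT phi -> cmeas F -> cmeas (F \o phi).
Proof. by move=> mphi [h1 h2]; split; [exact: (measurableT_comp h1 mphi)|exact: (measurableT_comp h2 mphi)]. Qed.

Lemma cmeas_normc d (T : measurableType d) (F : T -> R[i]) : cmeas F ->
  measurable_fun setT (fun z => normc (F z)).
Proof. by move=> [h1 h2]; exact: measurable_normc. Qed.

Lemma measurable_wt3 : measurable_fun setT (fun z : T1 * T2 => wt z.2.2).
Proof. by apply: (measurableT_comp measurable_wt); apply: measurableT_comp => //. Qed.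

(** The weighted square norm with the fibre variable [c] kept as a coordinate. *)
Definition sqn3 (u : T1 * T2 -> R) := (\int[mu3]_z (u z ^+ 2 * wt z.2.2)%:E)%E.

Lemma measurable_sqn3 (u : T1 * T2 -> R) : measurable_fun setT u ->
  measurable_fun setT (fun z => (u z ^+ 2 * wt z.2.2)%:E).
Proof.
move=> mu; apply/measurable_EFinP; apply: measurable_funM; last exact: measurable_wt3.
exact: measurable_funX.
Qed.

Lemma sqn3_ge0 u : (0 <= sqn3 u)%E.
Proof. by apply: integral_ge0 => z _; rewrite lee_fin mulr_ge0 ?sqr_ge0 ?wt_ge0. Qed.

Lemma sqn3_le (u v : T1 * T2 -> R) K : measurable_fun setT v -> 0 <= K ->
  (forall z, `|u z| <= K * `|v z|) -> (sqn3 u <= (K ^+ 2)%:E * sqn3 v)%E.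
Proof.
move=> mv K0 uv; rewrite /sqn3 -ge0_integralZl_EFin ?sqr_ge0 //.
- apply: ge0_le_integral_nonmeasurable => z; first by rewrite lee_fin mulr_ge0 ?sqr_ge0 ?wt_ge0.
  rewrite -EFinM lee_fin mulrA ler_wpM2r ?wt_ge0 // -exprMn -(real_normK (num_real (u z))).
  rewrite -(real_normK (num_real (K * v z))) ler_sqr ?nnegrE // normrM (ger0_norm K0); exact: uv.
- by move=> z _; rewrite lee_fin mulr_ge0 ?sqr_ge0 ?wt_ge0.
- exact: measurable_sqn3.
Qed.

Lemma sqn3_le_add (u v w : T1 * T2 -> R) : measurable_fun setT v -> measurable_fun setT w ->
  (forall z, `|u z| <= `|v z| + `|w z|) -> (sqn3 u <= 2%:E * (sqn3 v + sqn3 w))%E.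
Proof.
move=> mv mw uvw; have m1 := measurable_sqn3 mv; have m2 := measurable_sqn3 mw.
have p0 (x : T1 * T2 -> R) z : (0 <= (x z ^+ 2 * wt z.2.2)%:E)%E by rewrite lee_fin mulr_ge0 ?sqr_ge0 ?wt_ge0.
rewrite /sqn3 -ge0_integralD //.
rewrite -ge0_integralZl_EFin //; last 2 first.
- by move=> z _; rewrite adde_ge0.
- exact: emeasurable_funD.
apply: ge0_le_integral_nonmeasurable => z //.
rewrite -EFinD -EFinM lee_fin -mulrDl mulrA ler_wpM2r ?wt_ge0 //.
rewrite -(real_normK (num_real (u z))) -(real_normK (num_real (v z))) -(real_normK (num_real (w z))).
apply: (@le_trans _ _ ((`|v z| + `|w z|) ^+ 2)).
  by rewrite ler_sqr ?nnegrE ?addr_ge0 //; exact: uvw.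
have := sqr_ge0 (`|v z| - `|w z|); rewrite sqrrB sqrrD; lra.
Qed.

Lemma in_symitv M (c : R) : (c \in symitv M) = (`|c| <= M).
Proof. by apply/idP/idP; rewrite inE /symitv /= in_itv /= -ler_norml. Qed.

(** Every [c] in [-M, M] contributes the same amount, so the total is independent of [s]. *)
Lemma integral_tau3 s M (phi : T2 -> R) : 0 < M -> (forall c, `|c| <= M -> 0 < 1 + s * c) ->
  measurable_fun setT phi -> (forall p, 0 <= phi p) ->
  (\int[mu3]_z (\1_(symitv M) z.1 * phi (tau s z.1 z.2) * wt z.2.2)%:E =
   (2 * M)%:E * \int[mu2]_p (phi p * wt p.2)%:E)%E.
Proof.
move=> M0 sM mphi phi0.
have m : measurable_fun setT (fun z : T1 * T2 => (\1_(symitv M) z.1 * phi (tau s z.1 z.2) * wt z.2.2)%:E).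
  apply/measurable_EFinP; apply: measurable_funM; last exact: measurable_wt3.
  apply: measurable_funM; last exact: (measurableT_comp mphi (measurable_tau s)).
  by apply: (measurableT_comp (measurable_indic (measurable_symitv M))).
rewrite fubini_tonelli1 //; last first.
  by move=> z; rewrite lee_fin !mulr_ge0 ?wt_ge0 // indicE ler0n.
rewrite /fubini_F /=.
have E c : (\int[mu2]_p (\1_(symitv M) c * phi (tau s c p) * wt p.2)%:E)%E =
    (((fun=> \int[mu2]_p (phi p * wt p.2)%:E) \_ (symitv M)) c)%E.
  rewrite /patch indicE; case: ifPn => cM; last first.
    by rewrite integral0_eq // => p _; rewrite !mul0r.
  under eq_integral do rewrite mul1r.
  by apply: integral_tau => //; apply: sM; rewrite -in_symitv.
transitivity (\int[mu1]_c ((fun=> \int[mu2]_p (phi p * wt p.2)%:E) \_ (symitv M)) c)%E.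
  by apply: eq_integral => c _; rewrite -E.
rewrite -integral_mkcond integral_cst /=; last exact: measurable_symitv.
by rewrite lebesgue_symitv // muleC.
Qed.

(** The class of kernels in which fibre integrals converge for almost every point and can be
    subtracted. *)
Definition L2dom M (F : T1 * T2 -> R[i]) :=
  [/\ cmeas F, forall z, M < `|z.1| -> F z = 0 & (sqn3 (fun z => normc (F z)) < +oo)%E].

Lemma L2domB M F G : L2dom M F -> L2dom M G -> L2dom M (F \- G).
Proof.
move=> [mF sF lF] [mG sG lG]; split; first exact: cmeasB.
  by move=> z zM /=; rewrite sF // sG // subrr.
have nF := cmeas_normc mF; have nG := cmeas_normc mG.
apply: (@le_lt_trans _ _ (2%:E * (sqn3 (fun z => normc (F z)) + sqn3 (fun z => normc (G z))))%E).
  by apply: sqn3_le_add => // z; rewrite !ger0_norm ?normc_ge0 //; exact: normcB.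
by rewrite lte_mul_pinfty // lte_add_pinfty.
Qed.

Definition Cint (F : T1 * T2 -> R[i]) (p : T2) : R[i] := Cintegral (fun c => F (c, p)).

Lemma sqn_Cint_le M F : 0 < M -> L2dom M F ->
  (sqn (Cint F) <= (4 * M)%:E * sqn3 (fun z => normc (F z)))%E.
Proof.
move=> M0 [mF sF lF]; have nF := cmeas_normc mF.
have := @sqn_Cintegral_le R (fun c p => F (c, p)) (fun z => normc (F z)) M M0 nF.
move=> /(_ (fun c p => lexx _)); rewrite /sqn3 fubini_tonelli1; last 2 first.
- exact: measurable_sqn3.
- by move=> z; rewrite lee_fin mulr_ge0 ?sqr_ge0 ?wt_ge0.
apply=> c p cM; by rewrite sF // ComplexField.Normc.normc0.
Qed.

(** Tonelli gives the measurability of both parts, and [fine] of their difference stays measurable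
    even where the integral diverges. *)
Let measurable_Rint (u : T1 * T2 -> R) : measurable_fun setT u ->
  measurable_fun [set: T2] (fun p => \int[mu1]_c u (c, p)).
Proof.
move=> mu; rewrite /Rintegral.
have mE : measurable_fun setT (EFin \o u) by exact/measurable_EFinP.
apply: (@measurableT_comp _ _ _ _ _ _ fine); first exact: fine_measurable.
have -> : (fun p : T2 => \int[mu1]_c (u (c, p))%:E)%E =
    (fun p => \int[mu1]_c ((EFin \o u)^\+ (c, p)) - \int[mu1]_c ((EFin \o u)^\- (c, p)))%E.
  apply/funext => p; rewrite (integralE mu1 setT (fun c => (u (c, p))%:E)); congr (_ - _)%E.
    by apply: eq_integral => c _; rewrite !funeposE.
  by apply: eq_integral => c _; rewrite !funenegE.
apply: emeasurable_funB.
  apply: (measurable_fun_fubini_tonelli_G (m1 := mu1) ((EFin \o u)^\+)%E) => //.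
  exact: measurable_funepos.
apply: (measurable_fun_fubini_tonelli_G (m1 := mu1) ((EFin \o u)^\-)%E) => //.
exact: measurable_funeneg.
Qed.

Lemma cmeas_Cint F : cmeas F -> cmeas (Cint F).
Proof. by move=> [h1 h2]; split; [exact: (measurable_Rint h1)|exact: (measurable_Rint h2)]. Qed.

(** By Tonelli almost every slice of |F|^2 is integrable after division by the weight, which is
    positive for a != 0; then |F| is dominated by the indicator of [-M, M] plus |F|^2. *)
Lemma L2dom_ae_integrable M F : 0 < M -> L2dom M F ->
  {ae lebesgue2, forall p, p.2 != 0 ->
    mu1.-integrable setT (fun c => (complex.Re (F (c, p)))%:E) /\
    mu1.-integrable setT (fun c => (complex.Im (F (c, p)))%:E)}.
Proof.
move=> M0 [mF sF lF]; have nF := cmeas_normc mF.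
have mW := measurable_sqn3 nF.
have iW : mu3.-integrable setT (fun z => (normc (F z) ^+ 2 * wt z.2.2)%:E).
  apply/integrableP; split => //; move: lF; rewrite /sqn3; congr (_ < _)%E.
  by apply: eq_integral => z _; rewrite gee0_abs // lee_fin mulr_ge0 ?sqr_ge0 ?wt_ge0.
have := ae_integrable2 (m1 := mu1) (m2 := lebesgue2) iW.
apply: filterS => -[b a] /= H a0.
pose w := wt a; have w0 : 0 < w by rewrite /w /wt invr_gt0 exprn_even_gt0.
have i1 : mu1.-integrable setT (fun c => (normc (F (c, (b, a))) ^+ 2)%:E).
  have := integrableZl measurableT w^-1 H; apply: eq_integrable => // c _.
  by rewrite -EFinM mulrC mulfK // gt_eqF.
have i0 : mu1.-integrable setT (fun c => (\1_(symitv M) c)%:E).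
  exact: (@integrable_indic_itv R (- M) M true false).
have iD := integrableD measurableT i0 i1.
have bnd c : normc (F (c, (b, a))) <= \1_(symitv M) c + normc (F (c, (b, a))) ^+ 2.
  rewrite indicE in_symitv; have [_|cM] := leP `|c| M.
    have := sqr_ge0 (normc (F (c, (b, a))) - 1); have := normc_ge0 (F (c, (b, a))).
    rewrite sqrrB expr1n mulr1 /=; nra.
  by rewrite (sF (c, (b, a)) cM) ComplexField.Normc.normc0 expr0n addr0.
have mp : measurable_fun setT (fun c : T1 => (c, (b, a)) : T1 * T2) by exact: measurable_fun_pair.
have mr : measurable_fun setT (fun c : T1 => complex.Re (F (c, (b, a)))).
  exact: (measurableT_comp mF.1 mp).
have mi : measurable_fun setT (fun c : T1 => complex.Im (F (c, (b, a)))).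
  exact: (measurableT_comp mF.2 mp).
split.
  apply: (le_integrable measurableT _ _ iD) => [|c _]; first by apply/measurable_EFinP.
  rewrite /= lee_fin (le_trans (Re_le_normc _)) // (le_trans (bnd c)) // ler_norm //.
apply: (le_integrable measurableT _ _ iD) => [|c _]; first by apply/measurable_EFinP.
by rewrite /= lee_fin (le_trans (Im_le_normc _)) // (le_trans (bnd c)) // ler_norm.
Qed.

Lemma ae2_imply (P Q : T2 -> Prop) : (forall p, P p -> Q p) ->
  {ae lebesgue2, forall p, P p} -> {ae lebesgue2, forall p, Q p}.
Proof. by move=> PQ; apply: negligibleS => p /= nQ /PQ. Qed.

Lemma ae2_imply2 (P Q S : T2 -> Prop) : (forall p, P p -> Q p -> S p) ->
  {ae lebesgue2, forall p, P p} -> {ae lebesgue2, forall p, Q p} -> {ae lebesgue2, forall p, S p}.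
Proof.
move=> PQS nP nQ; apply: negligibleS (negligibleU nP nQ) => p /= nS.
by apply/not_andP => -[/PQS h /h].
Qed.

Lemma CintB M F G : 0 < M -> L2dom M F -> L2dom M G ->
  {ae lebesgue2, forall p, p.2 != 0 -> Cint (F \- G) p = Cint F p - Cint G p}.
Proof.
move=> M0 dF dG; have h1 := L2dom_ae_integrable M0 dF; have h2 := L2dom_ae_integrable M0 dG.
move: h1 h2; apply: ae2_imply2 => p h1 h2 p0; have [r1 i1] := h1 p0; have [r2 i2] := h2 p0.
rewrite /Cint /Cintegral; apply: complex_ext; rewrite ?cReB ?cImB /=.
  by rewrite -RintegralB //; apply: eq_Rintegral => c _; rewrite cReB.
by rewrite -RintegralB //; apply: eq_Rintegral => c _; rewrite cImB.
Qed.

(** Moving the weight into the function, as a factor 1/|a|, makes the Minkowski inequality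
    applicable. *)
Lemma L2norm_Lnorm (X : T2 -> R[i]) : L2norm X = Lnorm mu2 2%:E (EFin \o (fun p => normc (X p) * `|p.2|^-1)).
Proof.
rewrite L2normE unlock /sqn; congr poweR; apply: eq_integral => p _ /=.
by rewrite powR_mulrn // real_normK ?num_real // exprMn /wt exprVn real_normK ?num_real.
Qed.

Lemma L2norm_triangle (X Y Z : T2 -> R[i]) : cmeas X -> cmeas Y -> cmeas Z ->
  {ae lebesgue2, forall p, p.2 != 0 -> normc (Z p) <= normc (X p) + normc (Y p)} ->
  (L2norm Z <= L2norm X + L2norm Y)%E.
Proof.
move=> mX mY mZ h.
have mw : measurable_fun setT (fun p : T2 => `|p.2|^-1).
  apply: (measurableT_comp measurable_invr); apply: measurableT_comp => //.
have m U : cmeas U -> measurable_fun setT (fun p : T2 => normc (U p) * `|p.2|^-1).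
  by move=> mU; apply: measurable_funM => //; exact: cmeas_normc.
rewrite !L2norm_Lnorm; apply: (le_trans _ (minkowski_EFin _ (m _ mX) (m _ mY) _)); last by rewrite ler1n.
rewrite unlock; apply: gt0_ler_poweR; rewrite ?invr_ge0 //.
- by rewrite in_itv /= leey andbT; apply: integral_ge0 => p _; rewrite /= lee_fin powR_ge0.
- by rewrite in_itv /= leey andbT; apply: integral_ge0 => p _; rewrite /= lee_fin powR_ge0.
apply: (ae_ge0_le_integral (mu := lebesgue2)) => //.
- by move=> p _; rewrite /= lee_fin powR_ge0.
- by apply/measurable_EFinP; apply: (measurableT_comp (measurable_powR _)); apply: measurableT_comp => //; exact: m.
- by move=> p _; rewrite /= lee_fin powR_ge0.
- apply/measurable_EFinP; apply: (measurableT_comp (measurable_powR _)); apply: measurableT_comp => //.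
  by apply: measurable_funD; exact: m.
(* On the line a = 0 both sides vanish, since the inverse of 0 is 0. *)
move: h; apply: ae2_imply => p h _ /=; rewrite lee_fin; have [p0|p0] := eqVneq p.2 0.
  by rewrite p0 normr0 invr0 !mulr0 addr0.
have := h p0; have : 0 <= `|p.2|^-1 by rewrite invr_ge0.
move: (`|_|^-1) (normc_ge0 (X p)) (normc_ge0 (Y p)) (normc_ge0 (Z p)).
move: (normc (X p)) (normc (Y p)) (normc (Z p)) => x y z w x0 y0 z0 w0 zxy.
have H0 : 0 <= x * w + y * w by rewrite addr_ge0 // mulr_ge0.
have H1 : 0 <= z * w by exact: mulr_ge0.
rewrite (ger0_norm H0) (ger0_norm H1).
by apply: ge0_ler_powR; rewrite ?nnegrE // -mulrDl ler_wpM2r.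
Qed.

Lemma L2norm_Cint_triangle M F G : 0 < M -> L2dom M F -> L2dom M G ->
  (L2norm (Cint F) <= L2norm (Cint G) + L2norm (Cint (F \- G)%R))%E.
Proof.
move=> M0 dF dG; have [mF _ _] := dF; have [mG _ _] := dG.
apply: L2norm_triangle; try by apply: cmeas_Cint => //; exact: cmeasB.
have := CintB M0 dF dG; apply: ae2_imply => p E p0.
by rewrite -{1}(subrK (Cint G p) (Cint F p)) addrC (E p0) normcD.
Qed.

(** The integrand of [convol s h g], taken as a function of all three variables to make it jointly
    measurable. *)
Definition cker s (h g : R * R -> R[i]) (z : T1 * T2) : R[i] :=
  (`|1 + s * z.1|^-1)%:C * h (z.1, z.2.2 + s * (z.1 - z.2.1)) * g (tau s z.1 z.2).

Lemma convol_Cint s h g : convol s h g = Cint (cker s h g).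
Proof. by apply/funext => -[b a]. Qed.

Lemma measurable_hline s : measurable_fun setT
  (fun z : T1 * T2 => (z.1, z.2.2 + s * (z.1 - z.2.1)) : T2).
Proof.
apply: measurable_fun_pair => //; apply: measurable_funD; first by apply: measurableT_comp => //.
by apply: measurable_funM => //; apply: measurable_funB => //; apply: measurableT_comp => //.
Qed.

Lemma measurable_onepinv s : measurable_fun setT (fun z : T1 * T2 => `|1 + s * z.1|^-1).
Proof.
apply: (measurableT_comp measurable_invr); apply: measurableT_comp => //.
by apply: measurable_funD => //; exact: measurable_funM.
Qed.

Lemma cmeas_cker s (h g : T2 -> R[i]) : cmeas h -> cmeas g -> cmeas (cker s h g).
Proof.
move=> mh mg.
have -> : cker s h g = ((fun z => (`|1 + s * z.1|^-1)%:C) \*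
  (fun z => h (z.1, z.2.2 + s * (z.1 - z.2.1)))) \* (fun z => g (tau s z.1 z.2)) by [].
apply: cmeasM.
  apply: cmeasM.
    exact: (cmeas_real (measurable_onepinv s)).
  exact: (cmeas_comp (measurable_hline s) mh).
exact: (cmeas_comp (measurable_tau s) mg).
Qed.

Lemma sqn3_tau s M (g : T2 -> R[i]) : 0 < M -> (forall c, `|c| <= M -> 0 < 1 + s * c) -> cmeas g ->
  sqn3 (fun z => \1_(symitv M) z.1 * normc (g (tau s z.1 z.2))) = ((2 * M)%:E * sqn g)%E.
Proof.
move=> M0 sM mg; have mn := cmeas_normc mg.
rewrite /sqn -(integral_tau3 M0 sM (phi := fun p => normc (g p) ^+ 2)).
- apply: eq_integral => z _; congr (_ * _)%:E; rewrite exprMn; congr (_ * _).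
  by rewrite indicE; case: (_ \in _); rewrite ?expr1n ?expr0n.
- exact: measurable_funX.
- by move=> p; rewrite sqr_ge0.
Qed.

Lemma normc_cker_le s h g M A e z : 0 < e -> 0 <= A ->
  (forall p, normc (h p) <= A) -> (forall p, M < `|p.1| -> h p = 0) ->
  (forall c, `|c| <= M -> e <= 1 + s * c) ->
  normc (cker s h g z) <= A / e * (\1_(symitv M) z.1 * normc (g (tau s z.1 z.2))).
Proof.
move=> e0 A0 hA hM se; rewrite /cker indicE in_symitv; have [cM|cM] := leP `|z.1| M; last first.
  by rewrite hM //= mulr0 !mul0r mulr0 ComplexField.Normc.normc0.
have ec := se _ cM.
rewrite mul1r !normcM normc_real ler_wpM2r ?normc_ge0 // mulrC ler_pM ?normc_ge0 ?invr_ge0 //.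
rewrite ger0_norm ?invr_ge0 // lef_pV2 ?posrE //; last by rewrite normr_gt0; lra.
by rewrite (le_trans ec) // ler_norm.
Qed.

Lemma L2dom_cker s h g M A e : 0 < M -> 0 < e -> 0 <= A -> cmeas (h : T2 -> R[i]) ->
  (forall p, normc (h p) <= A) -> (forall p, M < `|p.1| -> h p = 0) ->
  (forall c, `|c| <= M -> e <= 1 + s * c) -> cmeas (g : T2 -> R[i]) -> (sqn g < +oo)%E ->
  L2dom M (cker s h g).
Proof.
move=> M0 e0 A0 mh hA hM se mg lg; split; first exact: cmeas_cker.
  by move=> z zM; rewrite /cker hM //= mulr0 mul0r.
have se' c : `|c| <= M -> 0 < 1 + s * c by move=> /se; exact: lt_le_trans.
apply: (@le_lt_trans _ _ (((A / e) ^+ 2)%:E * ((2 * M)%:E * sqn g))%E); last first.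
  by rewrite lte_mul_pinfty ?lee_fin ?sqr_ge0 // lte_mul_pinfty // lee_fin mulr_ge0 // ltW.
rewrite -(sqn3_tau M0 se' mg); apply: sqn3_le.
- apply: measurable_funM; first by apply: (measurableT_comp (measurable_indic (measurable_symitv M))).
  exact: (measurableT_comp (cmeas_normc mg) (measurable_tau s)).
- by rewrite divr_ge0 // ltW.
move=> z; rewrite ger0_norm ?normc_ge0 // ger0_norm ?mulr_ge0 ?normc_ge0 ?indicE ?ler0n //.
by rewrite -indicE; exact: normc_cker_le.
Qed.

Lemma L2_patch0 (g : R * R -> R[i]) : L2 g -> cmeas (patch0 g : T2 -> R[i]) /\ (sqn (patch0 g) < +oo)%E.
Proof.
move=> Lg; split; first exact: patch0_measurable.
case: Lg => _ _; rewrite L2normE sqn_patch0; case: (sqn g) (sqn_ge0 g) => [x| |] //= _.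
  by move=> _; rewrite ltry.
by rewrite invr_eq0 pnatr_eq0.
Qed.

Lemma L2norm_convol_patch0 s h (g : R * R -> R[i]) :
  L2norm (convol s h (patch0 g)) = L2norm (convol s h g).
Proof. by rewrite !L2normE sqn_convol_patch0. Qed.

(** Convolution is additive in its first argument almost everywhere; the common bound and support
    put both kernels in [L2dom], where [CintB] provides this. *)
Lemma opnorm_triangle s h1 h2 M A e : 0 < M -> 0 < e -> 0 <= A ->
  cmeas (h1 : T2 -> R[i]) -> cmeas (h2 : T2 -> R[i]) ->
  (forall p, normc (h1 p) <= A) -> (forall p, M < `|p.1| -> h1 p = 0) ->
  (forall p, normc (h2 p) <= A) -> (forall p, M < `|p.1| -> h2 p = 0) ->
  (forall c, `|c| <= M -> e <= 1 + s * c) ->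
  (opnorm s h1 <= opnorm s h2 + opnorm s (h1 \- h2)%R)%E.
Proof.
move=> M0 e0 A0 m1 m2 h1A h1M h2A h2M se; apply: ge_ereal_sup => _ [g [Lg g1] <-].
have [mg lg] := L2_patch0 Lg.
have d1 := L2dom_cker M0 e0 A0 m1 h1A h1M se mg lg.
have d2 := L2dom_cker M0 e0 A0 m2 h2A h2M se mg lg.
rewrite -L2norm_convol_patch0 convol_Cint; apply: (le_trans (L2norm_Cint_triangle M0 d1 d2)).
have -> : cker s h1 (patch0 g) \- cker s h2 (patch0 g) = cker s (h1 \- h2) (patch0 g).
  by apply/funext => z; rewrite /cker /= -mulrBl -mulrBr.
rewrite -!convol_Cint !L2norm_convol_patch0.
by apply: leeD; apply: ereal_sup_ubound; exists g.
Qed.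

End FiberIntegrals.

(** * Continuity away from 0 *)

Section Dilation.
Context {R : realType}.
Implicit Types (M e s lam kap : R).
Local Notation mu1 := (@lebesgue_measure R).
Local Notation mu2 := (mu1 \x mu1)%E.
Local Notation T1 := (measurableTypeR R).
Local Notation T2 := (measurableTypeR R * measurableTypeR R)%type.
Local Notation normc := (@ComplexField.Normc.normc R).

(** Valid for divergent integrals too: a positive factor changes neither infinite part, hence not
    the default value. *)
Lemma Rintegral_posZ kap (F : R -> R) : 0 < kap -> measurable_fun setT F ->
  \int[mu1]_x (kap * F x) = kap * \int[mu1]_x F x.
Proof.
move=> k0 mF; rewrite /Rintegral; have k0' := ltW k0.
have mE : measurable_fun [set: measurableTypeR R] (EFin \o F) by exact/measurable_EFinP.
rewrite (integralE mu1 setT (fun x => (kap * F x)%:E)) (integralE mu1 setT (fun x => (F x)%:E)).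
have -> : (fun x => (kap * F x)%:E) = (fun x => kap%:E * (EFin \o F) x)%E by apply/funext => x; rewrite EFinM.
rewrite (ge0_funeposM _ k0') (ge0_funenegM _ k0').
rewrite (ge0_integralZl_EFin mu1 measurableT _ _ k0') //; last by exact: measurable_funepos.
rewrite (ge0_integralZl_EFin mu1 measurableT _ _ k0') //; last by exact: measurable_funeneg.
have : (0 <= \int[mu1]_x (EFin \o F)^\+ x)%E by apply: integral_ge0.
have : (0 <= \int[mu1]_x (EFin \o F)^\- x)%E by apply: integral_ge0.
move: (\int[mu1]_x (EFin \o F)^\+ x)%E (\int[mu1]_x (EFin \o F)^\- x)%E.
move=> [x| |] [y| |] //= _ _; rewrite ?gt0_muley ?lte_fin //= ?mulr0 //.
by rewrite mulrBr.
Qed.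

Definition dil lam (f : R * R -> R[i]) (p : R * R) : R[i] := f (p.1 / lam, p.2).

Lemma measurable_dil_map lam : measurable_fun setT (fun p : T2 => (p.1 / lam, p.2) : T2).
Proof. by apply: measurable_fun_pair => //; apply: measurable_funM. Qed.

Lemma cmeas_dil lam f : cmeas (f : T2 -> R[i]) -> cmeas (dil lam f : T2 -> R[i]).
Proof. by move=> mf; exact: (cmeas_comp (measurable_dil_map lam) mf). Qed.

Lemma dilK lam f : lam != 0 -> dil lam^-1 (dil lam f) = f.
Proof. by move=> l0; apply/funext => -[b a]; rewrite /dil /= invrK mulfK. Qed.

Lemma ge0_integral_dil lam (f : T2 -> \bar R) : 0 < lam -> measurable_fun setT f -> (forall p, 0 <= f p)%E ->
  (\int[mu2]_p f (p.1 / lam, p.2)%R = lam%:E * \int[mu2]_p f p)%E.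
Proof.
move=> l0 mf f0.
have md : measurable_fun setT (fun p : T2 => f (p.1 / lam, p.2)%R).
  exact: (measurableT_comp mf (measurable_dil_map lam)).
rewrite (fubini_tonelli2 _ md) // (fubini_tonelli2 _ mf) // /fubini_G.
have mG := measurable_fun_fubini_tonelli_G (m1 := mu1) f mf f0.
rewrite -(ge0_integralZl_EFin mu1 measurableT _ mG (ltW l0)); last first.
  by move=> y _; apply: integral_ge0.
apply: eq_integral => y _ /=.
have mfy : measurable_fun setT (fun x => f (x, y)) by exact: measurableT_comp.
rewrite -(ge0_integral_affine 0 l0 mfy) //.
by apply: eq_integral => x _; rewrite subr0.
Qed.

Lemma sqn_dil lam kap (X : T2 -> R[i]) : 0 < lam -> cmeas X ->
  sqn (fun p => kap%:C * dil lam X p) = ((kap ^+ 2 * lam)%:E * sqn X)%E.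
Proof.
move=> l0 mX; have mn := cmeas_normc mX; rewrite EFinM -muleA.
have mf : measurable_fun [set: T2] (fun p => (normc (X p) ^+ 2 * wt p.2)%:E).
  apply/measurable_EFinP; apply: measurable_funM; first exact: measurable_funX.
  by apply: (measurableT_comp measurable_wt).
have f0 p : (0 <= (normc (X p) ^+ 2 * wt p.2)%:E)%E by rewrite lee_fin mulr_ge0 ?sqr_ge0 ?wt_ge0.
rewrite /sqn -(ge0_integral_dil l0 mf f0) -ge0_integralZl_EFin ?sqr_ge0 //; last first.
  exact: (measurableT_comp mf (measurable_dil_map lam)).
apply: eq_integral => p _ /=; rewrite -EFinM mulrA; congr (_ * _)%:E.
by rewrite normcM normc_real exprMn real_normK ?num_real.
Qed.

(** Substitute [c] by [lam * c]: the products s c and s (c - b) keep their form with parameter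
    [lam * s], and dc contributes the factor [lam]. *)
Lemma convol_dil s lam kap (h g : T2 -> R[i]) b a : 0 < lam -> 0 < kap -> cmeas h -> cmeas g ->
  convol s (dil lam h) (fun p => kap%:C * dil lam g p) (b, a) =
  (kap * lam)%:C * convol (lam * s) h g (b / lam, a).
Proof.
move=> l0 k0 mh mg; have ln0 : lam != 0 by rewrite gt_eqF.
pose F c := cker (lam * s) h g (c, (b / lam, a)).
have mp : measurable_fun setT (fun c : T1 => (c, (b / lam, a)) : T1 * T2) by exact: measurable_fun_pair.
have [mr mi] : cmeas (F : T1 -> R[i]) by exact: (cmeas_comp mp (cmeas_cker (lam * s) mh mg)).
have E c : (`|1 + s * c|^-1)%:C * dil lam h (c, a + s * (c - b)) *
    (kap%:C * dil lam g ((b - c) / (1 + s * c), a / (1 + s * c))) = kap%:C * F ((c - 0) / lam).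
  rewrite /F /cker /dil /tau /= subr0.
  have -> : lam * s * (c / lam) = s * c by rewrite (mulrC lam) -mulrA (mulrC lam) divfK.
  have -> : lam * s * (c / lam - b / lam) = s * (c - b) by rewrite -mulrBl (mulrC lam) -mulrA (mulrC lam) divfK.
  have -> : (b / lam - c / lam) / (1 + s * c) = (b - c) / (1 + s * c) / lam by rewrite -mulrBl mulrAC.
  by rewrite mulrCA.
have H := fun f mf f0 => @ge0_integral_affine R 0 lam f l0 mf f0.
rewrite /convol -/F /Cintegral; apply: complex_ext; rewrite ?cReM ?cImM /= !mul0r ?subr0 ?addr0.
  transitivity (\int[mu1]_c (kap * complex.Re (F ((c - 0) / lam)))).
    by apply: eq_Rintegral => c _; rewrite E cReM /= mul0r subr0.
  rewrite Rintegral_posZ //; last exact: (measurableT_comp mr (measurable_affine 0 lam)).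
  by rewrite (Rintegral_comp l0 H mr) mulrA.
transitivity (\int[mu1]_c (kap * complex.Im (F ((c - 0) / lam)))).
  by apply: eq_Rintegral => c _; rewrite E cImM /= mul0r addr0.
rewrite Rintegral_posZ //; last exact: (measurableT_comp mi (measurable_affine 0 lam)).
by rewrite (Rintegral_comp l0 H mi) mulrA.
Qed.

(** Each test vector is transported by a unitary dilation; of the factor [kap * lam] in
    [convol_dil], [kap] belongs to this isometry and [lam] scales the norm. *)
Lemma opnorm_dil_le s lam (h : T2 -> R[i]) : 0 < lam -> cmeas h ->
  (opnorm (lam * s) h <= lam^-1%:E * opnorm s (dil lam h))%E.
Proof.
move=> l0 mh; apply: ge_ereal_sup => _ [g [Lg g1] <-].
have [mg lg] := L2_patch0 Lg.
(* The factor making g -> kap g(b / lam, a) an isometry of L2. *)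
pose kap := (Num.sqrt lam)^-1.
have k0 : 0 < kap by rewrite invr_gt0 sqrtr_gt0.
have kl : kap ^+ 2 * lam = 1 by rewrite exprVn sqr_sqrtr ?(ltW l0) // mulVf // gt_eqF.
pose g' := fun p => kap%:C * dil lam (patch0 g) p.
have Eg : sqn g' = sqn g by rewrite sqn_dil // kl mul1e sqn_patch0.
have mg' : cmeas (g' : T2 -> R[i]).
  apply: (@cmeasM _ _ _ (fun=> kap%:C)); first by apply: cmeas_real; exact: measurable_cst.
  exact: cmeas_dil.
have Lg' : L2 g'.
  case: Lg => _ _ lg'; case: mg' => m1 m2; split.
  - exact: (measurable_funS measurableT).
  - exact: (measurable_funS measurableT).
  - by rewrite L2normE Eg -L2normE.
have mY : cmeas (convol (lam * s) h (patch0 g) : T2 -> R[i]).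
  by rewrite convol_Cint; apply: cmeas_Cint; exact: cmeas_cker.
have EX : convol s (dil lam h) g' = fun p => (kap * lam)%:C * dil lam (convol (lam * s) h (patch0 g)) p.
  by apply/funext => -[b a]; rewrite /g' convol_dil.
rewrite -L2norm_convol_patch0.
apply: (@le_trans _ _ (lam^-1%:E * L2norm (convol s (dil lam h) g'))%E); last first.
  rewrite lee_wpmul2l ?lee_fin ?invr_ge0 ?(ltW l0) //; apply: ereal_sup_ubound; exists g' => //.
  by split => //=; rewrite L2normE Eg -L2normE.
apply: L2norm_le; first by rewrite invr_ge0 ltW.
rewrite EX sqn_dil // muleA -EFinM.
have -> : lam^-1 ^+ 2 * ((kap * lam) ^+ 2 * lam) = 1.
  have alg (k l m : R) : m ^+ 2 * ((k * l) ^+ 2 * l) = (k ^+ 2 * l) * (m * l) ^+ 2 by ring.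
  rewrite alg.
  by rewrite kl mulVf ?gt_eqF // expr1n mulr1.
by rewrite mul1e.
Qed.

(** The reverse inequality is [opnorm_dil_le] for the inverse dilation, applied to the dilated
    function. *)
Lemma opnorm_dil s lam (h : T2 -> R[i]) : 0 < lam -> cmeas h ->
  opnorm (lam * s) h = (lam^-1%:E * opnorm s (dil lam h))%E.
Proof.
move=> l0 mh; have ln0 : lam != 0 by rewrite gt_eqF.
have li0 : 0 < lam^-1 by rewrite invr_gt0.
apply/eqP; rewrite eq_le opnorm_dil_le //=.
have := opnorm_dil_le (lam * s) li0 (cmeas_dil lam mh).
rewrite dilK // mulKf // invrK => h1.
have := lee_wpmul2l (x := lam^-1%:E) _ h1; rewrite lee_fin (ltW li0) => /(_ isT).
by rewrite muleA -EFinM mulVf // mul1e.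
Qed.

Lemma continuous_cmeas (f : R * R -> R[i]) : smooth f -> cmeas (f : T2 -> R[i]).
Proof.
move=> sf; split; apply: continuous_measurable2.
  exact: (Ck_continuous (smooth_re 0 sf)).
exact: (Ck_continuous (smooth_im 0 sf)).
Qed.

Lemma testfun_bounded (f : R * R -> R[i]) : testfun 0 f ->
  exists A, 0 <= A /\ forall p, normc (f p) <= A.
Proof.
move=> hf; have [M [e [M0 e0 bf]]] := testfun_boxed hf; have sf := testfun_smooth hf.
have [A [A0 hA]] := boxed_bounded (boxed_re bf) (Ck_continuous (smooth_re 0 sf)).
have [B [B0 hB]] := boxed_bounded (boxed_im bf) (Ck_continuous (smooth_im 0 sf)).
exists (A + B); split; first by rewrite addr_ge0.
by move=> p; apply: (le_trans (normc_le_ReIm _)); apply: lerD; [exact: hA|exact: hB].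
Qed.

Lemma testfun_lipschitz (f : R * R -> R[i]) : testfun 0 f ->
  exists L, 0 <= L /\ forall p q, normc (f p - f q) <= L * (`|p.1 - q.1| + `|p.2 - q.2|).
Proof.
move=> hf; have [M [e [M0 e0 bf]]] := testfun_boxed hf; have sf := testfun_smooth hf.
have [A [A0 hA]] := boxed_lipschitz (boxed_re bf) (smooth_re 1 sf).
have [B [B0 hB]] := boxed_lipschitz (boxed_im bf) (smooth_im 1 sf).
exists (A + B); split; first by rewrite addr_ge0.
move=> p q; apply: (le_trans (normc_le_ReIm _)); rewrite cReB cImB mulrDl.
by apply: lerD; [exact: hA|exact: hB].
Qed.

(** Membership for all smaller parameters excludes |s| |b| >= 1 on the support, and compactness
    turns the strict inequality into a margin. *)
Lemma domQ_strict s (f : R * R -> R[i]) : s != 0 -> domQ s f ->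
  exists d, [/\ 0 < d, d <= 1 & forall p, f p != 0 -> `|s| * `|p.1| <= 1 - d].
Proof.
move=> s0 [hf hd].
have [_ cK _] := hf.
have [d [d0 Hd]] : exists d : R, 0 < d /\ forall p, supp f p -> d <= 1 - `|s| * `|p.1|.
  apply: compact_inv_bound => //.
    move=> p; apply: cvgB; first exact: cvg_cst.
    by apply: cvgM; [exact: cvg_cst|apply: cvg_norm; exact: cvg_fst].
  move=> p Kp; rewrite subr_gt0 ltNge; apply/negP => h.
  have p0 : p.1 != 0 by apply: contraTneq h => ->; rewrite normr0 mulr0 -ltNge.
  (* The parameter -1/b has modulus at most |s| and makes 1 + delta b vanish at the offending
     point. *)
  have [|_ _ /(_ _ Kp)] := hd (- p.1^-1).
    by rewrite normrN normfV -[X in X <= _]div1r ler_pdivrMr ?normr_gt0.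
  by move=> [_ /=]; rewrite mulNr mulVf // subrr mul0r eqxx.
exists (Num.min d 1); split.
- by rewrite lt_min d0 ltr01.
- by rewrite ge_min lexx orbT.
move=> p fp; have := Hd p (@subset_closure _ [set p | f p != 0] p fp); rewrite lerBrDr => h.
by rewrite lerBrDr (le_trans _ h) // addrC lerD2r ge_min lexx.
Qed.

End Dilation.

(** * Comparison of the norms under dilation *)

Section ContinuityAway.
Context {R : realType}.
Local Notation T2 := (measurableTypeR R * measurableTypeR R)%type.
Local Notation normc := (@ComplexField.Normc.normc R).

(** [opnorm_dil] places all the norms in the algebra at [s0], where subadditivity in both directions
    bounds the change by the norm of [dil lam f - f]. *)
Lemma opnorm_near s0 (f : R * R -> R[i]) : s0 != 0 -> domQ s0 f ->
  exists N K d : R, [/\ 0 < d, opnorm s0 f = N%:E & forall lam, 0 < lam -> `|lam - 1| < d ->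
    ((lam^-1 * (N - K * `|lam - 1|))%:E <= opnorm (lam * s0) f /\
     opnorm (lam * s0) f <= (lam^-1 * (N + K * `|lam - 1|))%:E)%E].
Proof.
move=> s00 hd; have hf := hd.1; have mf := continuous_cmeas (testfun_smooth hf).
have [A [A0 hA]] := testfun_bounded hf; have [L [L0 hL]] := testfun_lipschitz hf.
have [d [d0 d1 Hd]] := domQ_strict s00 hd.
have t0 : 0 < `|s0| by rewrite normr_gt0.
(* Half of the margin is spent on the supports of the dilated functions, as (1 - d)(1 + d/2) <= 1 -
   d/2; the other half keeps 1 + s0 c >= d/2. *)
pose M := (1 - d / 2) / `|s0|.
have M0 : 0 < M by rewrite divr_gt0 //; lra.
pose e := d / 2; have e0 : 0 < e by rewrite divr_gt0.
have se c : `|c| <= M -> e <= 1 + s0 * c.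
  rewrite ler_pdivlMr // => h; have : `|s0 * c| <= 1 - e by rewrite normrM mulrC.
  by rewrite ler_norml => /andP[h1 _]; rewrite -lerBlDl; move: h1; rewrite opprB.
have suppd lam p : 0 < lam -> `|lam - 1| < d / 2 -> M < `|p.1| -> dil lam f p = 0.
  move=> l0 l1 pM; apply/eqP/negPn/negP => /Hd /=; apply/negP; rewrite -ltNge.
  rewrite normrM normfV (gtr0_norm l0) mulrA ltr_pdivlMr //.
  have l2 : lam < 1 + d / 2 by move: l1; rewrite ltr_norml => /andP[_]; lra.
  move: pM; rewrite ltr_pdivrMr // (mulrC `|p.1|); apply: le_lt_trans.
  have : (1 - d) * lam <= (1 - d) * (1 + d / 2) by rewrite ler_wpM2l //; [lra|exact: ltW].
  have := mulr_ge0 (ltW d0) (ltW d0); lra.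
have suppf p : M < `|p.1| -> f p = 0.
  have := suppd 1 p ltr01; rewrite subrr normr0 /dil divr1 -surjective_pairing.
  by apply; rewrite divr_gt0.
have mdil lam : cmeas (dil lam f : T2 -> R[i]) := cmeas_dil lam mf.
have Adil lam p : normc (dil lam f p) <= A by exact: hA.
have fin1 : opnorm s0 f \is a fin_num.
  rewrite ge0_fin_numE ?opnorm_ge0 //.
  by apply: (le_lt_trans (opnorm_le M0 e0 A0 hA suppf se)); rewrite ltry.
(* The bound of [opnorm_le] with sup norm the Lipschitz constant times |b/lam - b| <= 2 M |lam -
   1|. *)
pose K := 3 * M * (L * (2 * M)) / e.
exists (fine (opnorm s0 f)), K, (Num.min (d / 2) 2^-1); split.
- by rewrite lt_min divr_gt0 //= invr_gt0.
- by rewrite fineK.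
move=> lam l0; rewrite lt_min => /andP[l1 l2].
have lh : 2^-1 <= lam by move: l2; rewrite ltr_norml => /andP[+ _]; lra.
have li : lam^-1 <= 2 by rewrite -[leRHS]invrK lef_pV2 ?posrE.
have supd p := suppd lam p l0 l1.
have bound p : normc (dil lam f p - f p) <= L * (2 * M) * `|lam - 1|.
  have R0 : 0 <= L * (2 * M) * `|lam - 1|.
    by do 2 apply: mulr_ge0 => //; apply: mulr_ge0 => //; exact: ltW.
  have [pM|pM] := ltP M `|p.1|.
    by rewrite supd // suppf // subr0 ComplexField.Normc.normc0.
  case: p pM => b a /= pM; rewrite (le_trans (hL _ _)) //= subrr normr0 addr0 -mulrA ler_wpM2l //.
  have -> : b / lam - b = - (lam^-1 * b * (lam - 1)) by field; rewrite gt_eqF.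
  rewrite normrN !normrM ler_wpM2r // ler_pM //.
  by rewrite ger0_norm ?invr_ge0 // ltW.
have Q0 : 0 <= L * (2 * M) * `|lam - 1|.
    by do 2 apply: mulr_ge0 => //; apply: mulr_ge0 => //; exact: ltW.
have b1 : (opnorm s0 (dil lam f \- f)%R <= (K * `|lam - 1|)%:E)%E.
  have -> : K * `|lam - 1| = 3 * M * (L * (2 * M) * `|lam - 1|) / e by rewrite /K; ring.
  apply: opnorm_le => // p pM /=; by rewrite supd // suppf // subr0.
have b2 : (opnorm s0 (f \- dil lam f)%R <= (K * `|lam - 1|)%:E)%E.
  have -> : K * `|lam - 1| = 3 * M * (L * (2 * M) * `|lam - 1|) / e by rewrite /K; ring.
  apply: opnorm_le => // p /=; last by move=> pM; rewrite supd // suppf // subr0.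
  by rewrite -(@normcN R) opprB; exact: bound.
have t1 := opnorm_triangle M0 e0 A0 (mdil lam) mf (Adil lam) supd hA suppf se.
have t2 := opnorm_triangle M0 e0 A0 mf (mdil lam) hA suppf (Adil lam) supd se.
have {}t1 := le_trans t1 (leeD (lexx _) b1); have {}t2 := le_trans t2 (leeD (lexx _) b2).
rewrite opnorm_dil //; have D0 := opnorm_ge0 s0 (dil lam f).
move: t1 t2 D0; rewrite -(fineK fin1) /=; move: (fine _) => N.
case: (opnorm s0 (dil lam f)) => [n| |] //; rewrite -!EFinD !lee_fin => t1 t2 n0.
have li0 : 0 <= lam^-1 by rewrite invr_ge0 ltW.
by split; apply: ler_wpM2l => //; rewrite lerBlDr.
Qed.

Lemma opnorm_continuous_away s0 (f : R * R -> R[i]) : domQ s0 f -> s0 != 0 ->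
  opnorm s (Q s f) @[s --> within [set s | domQ s f] (nbhs s0)] --> opnorm s0 (Q s0 f).
Proof.
move=> hd s00; have [N [K [d [d0 EN H]]]] := opnorm_near s00 hd.
rewrite Q_id // EN.
have clam : (fun s => s / s0) @ s0 --> (1 : R).
  by rewrite -(divff s00); apply: cvgM; [exact: cvg_id|exact: cvg_cst].
have cn : (fun s => `|s / s0 - 1|) @ s0 --> (0 : R).
  by rewrite -(normr0 R) -(subrr 1); apply: cvg_norm; apply: cvgB => //; exact: cvg_cst.
have ci : (fun s => (s / s0)^-1) @ s0 --> (1 : R).
  by rewrite -(invr1 R); apply: cvgV => //; exact: oner_neq0.
have cb (k : R) : (fun s => (s / s0)^-1 * (N + k * `|s / s0 - 1|)) @ s0 --> N.
  rewrite -[X in _ --> X]mul1r -[in X in _ --> X](addr0 N) -[in X in _ --> X](mulr0 k).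
  apply: cvgM => //; apply: cvgD; first exact: cvg_cst.
  by apply: cvgM => //; exact: cvg_cst.
have cw (u : R -> R) : u @ s0 --> N -> (u s)%:E @[s --> within [set s | domQ s f] (nbhs s0)] --> N%:E.
  move=> cu; apply: cvg_EFin; first exact: nearW.
  by apply: (cvg_trans _ cu); apply: cvg_app; exact: cvg_within.
apply: (@squeeze_cvge _ _ _ _ (fun s => ((s / s0)^-1 * (N + (- K) * `|s / s0 - 1|))%:E) _
   (fun s => ((s / s0)^-1 * (N + K * `|s / s0 - 1|))%:E)); [|exact: cw|exact: cw].
rewrite near_withinE; near=> s => ds; rewrite Q_id //.
have sl : s / s0 * s0 = s by rewrite divfK.
have l0 : 0 < s / s0 by near: s; exact: (cvgr_gt _ clam).
have l1 : `|s / s0 - 1| < d by near: s; exact: (cvgr_lt _ cn).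
by have [h1 h2] := H _ l0 l1; rewrite sl in h1 h2; rewrite mulNr h1 h2.
Unshelve. all: end_near. Qed.

End ContinuityAway.

(** * Strong continuity and lower semicontinuity at 0 *)

Section TendsToZero.
Context {R : realType}.
Implicit Types u v : nat -> \bar R.

(** A one-sided form of convergence, adequate for nonnegative sequences and inherited by any smaller
    sequence. *)
Definition tends0 u := forall e : R, 0 < e -> \forall n \near \oo, (u n <= e%:E)%E.

Lemma tends0_cvg u : u @ \oo --> 0%E -> tends0 u.
Proof.
move=> cu e e0; apply: (cu [set y : \bar R | (y <= e%:E)%E]).
apply: (@filterS _ _ _ [set y | (y < e%:E)%E]); first by move=> y; exact: ltW.
by apply: open_nbhs_nbhs; split; [exact: open_ereal_lt_ereal|rewrite /= lte_fin].
Qed.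

Lemma tends0_le u v : tends0 v -> (forall n, (u n <= v n)%E) -> tends0 u.
Proof. by move=> hv uv e /hv; apply: filterS => n; exact: le_trans (uv n). Qed.

Lemma tends0D u v : tends0 u -> tends0 v -> tends0 (fun n => u n + v n)%E.
Proof.
move=> hu hv e e0; have e2 : 0 < e / 2 by rewrite divr_gt0.
apply: filterS2 (hu _ e2) (hv _ e2) => n h1 h2.
by rewrite (splitr e) EFinD; exact: leeD.
Qed.

Lemma tends0M (k : R) u : 0 <= k -> tends0 u -> tends0 (fun n => k%:E * u n)%E.
Proof.
move=> k0 hu e e0; have k1 : 0 < k + 1 by rewrite ltr_wpDl.
apply: filterS (hu (e / (k + 1)) _); last by rewrite divr_gt0.
move=> n h; apply: (le_trans (lee_wpmul2l _ h)); first by rewrite lee_fin.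
rewrite -EFinM lee_fin mulrA ler_pdivrMr // mulrC ler_wpM2l ?(ltW e0) //.
by rewrite lerDl.
Qed.

(** Dominated convergence for weighted squares; pointwise convergence is asked only where the weight
    is nonzero, so the line a = 0 drops out. *)
Lemma sq_dct d (T : measurableType d) (mu : {measure set T -> \bar R}) (w : T -> R)
    (u : nat -> T -> R) (v : T -> R) :
  measurable_fun setT w -> (forall x, 0 <= w x) -> (forall n, measurable_fun setT (u n)) ->
  measurable_fun setT v -> (forall n x, `|u n x| <= `|v x|) ->
  (forall x, w x != 0 -> u n x @[n --> \oo] --> (0 : R)) ->
  (\int[mu]_x (v x ^+ 2 * w x)%:E < +oo)%E ->
  tends0 (fun n => \int[mu]_x (u n x ^+ 2 * w x)%:E)%E.
Proof.
move=> mw w0 mu_ mv uv u0 fin.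
have m (y : T -> R) : measurable_fun setT y -> measurable_fun setT (fun x => (y x ^+ 2 * w x)%:E).
  by move=> my; apply/measurable_EFinP; apply: measurable_funM => //; exact: measurable_funX.
have p0 (y : T -> R) x : (0 <= (y x ^+ 2 * w x)%:E)%E by rewrite lee_fin mulr_ge0 ?sqr_ge0.
have iv : mu.-integrable setT (fun x => (v x ^+ 2 * w x)%:E).
  apply/integrableP; split; first exact: m.
  by under eq_integral do rewrite gee0_abs //.
have cv : {ae mu, forall x, setT x -> (u n x ^+ 2 * w x)%:E @[n --> \oo] --> 0%E}.
  apply: aeW => x _; apply: cvg_EFin; first exact: nearW.
  have [wx|wx] := eqVneq (w x) 0.
    by rewrite (_ : _ \o _ = fun=> 0); [exact: cvg_cst|apply/funext => n; rewrite /= wx mulr0].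
  rewrite [X in _ --> X](_ : _ = 0 * 0 * w x); last by rewrite !mul0r.
  by apply: cvgM; [apply: cvgM; exact: u0|exact: cvg_cst].
have dom : {ae mu, forall x n, setT x -> (`|(u n x ^+ 2 * w x)%:E| <= (v x ^+ 2 * w x)%:E)%E}.
  apply: aeW => x n _; rewrite gee0_abs // lee_fin ler_wpM2r //.
  by rewrite -(real_normK (num_real (u n x))) -(real_normK (num_real (v x))) ler_sqr ?nnegrE.
have [_ _] := dominated_convergence measurableT (fun n => m _ (mu_ n)) (measurable_cst 0%E) cv iv dom.
by rewrite integral0; exact: tends0_cvg.
Qed.

End TendsToZero.

Section StrongContinuity.
Import HBNNSimple.
Context {R : realType}.
Variables (M : R) (sg : nat -> R).
Hypotheses (M0 : 0 < M) (sg0 : sg n @[n --> \oo] --> (0 : R)) (sgM : forall n, `|sg n| * M <= 2^-1).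
Local Notation mu1 := (@lebesgue_measure R).
Local Notation mu2 := (mu1 \x mu1)%E.
Local Notation T1 := (measurableTypeR R).
Local Notation T2 := (measurableTypeR R * measurableTypeR R)%type.
Local Notation mu3 := (mu1 \x lebesgue2)%E.
Local Notation normc := (@ComplexField.Normc.normc R).

Definition rsqn (phi : T2 -> R) : \bar R := (\int[mu2]_p (phi p ^+ 2 * wt p.2)%:E)%E.

Definition cutoff s (phi : T2 -> R) (z : T1 * T2) : R := \1_(symitv M) z.1 * phi (tau s z.1 z.2).

(* The squared L2 distance of the translates of phi by [tau (sg n)] and [tau 0],
   integrated over |c| <= M. *)
Definition osc n (phi : T2 -> R) : \bar R := sqn3 (fun z => cutoff (sg n) phi z - cutoff 0 phi z).

Definition cvgosc (phi : T2 -> R) := measurable_fun setT phi /\ tends0 (osc ^~ phi).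

Lemma measurable_cutoff s phi : measurable_fun setT phi -> measurable_fun setT (cutoff s phi).
Proof.
move=> mphi; apply: measurable_funM; first by apply: (measurableT_comp (measurable_indic (measurable_symitv M))).
exact: (measurableT_comp mphi (measurable_tau s)).
Qed.

(** That the right side is free of [s] is used twice: as equality of masses for indicators, and as a
    uniform bound on translations in [cvgosc_limit]. *)
Lemma sqn3_cutoff s phi : `|s| * M <= 2^-1 -> measurable_fun setT phi ->
  sqn3 (cutoff s phi) = ((2 * M)%:E * rsqn phi)%E.
Proof.
move=> sM mphi; rewrite /rsqn -(@integral_tau3 _ s M (fun p => phi p ^+ 2) M0).
- apply: eq_integral => z _; congr (_ * _)%:E; rewrite /cutoff exprMn; congr (_ * _).
  by rewrite indicE; case: (_ \in _); rewrite ?expr1n ?expr0n.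
- by move=> c /(onepsc sM) /andP[+ _]; apply: lt_le_trans; rewrite invr_gt0.
- exact: measurable_funX.
- by move=> p; rewrite sqr_ge0.
Qed.

Let zeroM : `|0 : R| * M <= 2^-1. Proof. by rewrite normr0 mul0r. Qed.

Lemma cvgoscD phi psi : cvgosc phi -> cvgosc psi -> cvgosc (phi \+ psi).
Proof.
move=> [m1 h1] [m2 h2]; split; first exact: measurable_funD.
apply: (tends0_le (tends0M (k := 2) _ (tends0D h1 h2))) => // n.
have mc chi : measurable_fun setT chi -> measurable_fun setT (fun z => cutoff (sg n) chi z - cutoff 0 chi z).
  by move=> mchi; apply: measurable_funB; exact: measurable_cutoff.
apply: sqn3_le_add; [exact: mc|exact: mc|move=> z].
rewrite (le_trans _ (ler_normD _ _)) // /cutoff /= !mulrDr opprD addrACA lexx //.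
Qed.

Lemma cvgoscZ k phi : cvgosc phi -> cvgosc (fun p => k * phi p).
Proof.
move=> [m1 h1]; split; first exact: measurable_funM.
apply: (tends0_le (tends0M (k := `|k| ^+ 2) _ h1)) => [|n]; first exact: sqr_ge0.
apply: sqn3_le => //; first by apply: measurable_funB; exact: measurable_cutoff.
by move=> z; rewrite -normrM mulrBr /cutoff !(mulrCA k) lexx.
Qed.

Lemma cvgoscB phi psi : cvgosc phi -> cvgosc psi -> cvgosc (phi \- psi).
Proof.
move=> h1 h2; have := cvgoscD h1 (cvgoscZ (-1) h2).
by rewrite (_ : (_ \+ _) = phi \- psi) //; apply/funext => p /=; rewrite mulN1r.
Qed.

Lemma cvgosc0 : cvgosc (fun=> 0).
Proof.
split; first exact: measurable_cst.
move=> e e0; apply: nearW => n; rewrite /osc /sqn3 integral0_eq ?lee_fin ?(ltW e0) // => z _.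
by rewrite /cutoff mulr0 subrr expr0n mul0r.
Qed.

Lemma cvgosc_sum (I : Type) (r : seq I) (F : I -> T2 -> R) : (forall i, cvgosc (F i)) ->
  cvgosc (fun p => \sum_(i <- r) F i p).
Proof.
move=> H; elim: r => [|i r IH].
  by rewrite (_ : (fun p => _) = fun=> 0); [exact: cvgosc0|apply/funext => p; rewrite big_nil].
rewrite (_ : (fun p => _) = F i \+ (fun p => \sum_(j <- r) F j p)); first exact: cvgoscD.
by apply/funext => p; rewrite big_cons.
Qed.

(** The translates of [phi - psi] are small uniformly in [n], so strong continuity survives limits
    in L^2. *)
Lemma cvgosc_limit (phi : T2 -> R) : measurable_fun setT phi ->
  (forall e, 0 < e -> exists psi, cvgosc psi /\ (rsqn (phi \- psi)%R <= e%:E)%E) -> cvgosc phi.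
Proof.
move=> mphi H; split=> // e e0.
(* Chosen for the final count 2 (e/4 + 2 (2 M e1 + 2 M e1)) = e. *)
pose e1 := e / (32 * M).
have e10 : 0 < e1 by rewrite divr_gt0 // mulr_gt0.
have [psi [[mpsi hpsi] hr]] := H _ e10.
have e4 : 0 < e / 4 by rewrite divr_gt0.
apply: filterS (hpsi _ e4) => n hn.
have md : measurable_fun setT (phi \- psi) by exact: measurable_funB.
have mc s := measurable_cutoff s mpsi; have mc' s := measurable_cutoff s md.
have b1 : (sqn3 (fun z => cutoff (sg n) (phi \- psi)%R z - cutoff 0 (phi \- psi)%R z)%R <=
    2%:E * (sqn3 (cutoff (sg n) (phi \- psi)%R) + sqn3 (cutoff 0 (phi \- psi)%R)))%E.
  by apply: sqn3_le_add => // z; exact: ler_normB.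
rewrite !sqn3_cutoff // in b1.
have M2 : (0 <= (2 * M)%:E)%E by rewrite lee_fin mulr_ge0 // ltW.
have {}b1 := le_trans b1 (lee_wpmul2l (lee_tofin (ler0n R 2)) (leeD (lee_wpmul2l M2 hr) (lee_wpmul2l M2 hr))).
have b2 : (osc n phi <= 2%:E * (osc n psi + sqn3 (fun z => cutoff (sg n) (phi \- psi)%R z - cutoff 0 (phi \- psi)%R z)%R))%E.
  apply: sqn3_le_add; [by apply: measurable_funB|by apply: measurable_funB|move=> z].
  apply: (le_trans _ (ler_normD _ _)); rewrite le_eqVlt; apply/orP; left; apply/eqP; congr `|_|.
  by rewrite /cutoff /=; ring.
apply: (le_trans b2); apply: (le_trans (lee_wpmul2l (lee_tofin (ler0n R 2)) (leeD hn b1))).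
rewrite -!(EFinM, EFinD) lee_fin le_eqVlt; apply/orP; left; apply/eqP.
by rewrite /e1; field; rewrite gt_eqF.
Qed.

Lemma cvg_tau (c b a : R) :
  ((b - c) / (1 + sg n * c), a / (1 + sg n * c)) @[n --> \oo] --> ((b - c) / (1 + 0 * c), a / (1 + 0 * c)).
Proof.
have ck : (1 + sg n * c)^-1 @[n --> \oo] --> (1 + 0 * c)^-1.
  apply: cvgV; first by rewrite mul0r addr0 oner_neq0.
  by apply: cvgD; [exact: cvg_cst|apply: cvgM => //; exact: cvg_cst].
have c1 x : x / (1 + sg n * c) @[n --> \oo] --> x / (1 + 0 * c) by apply: cvgM => //; exact: cvg_cst.
exact: (cvg_pair (c1 (b - c)) (c1 a)).
Qed.

(* Scheffe's argument: the truncated translates of the indicator of an open set all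
   have the same integral, and they are lower semicontinuous in the parameter. *)
Lemma cvgosc_open (O : set (R * R)) : open O -> (rsqn \1_O < +oo)%E -> cvgosc \1_O.
Proof.
move=> oO fO; have mO : measurable_fun [set: T2] (\1_O : T2 -> R).
  by apply: measurable_indic; exact: open_measurable2.
split=> //.
(* The part of the translate at 0 that the translate at [sg n] misses; it tends to 0 pointwise
   because [O] is open. *)
pose loss n (z : T1 * T2) : R := cutoff 0 \1_O z * (1 - cutoff (sg n) \1_O z).
have mloss n : measurable_fun setT (loss n).
  by apply: measurable_funM; [exact: measurable_cutoff|apply: measurable_funB => //; exact: measurable_cutoff].
have val s z : cutoff s \1_O z = 0 \/ cutoff s \1_O z = 1.
  by rewrite /cutoff !indicE; case: (_ \in _); case: (_ \in _); rewrite ?mulr1 ?mul0r ?mulr0; [right|left|left|left].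
have small : tends0 (fun n => sqn3 (loss n)).
  apply: (@sq_dct _ _ _ mu3 (fun z => wt z.2.2) loss (cutoff 0 \1_O)) => //.
  - exact: measurable_wt3.
  - by move=> z; exact: wt_ge0.
  - exact: measurable_cutoff.
  - move=> n z; rewrite /loss normrM.
    by have [->|->] := val (sg n) z; rewrite ?subr0 ?subrr ?normr1 ?normr0 ?mulr1 ?mulr0.
  - move=> [c [b a]] _; have [h|h] := val 0 (c, (b, a)).
      by rewrite (_ : (fun n => loss n _) = fun=> 0); [exact: cvg_cst|apply/funext => n; rewrite /loss h mul0r].
    have [cM zO] : c \in symitv M /\ tau 0 c (b, a) \in O.
      move: h; rewrite /cutoff !indicE; case: (_ \in _); case: (_ \in _) => //=; rewrite ?mul0r ?mulr0 => /eqP;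
      by rewrite eq_sym oner_eq0.
    have hO : \forall n \near \oo, O (tau (sg n) c (b, a)).
      have nO : nbhs ((b - c) / (1 + 0 * c), a / (1 + 0 * c)) O.
        by apply: open_nbhs_nbhs; split=> //; rewrite inE in zO.
      have H := @cvg_tau c b a; exact: (H _ nO).
    apply: cvg_near_cst; move: hO; apply: filterS => n hn.
    by rewrite /loss /cutoff !indicE cM mul1r (mem_set hn) mulr1 subrr mulr0.
  - by rewrite -/(sqn3 _) sqn3_cutoff // lte_mul_pinfty // lee_fin mulr_ge0 // ltW.
apply: (tends0_le (tends0M (k := 2) _ small)) => // n.
have I_fin : sqn3 (cutoff 0 \1_O) \is a fin_num.
  rewrite ge0_fin_numE ?sqn3_ge0 // sqn3_cutoff // lte_mul_pinfty // lee_fin mulr_ge0 // ltW //.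
have cutE : sqn3 (cutoff 0 \1_O) = sqn3 (cutoff (sg n) \1_O) by rewrite !sqn3_cutoff.
(* For x, y in {0, 1} one has (y - x)^2 + x^2 = 2 (x (1 - y))^2 + y^2. The masses of x^2 and y^2
   agree and are finite, so they cancel. *)
rewrite -(leeD2rE _ _ I_fin) {2}cutE.
have mc s := measurable_sqn3 (measurable_cutoff s mO).
have md : measurable_fun setT (fun z => ((cutoff (sg n) \1_O z - cutoff 0 \1_O z) ^+ 2 * wt z.2.2)%:E).
  by apply: measurable_sqn3; apply: measurable_funB; exact: measurable_cutoff.
have ml := measurable_sqn3 (mloss n).
have p0 (x : T1 * T2 -> R) z : (0 <= (x z ^+ 2 * wt z.2.2)%:E)%E by rewrite lee_fin mulr_ge0 ?sqr_ge0 ?wt_ge0.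
have pd z : (0 <= ((cutoff (sg n) \1_O z - cutoff 0 \1_O z) ^+ 2 * wt z.2.2)%:E)%E.
  by rewrite lee_fin mulr_ge0 ?sqr_ge0 ?wt_ge0.
rewrite /osc /sqn3 -ge0_integralD // -ge0_integralZl_EFin // -ge0_integralD //; last 2 first.
- by move=> z _; rewrite mule_ge0.
- by apply: emeasurable_funM => //; exact: measurable_cst.
rewrite le_eqVlt; apply/orP; left; apply/eqP; apply: eq_integral => z _.
rewrite -EFinM -!EFinD; congr EFin; rewrite /loss.
by have [->|->] := val (sg n) z; have [->|->] := val 0 z; ring.
Qed.

Lemma rsqn_le (phi psi : T2 -> R) : (forall p, `|phi p| <= `|psi p|) -> (rsqn phi <= rsqn psi)%E.
Proof.
move=> h; apply: ge0_le_integral_nonmeasurable => p; first by rewrite lee_fin mulr_ge0 ?sqr_ge0 ?wt_ge0.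
rewrite lee_fin ler_wpM2r ?wt_ge0 // -(real_normK (num_real (phi p))) -(real_normK (num_real (psi p))).
by rewrite ler_sqr ?nnegrE.
Qed.

(** Dominated pointwise convergence gives approximation in the weighted L^2, so [cvgosc_limit]
    applies. *)
Lemma cvgosc_pointwise (u : nat -> T2 -> R) (phi v : T2 -> R) : measurable_fun setT phi ->
  measurable_fun setT v -> (forall n, cvgosc (u n)) -> (forall n p, `|phi p - u n p| <= `|v p|) ->
  (rsqn v < +oo)%E -> (forall p, p.2 != 0 -> u n p @[n --> \oo] --> phi p) -> cvgosc phi.
Proof.
move=> mphi mv hu uv fv cu; apply: cvgosc_limit => // e e0.
have t : tends0 (fun n => rsqn (phi \- u n)%R).
  apply: (@sq_dct _ _ _ lebesgue2 (fun p => wt p.2) (fun n => phi \- u n)%R v) => //.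
  - by apply: (measurableT_comp measurable_wt).
  - by move=> p; exact: wt_ge0.
  - by move=> n; apply: measurable_funB => //; have [] := hu n.
  - move=> p; have [->|p0 _] := eqVneq p.2 0; first by rewrite wt0 eqxx.
    rewrite -(subrr (phi p)); apply: cvgB; first exact: cvg_cst.
    exact: cu.
have [n hn] := filter_ex (t e e0).
by exists (u n).
Qed.

(** Intersecting with a fixed open [X] of finite mass keeps complements in the class, as the
    indicator of [X] minus that of [B] within [X]. *)
Lemma cvgosc_indic (X A : set (R * R)) : open X -> (rsqn \1_X < +oo)%E -> measurable (A : set T2) ->
  cvgosc \1_(A `&` X).
Proof.
move=> oX fX mA.
have mX := open_measurable2 oX.
have fin (B : set (R * R)) : (rsqn \1_(B `&` X) < +oo)%E.
  apply: le_lt_trans fX; apply: rsqn_le => p; rewrite indicI /= !indicE.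
  by case: (_ \in _); rewrite ?mul1r ?mul0r ?normr0.
have mI (B : set (R * R)) : measurable (B : set T2) -> measurable_fun [set: T2] (\1_(B `&` X) : T2 -> R).
  by move=> mB; apply: measurable_indic; exact: measurableI.
have := @measurable_prod_open R; move=> E.
have mA' : <<s @open (R * R)%type >> A by rewrite -E.
apply: (@dynkin_induction _ (R * R)%type open (fun B => cvgosc \1_(B `&` X)) E _ _ _ _ _ _ mA').
- by move=> B C; exact: openI.
- by rewrite setTI; exact: cvgosc_open.
- by move=> B oB; apply: cvgosc_open => //; exact: openI.
- move=> B mB hB; have := cvgoscB (cvgosc_open oX fX) hB.
  rewrite (_ : _ \- _ = \1_(~` B `&` X)) //; apply/funext => p; rewrite !indicI /= !indicE in_setC.
  by case: (p \in B); case: (p \in X); rewrite /= ?mulr1 ?mulr0 ?subr0 ?subrr.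
- move=> F mF tF hF.
  have mU := bigcup_measurable (fun k (_ : setT k) => mF k).
  (* By disjointness at most one [F k] contains [p], so the partial sums jump once from 0 to 1. *)
  have cases p : (forall n, \1_(F n `&` X) p = 0 :> R) /\ \1_((\bigcup_k F k) `&` X) p = 0 :> R \/
      exists k, [/\ \1_X p = 1 :> R, \1_((\bigcup_k F k) `&` X) p = 1 :> R &
        forall i, \1_(F i `&` X) p = (i == k)%:R :> R].
    have [Xp|Xp] := boolP (p \in X); last first.
      by left; split=> [n|]; rewrite indicI /= !indicE (negbTE Xp) mulr0.
    have [[k Fk]|nF] := pselect (exists k, F k p).
      right; exists k; split; first by rewrite indicE Xp.
        by rewrite indicI /= !indicE Xp (mem_set (_ : (\bigcup_k F k) p)) ?mulr1 //; exists k.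
      move=> i; rewrite indicI /= !indicE Xp mulr1; have [->|ik] := eqVneq i k; first by rewrite mem_set.
      rewrite memNset // => Fi; move/eqP: ik; apply; apply: (tF i k) => //; by exists p.
    left; split=> [n|]; rewrite indicI /= !indicE memNset ?mul0r //.
      by move=> Fn; apply: nF; exists n.
    by move=> [k _ Fk]; apply: nF; exists k.
  have sumE p k n : (forall i, \1_(F i `&` X) p = (i == k)%:R :> R) ->
      \sum_(i < n) \1_(F i `&` X) p = (k < n)%:R :> R.
    move=> h; under eq_bigr do rewrite h.
    have [kn|nk] := ltnP k n.
      by rewrite (bigD1 (Ordinal kn)) //= eqxx big1 ?addr0 // => j /negbTE; rewrite -val_eqE /= => ->.
    by rewrite big1 // => j _; rewrite (ltn_eqF (leq_trans (ltn_ord j) nk)).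
  apply: (@cvgosc_pointwise (fun n p => \sum_(i < n) \1_(F i `&` X) p) _ \1_X).
  + exact: mI.
  + exact: measurable_indic.
  + by move=> n; apply: cvgosc_sum => i; exact: hF.
  + move=> n p; have [[h0 ->]|[k [-> -> h]]] := cases p.
      by rewrite big1 // subrr normr0.
    by rewrite (sumE _ _ _ h); case: (_ < _)%N; rewrite /= ?subrr ?subr0 ?normr0 ?normr1.
  + exact: fX.
  + move=> p _; have [[h0 ->]|[k [_ -> h]]] := cases p.
      by rewrite (_ : (fun n => _) = fun=> 0); [exact: cvg_cst|apply/funext => n; rewrite big1].
    apply: cvg_near_cst; near=> n; rewrite (sumE _ _ _ h).
    suff -> : (k < n)%N by [].
    by near: n; exact: nbhs_infty_gt.
Unshelve. all: end_near. Qed.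

(** An open exhaustion of a != 0 by sets of finite mass: the lower bound on |a| controls 1/a^2, and
    [N.+1] keeps the inverse meaningful at [N = 0]. *)
Definition box N : set (R * R) := [set p | [/\ `|p.1| < N.+1%:R, `|p.2| < N.+1%:R & N.+1%:R^-1 < `|p.2|]].

Lemma open_box N : open (box N).
Proof.
have c1 : continuous (fun p : R * R => `|p.1|) by move=> p; apply: cvg_norm; exact: cvg_fst.
have c2 : continuous (fun p : R * R => `|p.2|) by move=> p; apply: cvg_norm; exact: cvg_snd.
have -> : box N = ((fun p : R * R => `|p.1|) @^-1` [set x | x < N.+1%:R]) `&`
   (((fun p : R * R => `|p.2|) @^-1` [set x | x < N.+1%:R]) `&`
   ((fun p : R * R => `|p.2|) @^-1` [set x | N.+1%:R^-1 < x])).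
  by apply/seteqP; split => [p [? ? ?]|p [? [? ?]]].
apply: openI; last apply: openI.
- by apply: open_comp => [p _|]; [exact: c1|exact: open_lt].
- by apply: open_comp => [p _|]; [exact: c2|exact: open_lt].
- by apply: open_comp => [p _|]; [exact: c2|exact: open_gt].
Qed.

Lemma rsqn_box N : (rsqn \1_(box N) < +oo)%E.
Proof.
pose K : R := N.+1%:R; have K0 : 0 < K by rewrite /K ltr0n.
pose S : set T2 := symitv K `*` symitv K.
have mS : measurable S by apply: measurableX; exact: measurable_symitv.
apply: (@le_lt_trans _ _ (\int[mu2]_p ((K ^+ 2)%:E * (\1_S p)%:E)))%E.
  apply: ge0_le_integral_nonmeasurable => p; first by rewrite lee_fin mulr_ge0 ?sqr_ge0 ?wt_ge0.
  rewrite -EFinM lee_fin indicE; case: (boolP (p \in box N)) => [|_]; last first.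
    by rewrite expr0n mul0r mulr_ge0 ?sqr_ge0 // indicE ler0n.
  rewrite inE => -[h1 h2 h3]; rewrite indicE mem_set; last first.
    by split; rewrite /= /symitv /= in_itv /= -ler_norml ltW.
  rewrite expr1n mul1r mulr1 /wt -exprVn -(real_normK (num_real p.2^-1)) ler_sqr ?nnegrE ?(ltW K0) //.
  have p0 : 0 < `|p.2| by apply: lt_trans h3; rewrite invr_gt0.
  by rewrite normfV -[leRHS]invrK lef_pV2 ?posrE ?invr_gt0 // ltW.
rewrite ge0_integralZl_EFin ?sqr_ge0 //; last by apply/measurable_EFinP; exact: measurable_indic.
have -> : (\int[mu2]_p (\1_S p)%:E = mu2 S)%E by rewrite integral_indic // setIT.
rewrite /S product_measure1E; [|exact: measurable_symitv|exact: measurable_symitv].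
by rewrite /= !lebesgue_symitv // -!EFinM ltry.
Qed.

Lemma box_cover (p : R * R) : p.2 != 0 -> \forall N \near \oo, box N p.
Proof.
move=> p0; have q0 : 0 < `|p.2| by rewrite normr_gt0.
near=> N; have hN : `|p.1| + `|p.2| + `|p.2|^-1 < N.+1%:R.
  apply: (@lt_trans _ _ N%:R); last by rewrite ltr_nat.
  by near: N; exact: nbhs_infty_gtr.
have i0 : 0 < `|p.2|^-1 by rewrite invr_gt0.
have n1 := normr_ge0 p.1.
split; try lra.
rewrite -[ltRHS]invrK ltf_pV2 ?posrE ?ltr0n //; lra.
Unshelve. all: end_near. Qed.

(** Simple functions increasing to [phi], cut to the boxes, are combinations of indicators of finite
    mass; the cut makes them converge where a != 0, with [phi] as majorant. *)
Lemma cvgosc_ge0 (phi : T2 -> R) : measurable_fun setT phi -> (forall p, 0 <= phi p) ->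
  (rsqn phi < +oo)%E -> cvgosc phi.
Proof.
move=> mphi phi0 fphi.
have mE : measurable_fun setT (EFin \o phi) by exact/measurable_EFinP.
pose ap := nnsfun_approx measurableT mE.
have ap_le n p : ap n p <= phi p.
  by rewrite nnsfun_approxE -lee_fin; apply: (@le_approx _ _ _ setT (EFin \o phi)) => // q _; rewrite lee_fin.
have ap_ge0 n p : 0 <= ap n p by exact: fun_ge0.
apply: (@cvgosc_pointwise (fun n p => \1_(box n) p * ap n p) phi phi) => //.
- move=> n.
  have [r hr] : exists r : seq R, forall p, ap n p = \sum_(y <- r) y * \1_(ap n @^-1` [set y]) p.
    by eexists => p; rewrite fimfunE fsbig_finite //=; reflexivity.
  rewrite (_ : (fun p => _) = fun p => \sum_(y <- r) y * \1_((ap n @^-1` [set y]) `&` box n) p).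
    apply: cvgosc_sum => y; apply: cvgoscZ; apply: cvgosc_indic; [exact: open_box|exact: rsqn_box|].
    exact: measurable_funPTI.
  apply/funext => p; rewrite hr mulr_sumr; apply: eq_bigr => y _.
  by rewrite indicI /= mulrCA [in RHS](mulrC (\1_(_ @^-1` _) p)).
- move=> n p; rewrite indicE (ger0_norm (phi0 p)); case: (_ \in _).
    by rewrite mul1r ger0_norm ?subr_ge0 // lerBlDr lerDl.
  by rewrite mul0r subr0 ger0_norm.
move=> p p0; rewrite -[phi p]mul1r; apply: cvgM.
  apply: cvg_near_cst; apply: filterS (box_cover p0) => n hn; by rewrite indicE mem_set.
have := @cvg_nnsfun_approx _ _ R setT measurableT _ mE (fun q _ => phi0 q : (0 <= (EFin \o phi) q)%E) p I.
by move=> /fine_cvgP[_].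
Qed.

Lemma cvgosc_L2 (phi : T2 -> R) : measurable_fun setT phi -> (rsqn phi < +oo)%E -> cvgosc phi.
Proof.
move=> mphi fphi.
have mn : measurable_fun setT (fun p => `|phi p|) by exact: measurableT_comp.
pose pos := fun p => 2^-1 * (`|phi p| + phi p); pose neg := fun p => 2^-1 * (`|phi p| - phi p).
have h p : - `|phi p| <= phi p <= `|phi p| by rewrite -ler_norml.
have -> : phi = pos \- neg by apply/funext => p; rewrite /pos /neg /=; lra.
apply: cvgoscB; apply: cvgosc_ge0.
- by apply: measurable_funM => //; exact: measurable_funD.
- by move=> p; rewrite /pos; have /andP[] := h p; lra.
- apply: le_lt_trans fphi; apply: rsqn_le => p; have /andP[h1 h2] := h p.
  by rewrite /pos ger0_norm; lra.
- by apply: measurable_funM => //; exact: measurable_funB.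
- by move=> p; rewrite /neg; have /andP[] := h p; lra.
- apply: le_lt_trans fphi; apply: rsqn_le => p; have /andP[h1 h2] := h p.
  by rewrite /neg ger0_norm; lra.
Qed.

End StrongContinuity.

(** * Lower semicontinuity along sequences *)

Section LowerSemicontinuity.
Context {R : realType}.
Implicit Types (f g : R * R -> R[i]).
Local Notation mu1 := (@lebesgue_measure R).
Local Notation T1 := (measurableTypeR R).
Local Notation T2 := (measurableTypeR R * measurableTypeR R)%type.
Local Notation mu3 := (mu1 \x lebesgue2)%E.
Local Notation normc := (@ComplexField.Normc.normc R).

Lemma tends0_L2norm (X : nat -> T2 -> R[i]) : tends0 (fun n => sqn (X n)) -> tends0 (fun n => L2norm (X n)).
Proof.
move=> h e e0; apply: filterS (h (e ^+ 2) _) => [n hn|]; last by rewrite exprn_gt0.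
rewrite L2normE.
have -> : e%:E = ((e ^+ 2)%:E `^ 2^-1)%E.
  by rewrite poweR_EFin powR12_sqrt ?sqr_ge0 // sqrtr_sqr gtr0_norm.
by apply: gt0_ler_poweR; rewrite ?invr_ge0 // in_itv /= ?leey ?andbT ?sqn_ge0 // lee_fin sqr_ge0.
Qed.

Section AlongSequence.
Variables (f g : R * R -> R[i]) (M : R) (sg : nat -> R).
Hypotheses (hf : testfun 0 f) (fM : forall p, M < `|p.1| -> f p = 0).
Hypotheses (mg : cmeas (g : T2 -> R[i])) (lg : (sqn g < +oo)%E).
Hypotheses (M0 : 0 < M) (sg0 : sg n @[n --> \oo] --> (0 : R)) (sgM : forall n, `|sg n| * M <= 2^-1).

(** [cker s f g] without its factor in [g]: continuous in [s] and uniformly bounded, while the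
    factor in [g] converges only in L^2. *)
Definition coef s (z : T1 * T2) : R[i] := (`|1 + s * z.1|^-1)%:C * f (z.1, z.2.2 + s * (z.1 - z.2.1)).

Lemma cmeas_coef s : cmeas (coef s).
Proof.
apply: (@cmeasM _ _ _ (fun z : T1 * T2 => (`|1 + s * z.1|^-1)%:C)).
  exact: (cmeas_real (measurable_onepinv s)).
apply: (cmeas_comp (measurable_hline s) (F := f : T2 -> R[i])).
exact: continuous_cmeas (testfun_smooth hf).
Qed.

Lemma coef_bound A s z : (forall p, normc (f p) <= A) -> `|s| * M <= 2^-1 ->
  normc (coef s z) <= 2 * A * \1_(symitv M) z.1.
Proof.
move=> hA sM; rewrite /coef indicE in_symitv; have [zM|zM] := leP `|z.1| M; last first.
  by rewrite fM // [X in normc X]mulr0 ComplexField.Normc.normc0 mulr0.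
have /andP[k1 _] := onepsc sM zM.
rewrite mulr1 normcM normc_real ler_pM ?normc_ge0 // ger0_norm ?invr_ge0 //.
by rewrite -[leRHS]invrK lef_pV2 ?posrE ?normr_gt0; first [rewrite (le_trans k1) // ler_norm|lra].
Qed.

Lemma coef_cvg z : normc (coef (sg n) z - coef 0 z) @[n --> \oo] --> (0 : R).
Proof.
case: z => c [b a]; have [A [A0 hA]] := testfun_bounded hf; have [L [L0 hL]] := testfun_lipschitz hf.
pose bd n := `| `|1 + sg n * c|^-1 - 1| * A + L * `|sg n * (c - b)|.
have cbd : bd n @[n --> \oo] --> (0 : R).
  have -> : 0 = `|( `|1 + 0 * c|^-1 - 1 : R)| * A + L * `|0 * (c - b)| :> R.
    by rewrite !mul0r addr0 normr1 invr1 subrr !normr0 mul0r mulr0 addr0.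
  apply: cvgD.
    apply: cvgM; last exact: cvg_cst.
    apply: cvg_norm; apply: cvgB; last exact: cvg_cst.
    apply: cvgV; first by rewrite mul0r addr0 normr1 oner_neq0.
    apply: cvg_norm; apply: cvgD; first exact: cvg_cst.
    by apply: cvgM => //; exact: cvg_cst.
  apply: cvgM; first exact: cvg_cst.
  by apply: cvg_norm; apply: cvgM => //; exact: cvg_cst.
apply: (@squeeze_cvgr _ _ _ _ (fun=> 0) bd); [|exact: cvg_cst|exact: cbd].
apply: nearW => n; rewrite normc_ge0 /= /coef /= !mul0r !addr0 normr1 invr1 mul1r.
set x := f (c, a + _); set k := `|_|^-1.
have -> : k%:C * x - f (c, a) = (k - 1)%:C * x + (x - f (c, a)).
  by rewrite rmorphB rmorph1 mulrBl mul1r addrA subrK.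
rewrite (le_trans (normcD _ _)) // lerD // ?normcM ?normc_real ?ler_wpM2l //; first exact: hA.
by rewrite (le_trans (hL _ _)) //= subrr normr0 add0r addrAC subrr add0r.
Qed.

Lemma strong_cvg : tends0 (fun n => L2norm (Cint (cker 0 f g \- cker (sg n) f g))).
Proof.
have [A [A0 hA]] := testfun_bounded hf.
have mf := continuous_cmeas (testfun_smooth hf).
have s00 : `|0 : R| * M <= 2^-1 by rewrite normr0 mul0r.
have half : (0 : R) < 2^-1 by rewrite invr_gt0.
have dom s : `|s| * M <= 2^-1 -> L2dom M (cker s f g).
  move=> sM; apply: (L2dom_cker M0 half A0 mf hA fM _ mg lg) => c cM.
  by have /andP[] := onepsc sM cM.
apply: tends0_L2norm.
apply: (tends0_le (v := fun n => (4 * M)%:E * sqn3 (fun z : T1 * T2 => normc ((cker 0 f g \- cker (sg n) f g)%R z)))%E); last first.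
  by move=> n; apply: sqn_Cint_le => //; apply: L2domB; apply: dom.
apply: tends0M; first by rewrite mulr_ge0 // ltW.
have [m1 m2] := mg; have mn := cmeas_normc mg.
have o1 : cvgosc M sg (re g).
  apply: cvgosc_L2 => //; apply: le_lt_trans lg; apply: (@rsqn_le _ _ (fun p => normc (g p))) => p.
  by rewrite (ger0_norm (normc_ge0 _)); exact: Re_le_normc.
have o2 : cvgosc M sg (im g).
  apply: cvgosc_L2 => //; apply: le_lt_trans lg; apply: (@rsqn_le _ _ (fun p => normc (g p))) => p.
  by rewrite (ger0_norm (normc_ge0 _)); exact: Im_le_normc.
pose d (phi : T2 -> R) (n : nat) (z : T1 * T2) : R := cutoff M (sg n) phi z - cutoff M 0 phi z.
have md phi n : measurable_fun setT phi -> measurable_fun setT (d phi n).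
  by move=> mphi; apply: measurable_funB; exact: measurable_cutoff.
pose u2 (n : nat) (z : T1 * T2) : R := normc (coef (sg n) z - coef 0 z) * cutoff M 0 (fun p => normc (g p)) z.
have mu2 n : measurable_fun setT (u2 n).
  apply: measurable_funM; last exact: measurable_cutoff.
  by apply: cmeas_normc; apply: cmeasB; exact: cmeas_coef.
pose u1 (n : nat) (z : T1 * T2) : R := `|d (re g) n z| + `|d (im g) n z|.
have mu1' n : measurable_fun setT (u1 n).
  by apply: measurable_funD; apply: measurableT_comp => //; exact: md.
have b n : (sqn3 (fun z : T1 * T2 => normc ((cker 0 f g \- cker (sg n) f g)%R z)) <=
    2%:E * (sqn3 (fun z => (2 * A * u1 n z)%R) + sqn3 (u2 n)))%E.
  apply: sqn3_le_add => //; first exact: measurable_funM.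
  move=> z; rewrite ger0_norm ?normc_ge0 //= -(@normcN R) opprB.
  (* The first summand is a bounded coefficient times an oscillation of [g]; in the second [g] is
     frozen and dominated convergence applies. *)
  have -> : cker (sg n) f g z - cker 0 f g z = coef (sg n) z * (g (tau (sg n) z.1 z.2) - g (tau 0 z.1 z.2)) +
     (coef (sg n) z - coef 0 z) * g (tau 0 z.1 z.2).
    by rewrite /cker -!/(coef _ z) mulrBr mulrBl addrA subrK.
  rewrite (le_trans (normcD _ _)) // lerD //.
    rewrite normcM (le_trans (ler_wpM2r (normc_ge0 _) (coef_bound z hA (sgM n)))) //.
    apply: (le_trans _ (ler_norm _)); rewrite -(mulrA (2 * A)) ler_wpM2l ?mulr_ge0 //.
    rewrite /u1 /d /cutoff -!mulrBr !normrM.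
    have i0 : 0 <= \1_(symitv M) z.1 :> R by rewrite indicE ler0n.
    rewrite (ger0_norm i0) -mulrDr ler_wpM2l //.
    by rewrite (le_trans (normc_le_ReIm _)) // cReB cImB.
  apply: (le_trans _ (ler_norm _)); rewrite normcM /u2 /cutoff indicE in_symitv; have [zM|zM] := leP `|z.1| M.
    by rewrite mul1r.
  have c0 s : coef s z = 0 by rewrite /coef fM // mulr0.
  by rewrite !c0 subrr ComplexField.Normc.normc0 !mul0r.
apply: (tends0_le _ b); apply: tends0M => //; apply: tends0D.
  have H := tends0M (k := (2 * A) ^+ 2) (sqr_ge0 _) (tends0M (k := 2) (ler0n _ 2) (tends0D o1.2 o2.2)).
  apply: (tends0_le H) => n.
  apply: (le_trans (sqn3_le (mu1' n) (K := 2 * A) _ _)); first by rewrite mulr_ge0.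
    by move=> z; rewrite normrM (ger0_norm (mulr_ge0 _ A0)).
  apply: lee_wpmul2l; first by rewrite lee_fin sqr_ge0.
  apply: sqn3_le_add; [exact: md|exact: md|move=> z].
  by rewrite ger0_norm // addr_ge0.
apply: (@sq_dct _ _ _ mu3 (fun z => wt z.2.2) u2 (fun z => 4 * A * cutoff M 0 (fun p => normc (g p)) z)) => //.
- exact: measurable_wt3.
- by move=> z; exact: wt_ge0.
- by apply: measurable_funM => //; exact: measurable_cutoff.
- move=> n z; rewrite !normrM ler_wpM2r // ger0_norm ?normc_ge0 // (ger0_norm A0) ger0_norm //.
  have i1 : \1_(symitv M) z.1 <= 1 :> R by rewrite indicE lern1 leq_b1.
  have A2 : 0 <= 2 * A by rewrite mulr_ge0.
  have h1 := le_trans (coef_bound z hA (sgM n)) (ler_piMr A2 i1).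
  have h2 := le_trans (coef_bound z hA s00) (ler_piMr A2 i1).
  by rewrite (le_trans (normcB _ _)) // (le_trans (lerD h1 h2)) //; lra.
- move=> z _; rewrite /u2 -[X in _ --> X](mul0r (cutoff M 0 (fun p => normc (g p)) z)).
  by apply: cvgM; [exact: coef_cvg|exact: cvg_cst].
rewrite -/(sqn3 (fun z => 4 * A * cutoff M 0 (fun p => normc (g p)) z)).
apply: (le_lt_trans (sqn3_le (v := cutoff M 0 (fun p => normc (g p))) (K := 4 * A) _ _ _)).
- exact: measurable_cutoff.
- by rewrite mulr_ge0.
- by move=> z; rewrite normrM (ger0_norm (mulr_ge0 _ A0)).
by rewrite sqn3_cutoff // lte_mul_pinfty ?lee_fin ?sqr_ge0 // lte_mul_pinfty // lee_fin mulr_ge0 // ltW.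
Qed.

End AlongSequence.

(** A test vector whose image at parameter 0 has norm above [x] is fixed. Were the claim false,
    parameters tending to 0 with norms at most [x] would, by [strong_cvg], bound that image by [x]
    too. *)
Lemma opnorm_lsc0 f (x : R) : testfun 0 f -> (x%:E < opnorm 0 (Q 0 f))%E ->
  \forall s \near within [set s | domQ s f] (nbhs (0 : R)), (x%:E < opnorm s (Q s f))%E.
Proof.
move=> hf; rewrite (Q_id (domQ0 hf)) => /ereal_sup_gt[_ [g [Lg g1] <-] xg].
have [M [e [M0 e0 bf]]] := testfun_boxed hf.
have [A [A0 hA]] := testfun_bounded hf; have mf := continuous_cmeas (testfun_smooth hf).
have fM p : M < `|p.1| -> f p = 0 by move=> h; rewrite (boxedW bf) //; left.
apply: contrapT => nF.
(* The condition [0 < d] stands inside the existential so that [choice] applies to a total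
   relation. *)
have H (d : R) : exists s, 0 < d -> [/\ `|s| < d, domQ s f & (opnorm s f <= x%:E)%E].
  apply: contrapT => /forallNP nE; apply: nF.
  have d0 : 0 < d by have := nE 0; apply: contra_notP => h /h.
  rewrite near_withinE; apply/nbhs_ballP; exists d => // s; rewrite /ball /= sub0r normrN => sd ds.
  rewrite Q_id //= ltNge; apply/negP => h; by apply: (nE s).
(* The first bound forces [sg] to 0, the second gives [|sg n| * M <= 2^-1] for every [n]. *)
have [sg Hsg] := choice (fun n : nat => H (Num.min n.+1%:R^-1 (2 * M)^-1)).
have dn (n : nat) : 0 < Num.min n.+1%:R^-1 (2 * M)^-1 :> R.
  by rewrite lt_min !invr_gt0 ltr0n mulr_gt0.
have sgM n : `|sg n| * M <= 2^-1.
  have [+ _ _] := Hsg n (dn n); rewrite lt_min => /andP[_ h].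
  by rewrite -ler_pdivlMr // -invfM ltW.
have sg0 : sg n @[n --> \oo] --> (0 : R).
  apply/norm_cvg0P; apply: (@squeeze_cvgr _ _ _ _ (fun=> 0) (@harmonic R)); [|exact: cvg_cst|exact: cvg_harmonic].
  by apply: nearW => n; rewrite normr_ge0 /=; have [+ _ _] := Hsg n (dn n); rewrite lt_min => /andP[/ltW].
have [mg lg] := L2_patch0 Lg.
have s00 : `|0 : R| * M <= 2^-1 by rewrite normr0 mul0r.
have half : (0 : R) < 2^-1 by rewrite invr_gt0.
have dom s : `|s| * M <= 2^-1 -> L2dom M (cker s f (patch0 g)).
  move=> sM; apply: (L2dom_cker M0 half A0 mf hA fM _ mg lg) => c cM.
  by have /andP[] := onepsc sM cM.
have T := strong_cvg hf fM mg lg M0 sg0 sgM.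
move: xg; apply/negP; rewrite -leNgt; apply/lee_addgt0Pr => d d0.
have [n hn] := filter_ex (T d d0).
rewrite -L2norm_convol_patch0 convol_Cint.
apply: (le_trans (L2norm_Cint_triangle M0 (dom 0 s00) (dom (sg n) (sgM n)))).
apply: leeD => //; rewrite -convol_Cint L2norm_convol_patch0.
have [_ _ +] := Hsg n (dn n); apply: le_trans; apply: ereal_sup_ubound; by exists g.
Qed.

End LowerSemicontinuity.

Theorem proposition6p3 (R : realType) (f g : R * R -> R[i])
    (hf : testfun 0 f) (hg : testfun 0 g) :
  (domQ 0 f /\ Q 0 f = f) /\
  (opnorm s (Q s (star 0 f) \- star s (Q s f)) @[s --> (0 : R)^'] --> 0%E) /\
  (opnorm s (convol s (Q s f) (Q s g) \- Q s (convol 0 f g))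
     @[s --> (0 : R)^'] --> 0%E) /\
  (opnorm s ((fun p => (s^-1)%:C * convol_comm s (Q s f) (Q s g) p)
               \- Q s (bracket f g)) @[s --> (0 : R)^'] --> 0%E) /\
  ((forall s0 : R, domQ s0 f -> s0 != 0 ->
      opnorm s (Q s f) @[s --> within [set s | domQ s f] (nbhs s0)]
        --> opnorm s0 (Q s0 f)) /\
   (forall x : R, (x%:E < opnorm 0 (Q 0 f))%E ->
      \forall s \near within [set s | domQ s f] (nbhs (0 : R)),
        (x%:E < opnorm s (Q s f))%E)).
Proof.
split; first by split; [exact: domQ0|exact/Q_id/domQ0].
split; first exact: star_defect_cvg0.
split; first exact: product_defect_cvg0.
split; first exact: commutator_defect_cvg0.
by split=> [s0|x]; [exact: opnorm_continuous_away|exact: opnorm_lsc0].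
Qed.
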